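(* Let $n,k\ge 1$ be integers and $s\in(0,1)$. Let $\omega^n\subset\mathbb{R}^n$ be a bounded Lipschitz domain and let $B^k_1\subset\mathbb{R}^k$ be a bounded, open and convex neighbourhood of the origin. For $\ell\in(0,\infty)$ put $B^k_\ell=\ell B^k_1$, $\Omega^{n+k}_\ell=\omega^n\times B^k_\ell\subset\mathbb{R}^{n+k}$, and put $\Omega^{n+k}_\infty=\omega^n\times\mathbb{R}^k$. Let $\lambda^s(\cdot)$ denote the Poincaré constant of the Dirichlet fractional Laplacian of order $s$ (defined in the context). Then for any $\ell\in(0,\infty)$: (i) $\lambda^s(\Omega^{n+k}_\infty)=\lambda^s(\omega^n)$; (ii) $\lambda^s(\omega^n)<\lambda^s(\Omega^{n+k}_\ell)<\lambda^s(\omega^n)+\dfrac{\lambda^s(B^k_1)}{\ell^{2s}}$. In particular, $\displaystyle\lim_{\ell\to\infty}\lambda^s(\Omega^{n+k}_\ell)=\lambda^s(\omega^n)$.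
   Context: All functions are real-valued. For an integer $d\ge1$ and $s\in(0,1)$, define for $u\in L^2(\mathbb{R}^d)$ $$\mathcal{E}^s_d(u)=\frac{C_{d,s}}{2}\iint_{\mathbb{R}^d\times\mathbb{R}^d}\frac{(u(z)-u(\eta))^2}{|z-\eta|^{d+2s}}\,dz\,d\eta,\qquad C_{d,s}=\frac{s2^{2s}}{\Gamma(1-s)}\frac{\Gamma\left(\frac{d+2s}{2}\right)}{\pi^{d/2}};$$ equivalently $\mathcal{E}^s_d(u)=\langle(-\Delta_{\mathbb{R}^d})^su,u\rangle=\int_{\mathbb{R}^d}|\xi|^{2s}|\mathcal{F}_d[u](\xi)|^2\,d\xi$, where $\mathcal{F}_d$ is the unitary Fourier transform on $\mathbb{R}^d$ (with kernel $e^{-iz\cdot\xi}$). $H^s(\mathbb{R}^d)=\{u\in L^2(\mathbb{R}^d): \mathcal{E}^s_d(u)<\infty\}$. For a (possibly unbounded) Lipschitz domain $U\subset\mathbb{R}^d$, $$\widetilde H^s(U)=\{u\in H^s(\mathbb{R}^d): u\equiv 0 \text{ on } \mathbb{R}^d\setminus\overline U\},\qquad \lambda^s(U)=\inf_{u\in\widetilde H^s(U),\,u\ne0}\frac{\mathcal{E}^s_d(u)}{\|u\|^2_{L^2(U)}}.$$ *)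

(* Defs.v *)
From HB Require Import structures.
From mathcomp Require Import all_boot all_order all_algebra.
From mathcomp Require Import all_classical all_reals all_analysis.

Set Implicit Arguments.
Unset Strict Implicit.
Unset Printing Implicit Defensive.

Import Order.TTheory GRing.Theory Num.Theory.
Import numFieldNormedType.Exports.

Local Open Scope classical_set_scope.
Local Open Scope ring_scope.

Definition rV_display : measure_display. Proof. exact: default_measure_display. Qed.

(* The product sigma-algebra, generated by the coordinates; by
   [open_measurable_rV] it is the Borel sigma-algebra. *)
Section measurable_rV.
Variables (R : realType) (d : nat).

Let coord : 'I_d -> 'rV[R]_d -> measurableTypeR R := fun i x => x 0 i.

Let rV_set0 : g_sigma_preimage coord set0.
Proof. exact: sigma_algebra0. Qed.

Let rV_setC A : g_sigma_preimage coord A -> g_sigma_preimage coord (~` A).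
Proof. exact: sigma_algebraC. Qed.

Let rV_bigcup (F : _^nat) : (forall i, g_sigma_preimage coord (F i)) ->
  g_sigma_preimage coord (\bigcup_i (F i)).
Proof. exact: sigma_algebra_bigcup. Qed.

HB.instance Definition _ := @isMeasurable.Build rV_display
  'rV[R]_d (g_sigma_preimage coord) rV_set0 rV_setC rV_bigcup.

Lemma measurable_coord_rV (i : 'I_d) :
  measurable_fun setT (fun x : 'rV[R]_d => x 0 i : measurableTypeR R).
Proof.
move=> _ Y mY; rewrite setTI; apply: sub_sigma_algebra => /=.
rewrite -bigcup_seq/=; exists i => /=; first by rewrite mem_index_enum.
by exists Y => //; rewrite setTI.
Qed.

Lemma measurable_fun_rVP dT (T : measurableType dT) (f : T -> 'rV[R]_d) :
  measurable_fun setT f <->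
  forall i, measurable_fun setT (fun t => f t 0 i : measurableTypeR R).
Proof.
split=> [mf i|mf].
  apply: (@measurableT_comp _ _ _ _ _ _
    (fun x : 'rV[R]_d => x 0 i : measurableTypeR R)) => //.
  exact: measurable_coord_rV.
move=> _ A mA; rewrite setTI.
suff: g_sigma_preimage coord `<=` [set B | measurable (f @^-1` B)] by apply.
apply: smallest_sub.
  split => /=.
  - by rewrite preimage_set0.
  - by move=> B mB; rewrite setTD preimage_setC; exact: measurableC.
  - by move=> F mF; rewrite preimage_bigcup; exact: bigcup_measurable.
move=> B; rewrite -bigcup_seq => -[i _] [C mC <-] /=; rewrite setTI.
by have := mf i measurableT _ mC; rewrite setTI.
Qed.

Lemma measurable_box_rV (A : 'I_d -> set (measurableTypeR R)) :
  (forall i, measurable (A i)) ->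
  measurable [set x : 'rV[R]_d | forall i, A i (x 0 i)].
Proof.
move=> mA; rewrite (_ : mkset _ = \big[setI/setT]_(i < d)
    ([set x : 'rV[R]_d | A i (x 0 i)])).
  apply: bigsetI_measurable => i _; rewrite -[X in measurable X]setTI.
  exact: (measurable_coord_rV i).
rewrite -bigcap_seq; apply/seteqP; split => [x Ax i _|x Ax i]; first exact: Ax.
by apply: Ax; rewrite /= mem_index_enum.
Qed.

Lemma open_measurable_rV (A : set 'rV[R]_d) : open A -> measurable A.
Proof.
move=> oA.
pose box (p : 'rV[rat]_d * nat) : set 'rV[R]_d :=
  [set y | forall i, ball (ratr (p.1 0 i) : R) p.2.+1%:R^-1 (y 0 i)].
rewrite (_ : A = \bigcup_(p in [set p | box p `<=` A]) box p).
  rewrite bigcup_mkcond; apply: countable_bigcupT_measurable => [|p].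
    exact: countableP.
  case: ifPn => // _.
  apply: (measurable_box_rV (A := fun i => ball (ratr (p.1 0 i) : R) _)) => i.
  rewrite ball_itv; exact: measurable_itv.
apply/seteqP; split => [x Ax|x [p pA] /pA//].
have /nbhs_ballP[e /= e0 eA] := open_nbhs_nbhs (conj oA Ax).
have [k ke] : exists k : nat, k.+1%:R^-1 < e / 2.
  have [k _ kP] := near_infty_natSinv_lt (PosNum (divr_gt0 e0 (ltr0n _ 2))).
  by exists k; apply: (kP k) => /=.
have k0 : 0 < k.+1%:R^-1 :> R by rewrite invr_gt0.
have /choice[q qP] : forall i, exists q : rat,
    ratr q \in `](x 0 i - k.+1%:R^-1), (x 0 i + k.+1%:R^-1)[.
  by move=> i; apply: rat_in_itvoo; rewrite ltrD2l gtrN.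
have qx i : `|ratr (q i) - x 0 i| < k.+1%:R^-1.
  by have := qP i; rewrite in_itv/= -ltr_distl.
exists (\row_i q i, k) => [y yq|i]; last by rewrite mxE; exact: qx.
apply: eA; split => // i0 i; rewrite (ord1 i0).
suff : `|x 0 i - y 0 i| < e by [].
have := yq i; rewrite mxE /ball/= => yqi.
rewrite (_ : _ - _ = (x 0 i - ratr (q i)) + (ratr (q i) - y 0 i)); last first.
  by rewrite addrA subrK.
rewrite (le_lt_trans (ler_normD _ _))// [e]splitr ltrD//.
  by rewrite distrC (lt_trans (qx i)).
exact: lt_trans yqi ke.
Qed.

End measurable_rV.

(* Lebesgue measure on R^d: the d-fold product of the one on R, obtained by
   transporting products along (x, v) |-> row_mx x%:M v. *)
Definition rV_cons (R : realType) (d : nat) (p : measurableTypeR R * 'rV[R]_d) :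
  'rV[R]_d.+1 := row_mx (p.1%:M : 'rV[R]_1) p.2.

Lemma rV_consE0 (R : realType) (d : nat) (p : measurableTypeR R * 'rV[R]_d) :
  rV_cons p 0 ord0 = p.1.
Proof.
rewrite /rV_cons (_ : ord0 = lshift d (ord0 : 'I_1)); last exact/val_inj.
by rewrite (row_mxEl (p.1%:M : 'rV[R]_1)) mxE eqxx mulr1n.
Qed.

Lemma rV_consES (R : realType) (d : nat) (p : measurableTypeR R * 'rV[R]_d)
    (i : 'I_d) : rV_cons p 0 (lift ord0 i) = p.2 0 i.
Proof.
rewrite /rV_cons (_ : lift ord0 i = rshift 1 i); last exact/val_inj.
by rewrite (row_mxEr (p.1%:M : 'rV[R]_1)).
Qed.

Definition rV_uncons (R : realType) (d : nat) (x : 'rV[R]_d.+1) :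
  measurableTypeR R * 'rV[R]_d := (x 0 ord0, \row_i x 0 (lift ord0 i)).

Lemma rV_consK (R : realType) (d : nat) :
  cancel (@rV_cons R d) (@rV_uncons R d).
Proof.
move=> [x v]; rewrite /rV_uncons rV_consE0; congr pair.
by apply/rowP => i; rewrite mxE rV_consES.
Qed.

Lemma measurable_rV_uncons (R : realType) (d : nat) :
  measurable_fun setT (@rV_uncons R d).
Proof.
apply/measurable_fun_pairP; split; first exact: measurable_coord_rV.
apply/measurable_fun_rVP => i; rewrite /comp /=.
under eq_fun do rewrite mxE.
exact: measurable_coord_rV.
Qed.

Lemma measurable_rV_cons (R : realType) (d : nat) :
  measurable_fun setT (@rV_cons R d).
Proof.
apply/measurable_fun_rVP => i.
case: (unliftP ord0 i) => [j ->|->].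
  under eq_fun do rewrite rV_consES.
  exact: measurableT_comp (measurable_coord_rV j) measurable_snd.
under eq_fun do rewrite rV_consE0.
exact: measurable_fst.
Qed.

Section lebesgue_rV_step.
Context (R : realType) (d : nat).
Variable m : {sigma_finite_measure set 'rV[R]_d -> \bar R}.

Definition lebesgue_rV_step : set 'rV[R]_d.+1 -> \bar R :=
  pushforward (@lebesgue_measure R \x m)%E (@rV_cons R d).

Let step0 : lebesgue_rV_step set0 = 0%E.
Proof. by rewrite /lebesgue_rV_step /pushforward preimage_set0 measure0. Qed.

Let step_ge0 A : (0 <= lebesgue_rV_step A)%E.
Proof. by rewrite /lebesgue_rV_step /pushforward measure_ge0. Qed.

Let step_sigma_additive : semi_sigma_additive lebesgue_rV_step.
Proof.
move=> F mF tF mUF; rewrite /lebesgue_rV_step /pushforward preimage_bigcup.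
apply: measure_semi_sigma_additive.
- by move=> n; rewrite -[X in measurable X]setTI; exact: measurable_rV_cons.
- apply/trivIsetP => /= i j _ _ ij; rewrite -preimage_setI.
  by move/trivIsetP : tF => /(_ _ _ _ _ ij) ->//; rewrite preimage_set0.
- rewrite -preimage_bigcup -[X in measurable X]setTI.
  exact: measurable_rV_cons.
Qed.

HB.instance Definition _ := isMeasure.Build _ _ _ lebesgue_rV_step
  step0 step_ge0 step_sigma_additive.

Lemma lebesgue_rV_step_box (A : 'I_d.+1 -> set (measurableTypeR R)) :
  (forall i, measurable (A i)) ->
  lebesgue_rV_step [set x : 'rV[R]_d.+1 | forall i, A i (x 0 i)] =
  (lebesgue_measure (A ord0) *
   m [set x : 'rV[R]_d | forall i, A (lift ord0 i) (x ord0 i)])%E.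
Proof.
move=> mA; rewrite /lebesgue_rV_step /pushforward.
have mB := measurable_box_rV (fun i => mA (lift ord0 i)).
rewrite -(product_measure1E _ _ (mA ord0) mB).
congr (_ _); apply/seteqP; split => [p Ap|p [Ap0 Ap] i] /=.
  split; first by have := Ap ord0; rewrite rV_consE0.
  by move=> i; have := Ap (lift ord0 i); rewrite rV_consES.
by case: (unliftP ord0 i) => [j ->|->]; rewrite ?rV_consES ?rV_consE0//; apply: Ap.
Qed.

Let step_sigma_finite : sigma_finite setT lebesgue_rV_step.
Proof.
have /sigma_finiteP[F [TF ndF Foo]] := sigma_finiteT (@lebesgue_measure R).
have /sigma_finiteP[G [TG ndG Goo]] := sigma_finiteT m.
exists (fun n => @rV_uncons R d @^-1` (F n `*` G n)).
  rewrite -preimage_bigcup; apply/esym; rewrite -subTset => x _ /=.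
  have [k _ Fk] : (\bigcup_n F n) (rV_uncons x).1 by rewrite -TF.
  have [l _ Gl] : (\bigcup_n G n) (rV_uncons x).2 by rewrite -TG.
  exists (maxn k l) => //; split.
  - by move: Fk; exact/subsetPset/ndF/leq_maxl.
  - by move: Gl; exact/subsetPset/ndG/leq_maxr.
move=> n; have [mF Fn] := Foo n; have [mG Gn] := Goo n; split.
  rewrite -[X in measurable X]setTI.
  by apply: measurable_rV_uncons => //; exact: measurableX.
rewrite /lebesgue_rV_step /pushforward -comp_preimage.
rewrite (_ : _ \o _ = id); last by apply/funext => p /=; rewrite rV_consK.
rewrite preimage_id (product_measure1E _ _ mF mG).
by rewrite lte_mul_pinfty// ge0_fin_numE.
Qed.

HB.instance Definition _ := Measure_isSigmaFinite.Build _ _ _ lebesgue_rV_step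
  step_sigma_finite.

End lebesgue_rV_step.

Fixpoint lebesgue_rV (R : realType) (d : nat) :
    {sigma_finite_measure set 'rV[R]_d -> \bar R} :=
  match d with
  | 0 => \d_(0 : 'rV[R]_0)
  | d'.+1 => lebesgue_rV_step (lebesgue_rV R d')
  end.

Lemma lebesgue_rV_box (R : realType) (d : nat)
    (A : 'I_d -> set (measurableTypeR R)) :
  (forall i, measurable (A i)) ->
  lebesgue_rV R d [set x : 'rV[R]_d | forall i, A i (x 0 i)] =
  (\prod_(i < d) lebesgue_measure (A i))%E.
Proof.
elim: d A => [|d IH] A mA /=.
  rewrite big_ord0 diracE mem_set//.
  by case.
by rewrite lebesgue_rV_step_box// big_ord_recl -(IH (fun i => A (lift ord0 i))).
Qed.

(* The norm of the normed module 'rV[R]_d is the sup norm, not the Euclidean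
   one. *)
Definition enorm (R : realType) (d : nat) (x : 'rV[R]_d) : R :=
  Num.sqrt (\sum_(i < d) x 0 i ^+ 2).

Definition Gamma (R : realType) (a : R) : R :=
  \int[lebesgue_measure]_(t in `]0, +oo[) (t `^ (a - 1) * expR (- t)).

Definition Cds (R : realType) (d : nat) (s : R) : R :=
  s * 2 `^ (2 * s) / Gamma (1 - s) *
  (Gamma ((d%:R + 2 * s) / 2) / pi `^ (d%:R / 2)).

Definition energy (R : realType) (d : nat) (s : R) (u : 'rV[R]_d -> R) : \bar R :=
  ((Cds d s / 2)%:E *
   \int[lebesgue_rV R d \x lebesgue_rV R d]_p
     ((u p.1 - u p.2) ^+ 2 / enorm (p.1 - p.2) `^ (d%:R + 2 * s))%:E)%E.

Definition Hs (R : realType) (d : nat) (s : R) : set ('rV[R]_d -> R) :=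
  [set u | u \in Lfun (lebesgue_rV R d) 2%:E /\ (energy s u < +oo)%E].

Definition Hs_tilde (R : realType) (d : nat) (s : R) (U : set 'rV[R]_d) :
    set ('rV[R]_d -> R) :=
  [set u | Hs s u /\
    {ae lebesgue_rV R d, forall x, ~ closure U x -> u x = 0}].

Definition sqnormL2 (R : realType) (d : nat) (U : set 'rV[R]_d)
    (u : 'rV[R]_d -> R) : \bar R :=
  (\int[lebesgue_rV R d]_(x in U) ((u x) ^+ 2)%:E)%E.

(* Functions stand for their classes modulo a.e. equality, so u != 0 means that
   u is not a.e. zero. *)
Definition lambda (R : realType) (d : nat) (s : R) (U : set 'rV[R]_d) : \bar R :=
  ereal_inf [set (energy s u / sqnormL2 U u)%E | u in
    [set u | Hs_tilde s U u /\
      ~ {ae lebesgue_rV R d, forall x, u x = 0}]].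

(* Domain = nonempty connected open set. In the orthonormal coordinates
   y *m Q, the set U coincides near each boundary point with the strict
   epigraph, in the direction i, of a Lipschitz function of the other d - 1
   coordinates. *)
Definition lipschitz_domain (R : realType) (d : nat) (U : set 'rV[R]_d) : Prop :=
  [/\ open U, connected U, U !=set0 &
    forall x, (closure U `\` U) x ->
      exists (Q : 'M[R]_d) (i : 'I_d) (g : 'rV[R]_d.-1 -> R^o),
        [/\ Q *m Q^T = 1%:M, lipschitz g &
          \forall y \near x, U y <-> g (col' i (y *m Q)) < (y *m Q) 0 i]].

Definition dilation (R : realType) (k : nat) (l : R) (B : set 'rV[R]_k) :
    set 'rV[R]_k := [set l *: x | x in B].

Definition prod_rV (R : realType) (n k : nat) (A : set 'rV[R]_n)
    (B : set 'rV[R]_k) : set 'rV[R]_(n + k) :=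
  [set z | A (lsubmx z) /\ B (rsubmx z)].

(* Main.v *)
(** Subordination writes the energy of u as an average over t > 0 of the heat
    forms [heat_form t u] = \iint (u(z) - u(z'))^2 gamma_t(z - z') dz dz', whose
    Gaussian kernels factor along R^(n+k) = R^n x R^k.
    For a tensor product, expanding the square shows that the Rayleigh quotient of
    v (x) w is the sum of those of v and w, minus a defect given by the product of
    the heat forms of v and w.
    Conversely, Gaussian kernels are positive definite, so the heat pairing of two
    slices u(., y) and u(., y') is at most the mean of their self-pairings; hence
    the energy of u is at least the integral of the energies of its slices, plus a
    defect measuring the Gaussian mass that leaves B_l.
    On bounded sets both defects, restricted to a compact range of t, are bounded
    below by a fixed multiple of the squared L^2 norm, so the inequalities remain
    strict for the infima and no minimizer is needed. *)
Require Import Defs.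
From HB Require Import structures.
From mathcomp Require Import all_boot all_order all_algebra.
From mathcomp Require Import all_classical all_reals all_analysis.
From mathcomp Require Import measurable_realfun ring lra.
Import Order.TTheory GRing.Theory Num.Theory.
Import numFieldNormedType.Exports.

Set Implicit Arguments.
Unset Strict Implicit.
Unset Printing Implicit Defensive.

Local Open Scope classical_set_scope.
Local Open Scope ring_scope.

(** The kernel |z|^(-(n+k+2s)) itself does not split over R^n x R^k, so every comparison is made at
    a fixed time and only then integrated in time. Integrands are kept nonnegative in [\bar R], so
    that Tonelli applies without integrability checks. Identities therefore carry their negative
    terms on the other side, and functions are replaced by their absolute values, which makes the
    cross terms of expanded squares nonnegative. [Hs_tilde] forces vanishing only off the closure of
    U, whereas slices, tensor products and inclusions are handled with functions vanishing off U
    itself. The two agree when boundaries are null; this is what the Lipschitz regularity of omega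
    and the convexity of B provide. The upper half of (i) is a consequence of the upper bound in
    (ii): omega x lB lies in omega x R^k, and the extra term tends to 0. The quotients of (ii) must
    also be known to be finite; a Lipschitz tent function has finite energy because its heat form is
    bounded for small t and O(1/t) for large t, which is where both s > 0 and s < 1 enter. *)

Local Notation mu d := (lebesgue_rV _ d).

(** * Lebesgue measure on R^d *)

Section nonneg_integral.
Context d (T : measurableType d) (R : realType).
Variable m : {measure set T -> \bar R}.
Local Open Scope ereal_scope.

Lemma integralT_ge0 (f : T -> \bar R) : (forall x, 0 <= f x) ->
  0 <= \int[m]_x f x.
Proof. by move=> f0; apply: integral_ge0. Qed.

Lemma integralT_ge0D (f g : T -> \bar R) :
  measurable_fun setT f -> measurable_fun setT g ->
  (forall x, 0 <= f x) -> (forall x, 0 <= g x) ->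
  \int[m]_x (f x + g x) = \int[m]_x f x + \int[m]_x g x.
Proof. by move=> *; rewrite ge0_integralD. Qed.

Lemma integralT_ge0Zl (c : \bar R) (f : T -> \bar R) :
  measurable_fun setT f -> 0 <= c -> (forall x, 0 <= f x) ->
  \int[m]_x (c * f x) = c * \int[m]_x f x.
Proof. by move=> *; rewrite ge0_integralZl. Qed.

Lemma integralT_ge0_le (f g : T -> \bar R) :
  measurable_fun setT f -> measurable_fun setT g ->
  (forall x, 0 <= f x) -> (forall x, f x <= g x) ->
  \int[m]_x f x <= \int[m]_x g x.
Proof.
by move=> mf mg f0 fg; apply: ge0_le_integral => // x _; exact: le_trans (fg x).
Qed.

Lemma eq_integralT (f g : T -> \bar R) : f =1 g -> \int[m]_x f x = \int[m]_x g x.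
Proof. by move=> fg; apply: eq_integral => x _. Qed.

End nonneg_integral.

Section rV_integral.
Context (R : realType).
Local Open Scope ereal_scope.

Lemma integral_rV0 (f : 'rV[R]_0 -> \bar R) : measurable_fun setT f ->
  \int[mu 0]_x f x = f 0%R.
Proof.
move=> mf; rewrite [LHS](_ : _ = \int[\d_(0%R : 'rV[R]_0)]_x f x)//.
by rewrite integral_dirac// diracT mul1e.
Qed.

Lemma integral_rVS d (f : 'rV[R]_d.+1 -> \bar R) : measurable_fun setT f ->
  (forall x, 0 <= f x) ->
  \int[mu d.+1]_x f x =
  \int[lebesgue_measure]_x \int[mu d]_v f (rV_cons (x, v)).
Proof.
move=> mf f0.
have mc := @measurable_rV_cons R d.
transitivity (\int[(@lebesgue_measure R \x mu d)]_p f (rV_cons p)).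
  have := @ge0_integral_pushforward _ _ _ _ R (@rV_cons R d) mc
     (@lebesgue_measure R \x mu d) setT f measurableT mf (fun y _ => f0 y).
  rewrite preimage_setT => <-.
  by apply: eq_measure_integral.
by rewrite fubini_tonelli1//; exact: measurableT_comp.
Qed.

End rV_integral.

Section measurability.
Context d (T : measurableType d) (R : realType).
Local Notation mR := (measurableTypeR R).

Lemma measurable_coord n (f : T -> 'rV[R]_n) (i : 'I_n) (j : 'I_1) :
  measurable_fun setT f -> measurable_fun setT (fun x => f x j i : mR).
Proof. by move=> /measurable_fun_rVP/(_ i); rewrite (ord1 j). Qed.

Lemma measurable_rVB n (f g : T -> 'rV[R]_n) :
  measurable_fun setT f -> measurable_fun setT g ->
  measurable_fun setT (fun x => f x - g x).
Proof.
move=> mf mg; apply/measurable_fun_rVP => i.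
under eq_fun do rewrite !mxE.
by apply: measurable_funB; exact: measurable_coord.
Qed.

Lemma measurable_rVD n (f g : T -> 'rV[R]_n) :
  measurable_fun setT f -> measurable_fun setT g ->
  measurable_fun setT (fun x => f x + g x).
Proof.
move=> mf mg; apply/measurable_fun_rVP => i.
under eq_fun do rewrite !mxE.
by apply: measurable_funD; exact: measurable_coord.
Qed.

Lemma measurable_rVZ n (c : R) (f : T -> 'rV[R]_n) :
  measurable_fun setT f -> measurable_fun setT (fun x => c *: f x).
Proof.
move=> mf; apply/measurable_fun_rVP => i.
under eq_fun do rewrite !mxE.
by apply: measurable_funM => //; exact: measurable_coord.
Qed.

Lemma measurable_row_mx n k (f : T -> 'rV[R]_n) (g : T -> 'rV[R]_k) :
  measurable_fun setT f -> measurable_fun setT g ->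
  measurable_fun setT (fun x => row_mx (f x) (g x)).
Proof.
move=> mf mg; apply/measurable_fun_rVP => i.
case: (split_ordP i) => j ->.
  by under eq_fun do rewrite row_mxEl; exact: measurable_coord.
by under eq_fun do rewrite row_mxEr; exact: measurable_coord.
Qed.

Lemma measurable_lsubmx n k (f : T -> 'rV[R]_(n + k)) :
  measurable_fun setT f -> measurable_fun setT (fun x => lsubmx (f x)).
Proof.
move=> mf; apply/measurable_fun_rVP => i.
by under eq_fun do rewrite mxE; exact: measurable_coord.
Qed.

Lemma measurable_rsubmx n k (f : T -> 'rV[R]_(n + k)) :
  measurable_fun setT f -> measurable_fun setT (fun x => rsubmx (f x)).
Proof.
move=> mf; apply/measurable_fun_rVP => i.
by under eq_fun do rewrite mxE; exact: measurable_coord.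
Qed.

Lemma measurable_rV_consT n (f : T -> mR) (g : T -> 'rV[R]_n) :
  measurable_fun setT f -> measurable_fun setT g ->
  measurable_fun setT (fun x => rV_cons (f x, g x)).
Proof.
move=> mf mg; apply: (measurableT_comp (@measurable_rV_cons R n)).
exact: measurable_fun_pair.
Qed.

Lemma measurable_fineE (f : T -> R) :
  measurable_fun setT (f : T -> mR) -> measurable_fun setT (fun x => (f x)%:E).
Proof. by move=> mf; exact/measurable_EFinP. Qed.

Lemma measurable_fun_prod (I : Type) (s : seq I) (F : I -> T -> R) :
  (forall i, measurable_fun setT (F i : T -> mR)) ->
  measurable_fun setT (fun x => \prod_(i <- s) F i x : mR).
Proof.
move=> mF; elim: s => [|i s IH].
  rewrite [X in measurable_fun _ X](_ : _ = cst 1).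
    exact: measurable_cst.
  by apply/funext => x; rewrite big_nil.
rewrite [X in measurable_fun _ X](_ : _ = (fun x => F i x * \prod_(i <- s) F i x)).
  by apply: measurable_funM => //; exact: mF.
by apply/funext => x; rewrite big_cons.
Qed.

End measurability.

(** Measurability is proved by the syntax of the function: each rule peels off its head symbol, and
    a hypothesis [measurable_fun setT u] serves as the rule for the head [u]. Differences and sums
    try the scalar rule before the vector one. [meas] is extended below to Gaussian kernels. *)
Ltac mstep :=
 match goal with
 | H : measurable_fun ?D ?f |- measurable_fun ?D ?f => exact H
 | |- measurable_fun _ (fun _ => ?c) => exact: measurable_cst
 | |- measurable_fun _ (fun x => x) => exact: measurable_id
 | |- measurable_fun _ (fun x => EFin (@?f x)) => refine (measurable_fineE (f := f) _)
 | |- measurable_fun _ (fun x => fst (@?f x)) =>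
     refine (measurableT_comp (g := f) measurable_fst _)
 | |- measurable_fun _ (fun x => snd (@?f x)) =>
     refine (measurableT_comp (g := f) measurable_snd _)
 | |- measurable_fun _ (fun x => (@?f x, @?g x)) =>
     refine (measurable_fun_pair (f := f) (g := g) _ _)
 | |- measurable_fun _ (fun x => rV_cons (@?f x, @?g x)) =>
     refine (measurable_rV_consT (f := f) (g := g) _ _)
 | |- measurable_fun _ (fun x => row_mx (@?f x) (@?g x)) =>
     refine (measurable_row_mx (f := f) (g := g) _ _)
 | |- measurable_fun _ (fun x => lsubmx (@?f x)) =>
     refine (measurable_lsubmx (f := f) _)
 | |- measurable_fun _ (fun x => rsubmx (@?f x)) =>
     refine (measurable_rsubmx (f := f) _)
 | |- measurable_fun _ (fun x => fun_of_matrix (@?f x) _ _) =>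
     refine (measurable_coord (f := f) _ _ _)
 | |- measurable_fun _ (fun x => (@?f x - @?g x)%R) =>
     first [refine (measurable_funB (f := f) (g := g) _ _)
           |refine (measurable_rVB (f := f) (g := g) _ _)]
 | |- measurable_fun _ (fun x => (@?f x + @?g x)%R) =>
     first [refine (measurable_funD (f := f) (g := g) _ _)
           |refine (measurable_rVD (f := f) (g := g) _ _)
           |refine (emeasurable_funD (f := f) (g := g) _ _)]
 | |- measurable_fun _ (fun x => (@?f x * @?g x)%R) =>
     refine (measurable_funM (f := f) (g := g) _ _)
 | |- measurable_fun _ (fun x => (@?f x * @?g x)%E) =>
     refine (emeasurable_funM (f := f) (g := g) _ _)
 | |- measurable_fun _ (fun x => (@?f x ^+ _)%R) =>
     refine (measurable_funX (f := f) _ _)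
 | |- measurable_fun _ (fun x => (- @?f x)%R) =>
     refine (measurable_funN (f := f) _)
 | |- measurable_fun _ (fun x => (_ *: @?f x)%R) =>
     refine (measurable_rVZ (f := f) _ _)
 | |- measurable_fun _ (fun x => expR (@?f x)) =>
     refine (measurableT_comp (g := f) (@measurable_expR _) _)
 | |- measurable_fun _ (fun x => powR (@?f x) ?p) =>
     refine (measurableT_comp (g := f) (@measurable_powR _ p) _)
 | |- measurable_fun _ (fun x => Num.norm (@?f x)) =>
     refine (measurableT_comp (g := f) (@normr_measurable _ setT) _)
 | |- measurable_fun _ (fun x => \prod_(i <- ?s) @?F x i)%R =>
     refine (measurable_fun_prod (F := fun i x => F x i) s _)
 | H : measurable_fun setT ?u |- measurable_fun _ (fun x => ?u (@?f x)) =>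
     refine (measurableT_comp (g := f) H _)
 | H : measurable_fun setT ?u |- measurable_fun _ ?u => exact H
 | |- forall _, _ => move=> ?
 end.
Ltac meas := rewrite /comp /=; repeat mstep; try done.

Section lebesgue_affine.
Context (R : realType).
Local Notation leb := (@lebesgue_measure R).
Local Open Scope ereal_scope.

Lemma lebesgue_integral_translate (a : R) (f : R -> \bar R) :
  measurable_fun setT f -> (forall x, 0 <= f x) ->
  \int[leb]_x f (x + a)%R = \int[leb]_x f x.
Proof.
move=> mf f0.
have ma : measurable_fun setT (fun x : measurableTypeR R => (x + a)%R : measurableTypeR R).
  by meas.
have := @ge0_integral_pushforward _ _ _ _ R _ ma leb setT f measurableT mf
  (fun y _ => f0 y).
rewrite preimage_setT => <-.
(* The pushforward gives []x, y]] the measure of []x - a, y - a]], which has the same length, and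
   Lebesgue measure is determined by its values on half-open intervals. *)
apply: eq_measure_integral => A mA _; apply/esym/lebesgue_measure_unique => //.
move=> _ [[x y]] _ <-; rewrite /= /pushforward.
rewrite (_ : _ @^-1` _ = `](x - a)%R, (y - a)%R]%classic); last first.
  by apply/seteqP; split => z /=; rewrite !in_itv/= ltrBlDr lerBrDr.
rewrite !lebesgue_measure_itv/= !lte_fin ltrD2r.
by case: ifPn => // _; rewrite -!EFinB; congr EFin; ring.
Qed.

Lemma lebesgue_integral_scale (c : R) (f : R -> \bar R) : (0 < c)%R ->
  measurable_fun setT f -> (forall x, 0 <= f x) ->
  \int[leb]_x f (c * x)%R = (c^-1)%:E * \int[leb]_x f x.
Proof.
move=> c0 mf f0.
have mc : measurable_fun setT (fun x : measurableTypeR R => (c * x)%R : measurableTypeR R).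
  by meas.
have := @ge0_integral_pushforward _ _ _ _ R _ mc leb setT f measurableT mf
  (fun y _ => f0 y).
rewrite preimage_setT => <-.
have ci0 : (0 <= c^-1)%R by rewrite invr_ge0 ltW.
transitivity (\int[mscale (NngNum ci0) leb]_x f x); last first.
  by rewrite ge0_integral_mscale.
apply: eq_measure_integral => A mA _.
pose P := measure_function_pushforward__canonical__measure_function_Measure leb mc.
(* Uniqueness is about measures that give each interval its length, so the pushforward is first
   multiplied by [c] to undo the factor 1/c on preimages of intervals. *)
have E : leb A = c%:E * P A.
  transitivity (mscale (NngNum (ltW c0)) P A); last by [].
  apply/lebesgue_measure_unique => //.
  move=> _ [[x y]] _ <-; rewrite /= /mscale /P /= /pushforward.
  rewrite (_ : _ @^-1` _ = `](x / c)%R, (y / c)%R]%classic); last first.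
    by apply/seteqP; split => z /=; rewrite !in_itv/= ltr_pdivrMr// ler_pdivlMr// [(z * c)%R]mulrC.
  rewrite !lebesgue_measure_itv/= !lte_fin ltr_pM2r ?invr_gt0//.
  case: ifPn => // _; last by rewrite mule0.
  rewrite -!EFinB -EFinM; congr EFin; field; exact: lt0r_neq0.
transitivity ((c^-1)%:E * leb A); last by [].
by rewrite E muleA -EFinM mulVf ?mul1e// lt0r_neq0.
Qed.

End lebesgue_affine.

Section rV_affine.
Context (R : realType).
Local Open Scope ereal_scope.
Implicit Type d : nat.

Lemma measurable_rV_slice d (f : 'rV[R]_d.+1 -> \bar R) :
  measurable_fun setT f -> (forall x, 0 <= f x) ->
  measurable_fun setT (fun x : R => \int[mu d]_v f (rV_cons (x, v))).
Proof.
move=> mf f0; have mc := @measurable_rV_cons R d.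
by apply: (measurable_fun_fubini_tonelli_F (m2 := mu d)
  (fun p : measurableTypeR R * 'rV[R]_d => f (rV_cons p))) => //; meas.
Qed.

Lemma rV_consD d (x y : R) (v w : 'rV[R]_d) :
  (rV_cons (x, v) + rV_cons (y, w) = rV_cons (x + y, v + w))%R.
Proof.
by apply/rowP => i; rewrite mxE; case: (unliftP ord0 i) => [j ->|->];
  rewrite ?rV_consES ?rV_consE0// mxE.
Qed.

Lemma rV_consZ d (c x : R) (v : 'rV[R]_d) :
  (c *: rV_cons (x, v) = rV_cons (c * x, c *: v))%R.
Proof.
by apply/rowP => i; rewrite mxE; case: (unliftP ord0 i) => [j ->|->];
  rewrite ?rV_consES ?rV_consE0// mxE.
Qed.

Lemma rV_unconsK d : cancel (@rV_uncons R d) (@rV_cons R d).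
Proof.
move=> a; apply/rowP => i; rewrite /rV_uncons.
by case: (unliftP ord0 i) => [j ->|->]; rewrite ?rV_consES ?rV_consE0// mxE.
Qed.

Lemma integral_rV_translate d (a : 'rV[R]_d) (f : 'rV[R]_d -> \bar R) :
  measurable_fun setT f -> (forall x, 0 <= f x) ->
  \int[mu d]_x f (x + a)%R = \int[mu d]_x f x.
Proof.
elim: d => [|d IH] in a f *.
  move=> mf f0; congr integral; apply/funext => x; congr f.
  by apply/rowP => -[].
move=> mf f0; have mc := @measurable_rV_cons R d.
rewrite -[a]rV_unconsK; case: (rV_uncons a) => {}a v.
rewrite !integral_rVS//; last by meas.
under eq_integral do under eq_integral do rewrite rV_consD.
have := @lebesgue_integral_translate R a (fun x => \int[mu d]_v f (rV_cons (x, v))).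
move=> <-; last 2 first.
  exact: measurable_rV_slice.
  by move=> x; exact: integralT_ge0.
apply: eq_integralT => x.
by rewrite (IH v (fun w => f (rV_cons (x + a, w)%R)))//; meas.
Qed.

Lemma integral_rV_scale d (c : R) (f : 'rV[R]_d -> \bar R) : (0 < c)%R ->
  measurable_fun setT f -> (forall x, 0 <= f x) ->
  \int[mu d]_x f (c *: x)%R = (c ^- d)%:E * \int[mu d]_x f x.
Proof.
move=> c0; elim: d => [|d IH] in f *.
  move=> mf f0; rewrite expr0 invr1 mul1e; congr integral; apply/funext => x; congr f.
  by apply/rowP => -[].
move=> mf f0; have mc := @measurable_rV_cons R d.
rewrite !integral_rVS//; last by meas.
under eq_integral do under eq_integral do rewrite rV_consZ.
pose g (x : R) := \int[mu d]_v f (rV_cons (x, v)).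
have mg : measurable_fun setT g := measurable_rV_slice mf f0.
have g0 x : 0 <= g x by exact: integralT_ge0.
transitivity (\int[lebesgue_measure]_x ((c ^- d)%:E * g (c * x)%R)).
  by apply: eq_integralT => x; rewrite (IH (fun w => f (rV_cons (c * x, w)%R)))//; meas.
have mgc : measurable_fun setT (fun x : measurableTypeR R => g (c * x)%R) by meas.
transitivity ((c ^- d)%:E * \int[lebesgue_measure]_x g (c * x)%R).
  apply: (integralT_ge0Zl _ mgc) => //.
  by rewrite lee_fin invr_ge0 exprn_ge0// ltW.
rewrite (@lebesgue_integral_scale R c g)//.
by rewrite muleA -EFinM exprS invfM mulrC.
Qed.

End rV_affine.

(* The library's sigma-finite instance on [m1 \x m2] is shadowed by the one for
   products of subprobabilities, which does not apply to Lebesgue measure. *)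
Section sigma_finite_product.
Context d1 d2 (T1 : measurableType d1) (T2 : measurableType d2) (R : realType).
Variables (m1 : {sigma_finite_measure set T1 -> \bar R})
  (m2 : {sigma_finite_measure set T2 -> \bar R}).
Local Open Scope ereal_scope.

Definition sigma_finite_prod : set (T1 * T2) -> \bar R := m1 \x m2.

HB.instance Definition _ := Measure.on sigma_finite_prod.

Let sigma_finite_prod_sigma_finite : sigma_finite setT sigma_finite_prod.
Proof.
have /sigma_finiteP[F [TF ndF Foo]] := sigma_finiteT m1.
have /sigma_finiteP[G [TG ndG Goo]] := sigma_finiteT m2.
exists (fun n => F n `*` G n).
  apply/esym; rewrite -subTset => -[x y] _.
  have [k _ Fk] : (\bigcup_n F n) x by rewrite -TF.
  have [l _ Gl] : (\bigcup_n G n) y by rewrite -TG.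
  exists (maxn k l) => //; split.
  - by move: Fk; exact/subsetPset/ndF/leq_maxl.
  - by move: Gl; exact/subsetPset/ndG/leq_maxr.
move=> k; have [mF Fk] := Foo k; have [mG Gk] := Goo k.
split; first exact: measurableX.
by rewrite /sigma_finite_prod product_measure1E// lte_mul_pinfty// ge0_fin_numE.
Qed.

HB.instance Definition _ := Measure_isSigmaFinite.Build _ _ _
  sigma_finite_prod sigma_finite_prod_sigma_finite.

End sigma_finite_product.

(** Convertible to the product measure in [energy], but equipped with the sigma-finite structure
    that Tonelli needs when pairs of points are integrated together with a further variable. *)
Definition leb2 (R : realType) d :
    {sigma_finite_measure set ('rV[R]_d * 'rV[R]_d)%type -> \bar R} :=
  sigma_finite_prod (lebesgue_rV R d) (lebesgue_rV R d).

Section leb2.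
Context (R : realType) (d : nat) (f : ('rV[R]_d * 'rV[R]_d) -> \bar R).
Hypotheses (mf : measurable_fun setT f) (f0 : (forall x, 0 <= f x)%E).
Local Open Scope ereal_scope.

Lemma integral_leb2l : \int[leb2 R d]_x f x =
  \int[lebesgue_rV R d]_x \int[lebesgue_rV R d]_y f (x, y).
Proof.
exact: (fubini_tonelli1 (m1 := lebesgue_rV R d) (m2 := lebesgue_rV R d) f).
Qed.

Lemma integral_leb2r : \int[leb2 R d]_x f x =
  \int[lebesgue_rV R d]_y \int[lebesgue_rV R d]_x f (x, y).
Proof.
exact: (fubini_tonelli2 (m1 := lebesgue_rV R d) (m2 := lebesgue_rV R d) f).
Qed.

End leb2.

Local Notation mm d := (leb2 _ d).

Section sections.
Context d1 d2 (T1 : measurableType d1) (T2 : measurableType d2) (R : realType).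
Variable m : {sigma_finite_measure set T2 -> \bar R}.
Local Open Scope ereal_scope.

Lemma measurable_integral_section (f : T1 -> T2 -> \bar R) :
  measurable_fun setT (fun p : T1 * T2 => f p.1 p.2) ->
  (forall x y, 0 <= f x y) ->
  measurable_fun setT (fun x => \int[m]_y f x y).
Proof.
move=> mf f0.
by apply: (measurable_fun_fubini_tonelli_F (m2 := m)
  (fun p : T1 * T2 => f p.1 p.2)).
Qed.

End sections.

Section rV_product.
Context (R : realType).
Local Open Scope ereal_scope.
Implicit Type d : nat.

Lemma integral_row_mx n k (f : 'rV[R]_(n + k) -> \bar R) :
  measurable_fun setT f -> (forall x, 0 <= f x) ->
  \int[mu (n + k)]_z f z = \int[mu n]_x \int[mu k]_y f (row_mx x y).
Proof.
elim: n => [|n IH] in f *; move=> mf f0.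
  rewrite integral_rV0.
    apply: eq_integralT => y; congr f; apply/rowP => i.
    have E : i = rshift 0 i by apply: val_inj.
    by rewrite [in RHS]E row_mxEr.
  by apply: measurable_integral_section => //; meas.
rewrite [RHS]integral_rVS; last 2 first.
- by apply: measurable_integral_section => //; meas.
- by move=> x; exact: integralT_ge0.
(* [n.+1 + k] is convertible to [(n + k).+1], so the first coordinate can be split off the
   concatenated vector. *)
rewrite [LHS](@integral_rVS _ (n + k) f)//.
apply: eq_integralT => x.
have mfx : measurable_fun setT (fun v : 'rV[R]_(n + k) => f (rV_cons (x, v))) by meas.
have -> := IH _ mfx (fun v => f0 _).
apply: eq_integralT => v; apply: eq_integralT => y; congr f.
apply/rowP => i.
case: (unliftP ord0 i) => [j ->|->].
  rewrite rV_consES; case: (split_ordP j) => l ->.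
    rewrite row_mxEl (_ : lift _ _ = lshift k (lift ord0 l)); last exact/val_inj.
    by rewrite row_mxEl rV_consES.
  rewrite row_mxEr (_ : lift _ _ = rshift n.+1 l); last exact/val_inj.
  by rewrite row_mxEr.
rewrite rV_consE0 (_ : ord0 = lshift k ord0); last exact/val_inj.
by rewrite row_mxEl rV_consE0.
Qed.

Lemma integral_row_mx2 n k (F : 'rV[R]_(n + k) * 'rV[R]_(n + k) -> \bar R) :
  measurable_fun setT F -> (forall x, 0 <= F x) ->
  \int[mm (n + k)]_z F z =
  \int[mm n]_p \int[mm k]_q F (row_mx p.1 q.1, row_mx p.2 q.2).
Proof.
move=> mF F0.
pose G (p : 'rV[R]_n * 'rV[R]_n) := \int[mm k]_q F (row_mx p.1 q.1, row_mx p.2 q.2).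
have mG : measurable_fun setT G.
  apply: (@measurable_integral_section _ _ _ _ R (mm k)
    (fun (p : 'rV[R]_n * 'rV[R]_n) (q : 'rV[R]_k * 'rV[R]_k) =>
       F (row_mx p.1 q.1, row_mx p.2 q.2))) => //.
  by meas.
have G0 p : 0 <= G p by exact: integralT_ge0.
rewrite [RHS](integral_leb2l mG G0) [LHS](integral_leb2l mF F0).
rewrite integral_row_mx; last 2 first.
- apply: (@measurable_integral_section _ _ _ _ R _
    (fun x y : 'rV[R]_(n + k) => F (x, y))) => //.
  by meas.
- by move=> x; exact: integralT_ge0.
apply: eq_integralT => x; transitivity (\int[mu k]_y \int[mu n]_x' \int[mu k]_y' F (row_mx x y, row_mx x' y')).
  by apply: eq_integralT => y; rewrite integral_row_mx//; meas.
(* The variables now come in the order x, y, x', y'. Only the middle two have to be exchanged, so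
   the integral in y' is kept inside [H]. *)
pose H (p : 'rV[R]_k * 'rV[R]_n) := \int[mu k]_y' F (row_mx x p.1, row_mx p.2 y').
have mH : measurable_fun setT H.
  apply: (@measurable_integral_section _ _ _ _ R _
    (fun (p : 'rV[R]_k * 'rV[R]_n) y' => F (row_mx x p.1, row_mx p.2 y'))) => //.
  by meas.
have H0 p : 0 <= H p by exact: integralT_ge0.
rewrite [LHS](fubini_tonelli (m1 := mu k) (m2 := mu n) H mH H0).
apply: eq_integralT => x'.
rewrite /G (integral_leb2l (f := fun q => F (row_mx x q.1, row_mx x' q.2)))//.
by meas.
Qed.

Lemma integral_prod2 (d1 d2 : measure_display) (T1 : measurableType d1) (T2 : measurableType d2)
   (m1 : {sigma_finite_measure set T1 -> \bar R})
   (m2 : {sigma_finite_measure set T2 -> \bar R}) (f : T1 -> \bar R) (g : T2 -> \bar R) :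
  measurable_fun setT f -> measurable_fun setT g ->
  (forall x, 0 <= f x) -> (forall x, 0 <= g x) ->
  \int[m1]_x \int[m2]_y (f x * g y) = \int[m1]_x f x * \int[m2]_y g y.
Proof.
move=> mf mg f0 g0.
under eq_integral do rewrite integralT_ge0Zl//.
by rewrite ge0_integralZr//; exact: integralT_ge0.
Qed.

End rV_product.

(** * Gaussian kernels and heat forms *)

Definition gauss1 (R : realType) (t x : R) : R :=
  Num.sqrt (t / pi) * expR (- (t * x ^+ 2)).

(* The heat kernel of R^d at time 1 / (4 * t). *)
Definition gauss (R : realType) (d : nat) (t : R) (z : 'rV[R]_d) : R :=
  \prod_(i < d) gauss1 t (z 0 i).

Lemma measurable_gauss1T d0 (T : measurableType d0) (R : realType)
  (f : T -> R) (g : T -> R) :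
  measurable_fun setT f -> measurable_fun setT g ->
  measurable_fun setT (fun x => gauss1 (f x) (g x)).
Proof.
move=> mf mg; rewrite /gauss1; apply: measurable_funM; last by meas.
have ms : measurable_fun setT (@Num.sqrt R).
  by apply: continuous_measurable_fun => x; exact: sqrt_continuous.
by apply: (measurableT_comp ms); meas.
Qed.

Lemma measurable_gaussT d0 (T : measurableType d0) (R : realType) (d : nat)
  (f : T -> R) (g : T -> 'rV[R]_d) :
  measurable_fun setT f -> measurable_fun setT g ->
  measurable_fun setT (fun x => gauss (f x) (g x)).
Proof.
move=> mf mg; rewrite /gauss; apply: measurable_fun_prod => i.
by apply: measurable_gauss1T; meas.
Qed.

Ltac mstep2 :=
 match goal with
 | |- measurable_fun _ (fun x => gauss (@?f x) (@?g x)) =>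
     refine (measurable_gaussT (f := f) (g := g) _ _)
 | |- measurable_fun _ (fun x => gauss1 (@?f x) (@?g x)) =>
     refine (measurable_gauss1T (f := f) (g := g) _ _)
 end.
Ltac meas ::= rewrite /comp /=; repeat first [mstep2 | mstep]; try done.

Section gaussian.
Context (R : realType).
Implicit Types (d : nat) (t : R).

Lemma gauss1_ge0 t x : 0 <= gauss1 t x.
Proof. by rewrite mulr_ge0// expR_ge0. Qed.

Lemma gauss_ge0 d t (z : 'rV_d) : 0 <= gauss t z.
Proof. by apply: prodr_ge0 => i _; exact: gauss1_ge0. Qed.

Lemma integral_gauss1 t : 0 < t ->
  (\int[@lebesgue_measure R]_x (gauss1 t x)%:E = 1)%E.
Proof.
move=> t0; have st0 : 0 < Num.sqrt t by rewrite sqrtr_gt0.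
have mg : measurable_fun setT (fun x : R => (expR (- x ^+ 2))%:E) by meas.
transitivity (\int[@lebesgue_measure R]_x
    ((Num.sqrt (t / pi))%:E * (expR (- (Num.sqrt t * x) ^+ 2))%:E))%E.
  apply: eq_integralT => x; rewrite -EFinM /gauss1 exprMn sqr_sqrtr//.
  exact: ltW.
have mg' : measurable_fun setT (fun x : measurableTypeR R => (expR (- (Num.sqrt t * x) ^+ 2))%:E).
  by meas.
rewrite integralT_ge0Zl//.
rewrite (@lebesgue_integral_scale _ (Num.sqrt t) (fun x => (expR (- x ^+ 2))%:E))//.
have := @integralT_gauss R; rewrite /gauss_fun => ->.
rewrite -!EFinM sqrtrM ?(ltW t0)// sqrtrV ?pi_ge0//; congr EFin.
by field; rewrite !lt0r_neq0//= sqrtr_gt0 pi_gt0.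
Qed.

Lemma gaussS d t x (v : 'rV_d) : gauss t (rV_cons (x, v)) = gauss1 t x * gauss t v.
Proof.
rewrite /gauss big_ord_recl rV_consE0; congr (_ * _).
by apply: eq_bigr => i _; rewrite rV_consES.
Qed.

Lemma integral_gauss d t : 0 < t -> (\int[mu d]_z (gauss t z)%:E = 1)%E.
Proof.
move=> t0; elim: d => [|d IH].
  by rewrite integral_rV0 ?/gauss ?big_ord0//; meas.
have g0 e (z : 'rV[R]_e) : (0 <= (gauss t z)%:E)%E by rewrite lee_fin gauss_ge0.
rewrite integral_rVS//; last by meas.
under eq_integral do under eq_integral do rewrite gaussS EFinM.
rewrite (@integral_prod2 R _ _ _ _ lebesgue_measure (mu d)
  (fun x => (gauss1 t x)%:E) (fun v => (gauss t v)%:E))//.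
- by rewrite IH integral_gauss1// mule1.
- by meas.
- by meas.
- by move=> x; rewrite lee_fin gauss1_ge0.
Qed.

Lemma gaussN d t (z : 'rV_d) : gauss t (- z) = gauss t z.
Proof. by apply: eq_bigr => i _; rewrite mxE /gauss1 sqrrN. Qed.

Lemma gaussC d t (x y : 'rV_d) : gauss t (x - y) = gauss t (y - x).
Proof. by rewrite -gaussN opprB. Qed.

Lemma integral_gaussr d t (x : 'rV_d) : 0 < t ->
  (\int[mu d]_y (gauss t (y - x))%:E = 1)%E.
Proof.
move=> t0.
have mg : measurable_fun setT (fun y : 'rV[R]_d => (gauss t y)%:E) by meas.
have -> := integral_rV_translate (- x) mg (fun y => _); first exact: integral_gauss.
by move=> y; rewrite lee_fin gauss_ge0.
Qed.

Lemma integral_gaussl d t (x : 'rV_d) : 0 < t ->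
  (\int[mu d]_y (gauss t (x - y))%:E = 1)%E.
Proof.
move=> t0; rewrite -(integral_gaussr x t0).
by apply: eq_integralT => y; rewrite gaussC.
Qed.

Lemma gauss_row_mx n k t (x : 'rV_n) (y : 'rV_k) :
  gauss t (row_mx x y) = gauss t x * gauss t y.
Proof.
rewrite /gauss big_split_ord; congr (_ * _); apply: eq_bigr => i _.
  by rewrite row_mxEl.
by rewrite row_mxEr.
Qed.

(* Completing the square; integrating in [a] gives the semigroup law. *)
Lemma gauss_semigroup d t (x y a : 'rV_d) : 0 < t ->
  gauss (2 * t) (x - a) * gauss (2 * t) (y - a) =
  gauss (4 * t) (a - 2^-1 *: (x + y)) * gauss t (x - y).
Proof.
move=> t0; rewrite /gauss -!big_split /=; apply: eq_bigr => i _; rewrite !mxE /gauss1.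
rewrite [LHS]mulrACA [RHS]mulrACA -!expRD -!sqrtrM; last 2 first.
- by rewrite divr_ge0 ?pi_ge0// mulr_ge0// ltW.
- by rewrite divr_ge0 ?pi_ge0// mulr_ge0// ltW.
have := lt0r_neq0 (pi_gt0 R); move: (pi : R) => p p0.
by congr (Num.sqrt _ * expR _); field.
Qed.

Lemma gaussE d t (z : 'rV_d) : 0 < t ->
  gauss t z = t `^ (d%:R / 2) / pi `^ (d%:R / 2) * expR (- (t * \sum_(i < d) z 0 i ^+ 2)).
Proof.
move=> t0; rewrite /gauss /gauss1 big_split/= -expR_sum mulr_sumr sumrN; congr (_ * _).
have E (a : R) : 0 <= a -> Num.sqrt a ^+ d = a `^ (d%:R / 2).
  by move=> a0; rewrite mulrC powRrM powR12_sqrt// powR_mulrn// sqrtr_ge0.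
by rewrite prodr_const card_ord sqrtrM ?ltW// sqrtrV ?pi_ge0// exprMn exprVn !E ?pi_ge0 ?ltW.
Qed.

(** The prefactor is smallest at t = 1 and the exponential at t = T. Bounding them separately gives
    a constant uniform in t, which is why defects are only measured on a compact range of times. *)
Lemma gauss_ge d t T L (z : 'rV_d) : 1 <= t <= T -> (forall i, `|z 0 i| <= L) ->
  (Num.sqrt (1 / pi) * expR (- (T * L ^+ 2))) ^+ d <= gauss t z.
Proof.
move=> /andP[t1 tT] zL; rewrite -[d in X in X <= _]card_ord -prodr_const.
apply: ler_prod => i _; rewrite mulr_ge0 ?expR_ge0//=.
apply: ler_pM; rewrite ?expR_ge0//.
  by rewrite ler_wsqrtr// ler_wpM2r// invr_ge0 pi_ge0.
rewrite ler_expR lerN2; apply: ler_pM => //.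
- by rewrite (le_trans _ t1).
- exact: sqr_ge0.
- by rewrite -real_normK ?num_real// lerXn2r// nnegrE// (le_trans _ (zL i)).
Qed.

End gaussian.

Definition heat_form (R : realType) d (t : R) (u : 'rV[R]_d -> R) : \bar R :=
  (\int[mm d]_p ((u p.1 - u p.2) ^+ 2 * gauss t (p.1 - p.2))%:E)%E.

(** The L^2 inner product of g with the heat evolution of h at time 1 / (4t). Formally,
    [heat_form t u] is twice |u|^2 minus twice the pairing of u with itself. *)
Definition heat_pairing (R : realType) d (t : R) (g h : 'rV[R]_d -> R) : \bar R :=
  (\int[mm d]_p (g p.1 * h p.2 * gauss t (p.1 - p.2))%:E)%E.

(** Stated for extended reals because it is applied to Gaussian averages of arbitrary nonnegative
    functions, which may be infinite. *)
Lemma lee_amgm (R : realDomainType) (x y : \bar R) : (0 <= x -> 0 <= y ->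
  x * y + x * y <= x * x + y * y)%E.
Proof.
case: x => [x| |]//; case: y => [y| |]// x0 y0.
- rewrite -!EFinM -!EFinD lee_fin -subr_ge0.
  by rewrite (_ : (_ - _)%R = ((x - y) ^+ 2)%R) ?sqr_ge0//; ring.
- by rewrite mulyy addey ?leey// -EFinM.
- by rewrite mulyy addye ?leey// -EFinM.
Qed.

Section iterated.
Context d1 d2 (T1 : measurableType d1) (T2 : measurableType d2) (R : realType).
Variables (m1 : {sigma_finite_measure set T1 -> \bar R})
  (m2 : {sigma_finite_measure set T2 -> \bar R}).
Local Open Scope ereal_scope.

Lemma integral_swap (f : T1 -> T2 -> \bar R) :
  measurable_fun setT (fun p : T1 * T2 => f p.1 p.2) -> (forall x y, 0 <= f x y) ->
  \int[m1]_x \int[m2]_y f x y = \int[m2]_y \int[m1]_x f x y.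
Proof.
by move=> mf f0; apply: (fubini_tonelli (m1 := m1) (m2 := m2) (fun p => f p.1 p.2)).
Qed.

Definition iterated_integral (f : T1 -> T2 -> R) := \int[m1]_x \int[m2]_y (f x y)%:E.

Lemma iterated_integralD (f g : T1 -> T2 -> R) :
  measurable_fun setT (fun p : T1 * T2 => f p.1 p.2) ->
  measurable_fun setT (fun p : T1 * T2 => g p.1 p.2) ->
  (forall x y, (0 <= f x y)%R) -> (forall x y, (0 <= g x y)%R) ->
  iterated_integral (fun x y => f x y + g x y)%R =
  iterated_integral f + iterated_integral g.
Proof.
move=> mf mg f0 g0; rewrite /iterated_integral -integralT_ge0D; last 4 first.
- by apply: (@measurable_integral_section _ _ _ _ R m2 (fun x y => (f x y)%:E)) => //; meas.
- by apply: (@measurable_integral_section _ _ _ _ R m2 (fun x y => (g x y)%:E)) => //; meas.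
- by move=> x; apply: integralT_ge0 => y; rewrite lee_fin.
- by move=> x; apply: integralT_ge0 => y; rewrite lee_fin.
apply: eq_integralT => x; rewrite -integralT_ge0D//.
- by apply: measurable_fineE; exact: (measurable_fun_pair2 x mf).
- by apply: measurable_fineE; exact: (measurable_fun_pair2 x mg).
- by move=> y; rewrite lee_fin.
- by move=> y; rewrite lee_fin.
Qed.

Lemma iterated_integralM (f : T1 -> R) (g : T2 -> R) :
  measurable_fun setT f -> measurable_fun setT g ->
  (forall x, (0 <= f x)%R) -> (forall y, (0 <= g y)%R) ->
  iterated_integral (fun x y => f x * g y)%R =
  \int[m1]_x (f x)%:E * \int[m2]_y (g y)%:E.
Proof.
move=> mf mg f0 g0; rewrite /iterated_integral.
under eq_integral do under eq_integral do rewrite EFinM.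
by apply: (@integral_prod2 R _ _ _ _ m1 m2 (fun x => (f x)%:E) (fun x => (g x)%:E)) => //; meas.
Qed.

End iterated.

Ltac nnstep := first
 [ progress intros
 | rewrite lee_fin
 | apply: adde_ge0 | apply: mule_ge0 | apply: integral_ge0
 | exact: gauss_ge0 | exact: gauss1_ge0 | exact: sqr_ge0
 | apply: mulr_ge0 | apply: addr_ge0 ].
Ltac nn := repeat first [by [] | nnstep].

Section heat_form.
Context (R : realType).
Implicit Types (d : nat) (t : R).
Local Open Scope ereal_scope.

Lemma heat_form_ge0 d t (u : 'rV[R]_d -> R) : 0 <= heat_form t u.
Proof. by apply: integralT_ge0 => p; rewrite lee_fin mulr_ge0 ?sqr_ge0 ?gauss_ge0. Qed.

Lemma integral_gauss_fst d t (f : 'rV[R]_d -> \bar R) : (0 < t)%R ->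
  measurable_fun setT f -> (forall x, 0 <= f x) ->
  \int[mm d]_p (f p.1 * (gauss t (p.1 - p.2))%:E) = \int[mu d]_x f x.
Proof.
move=> t0 mf f0; rewrite integral_leb2l; last 2 first.
- by meas.
- by move=> p; rewrite mule_ge0// lee_fin gauss_ge0.
apply: eq_integralT => x /=.
rewrite (integralT_ge0Zl _ (f := fun y : 'rV[R]_d => (gauss t (x - y))%:E))//.
- by rewrite integral_gaussl// mule1.
- by meas.
- by move=> y; rewrite lee_fin gauss_ge0.
Qed.

Lemma integral_gauss_snd d t (f : 'rV[R]_d -> \bar R) : (0 < t)%R ->
  measurable_fun setT f -> (forall x, 0 <= f x) ->
  \int[mm d]_p (f p.2 * (gauss t (p.1 - p.2))%:E) = \int[mu d]_x f x.
Proof.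
move=> t0 mf f0; rewrite integral_leb2r; last 2 first.
- by meas.
- by move=> p; rewrite mule_ge0// lee_fin gauss_ge0.
apply: eq_integralT => x /=.
rewrite (integralT_ge0Zl _ (f := fun y : 'rV[R]_d => (gauss t (y - x))%:E))//.
- by rewrite integral_gaussr// mule1.
- by meas.
- by move=> y; rewrite lee_fin gauss_ge0.
Qed.

(** This is (a - b)^2 + 2ab = a^2 + b^2 integrated against a kernel of unit mass in each variable.
    With the cross term on the left and u nonnegative, no integral has to be finite. *)
Lemma heat_formD d t (u : 'rV[R]_d -> R) : (0 < t)%R -> measurable_fun setT u ->
  (forall x, (0 <= u x)%R) ->
  heat_form t u + (heat_pairing t u u + heat_pairing t u u) =
  \int[mu d]_x (u x ^+ 2)%:E + \int[mu d]_x (u x ^+ 2)%:E.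
Proof.
move=> t0 mu0 u0.
have mu2 : measurable_fun setT (fun x => (u x ^+ 2)%:E) by meas.
have u20 x : 0 <= (u x ^+ 2)%:E by rewrite lee_fin sqr_ge0.
have g0 (z : 'rV[R]_d) : (0 <= gauss t z)%R by exact: gauss_ge0.
rewrite -{1}(integral_gauss_fst t0 mu2 u20) -(integral_gauss_snd t0 mu2 u20).
rewrite /heat_form /heat_pairing -!integralT_ge0D; try by nn; try by meas.
by apply: eq_integralT => p; rewrite -!EFinM -!EFinD; congr EFin; ring.
Qed.

(** The kernel has a square root under convolution: [gauss t] is [gauss (2 * t)] convolved with
    itself, by [gauss_semigroup] and the unit mass of [gauss (4 * t)]. For fixed midpoint variable
    [a], the pairing thus becomes a product of two averages. *)
Lemma heat_pairingE d t (g h : 'rV[R]_d -> R) : (0 < t)%R ->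
  measurable_fun setT g -> measurable_fun setT h ->
  (forall x, (0 <= g x)%R) -> (forall x, (0 <= h x)%R) ->
  heat_pairing t g h =
  \int[mu d]_a (\int[mu d]_x (g x * gauss (2 * t) (x - a))%:E *
                \int[mu d]_x (h x * gauss (2 * t) (x - a))%:E).
Proof.
move=> t0 mg mh g0 h0.
pose F (p : 'rV[R]_d * 'rV[R]_d) (a : 'rV[R]_d) :=
  (g p.1 * gauss (2 * t) (p.1 - a) * (h p.2 * gauss (2 * t) (p.2 - a)))%:E.
have F0 p a : 0 <= F p a by rewrite lee_fin !mulr_ge0// gauss_ge0.
have mF : measurable_fun setT (fun q : ('rV[R]_d * 'rV[R]_d) * 'rV[R]_d => F q.1 q.2).
  by rewrite /F; meas.
transitivity (\int[mm d]_p \int[mu d]_a F p a).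
  apply: eq_integralT => p.
  transitivity (\int[mu d]_a ((g p.1 * h p.2 * gauss t (p.1 - p.2))%:E *
      (gauss (4 * t) (a - 2^-1 *: (p.1 + p.2)))%:E)).
    rewrite (integralT_ge0Zl _ (f := fun a : 'rV[R]_d => (gauss (4 * t) (a - 2^-1 *: (p.1 + p.2)))%:E)).
    - by rewrite integral_gaussr ?mule1// mulr_gt0.
    - by meas.
    - by rewrite lee_fin !mulr_ge0// gauss_ge0.
    - by move=> a; rewrite lee_fin gauss_ge0.
  apply: eq_integralT => a; rewrite /F -EFinM; congr EFin.
  by rewrite [RHS]mulrACA gauss_semigroup//; ring.
rewrite integral_swap//; apply: eq_integralT => a.
rewrite integral_leb2l//; last by rewrite /F; meas.
rewrite -(@integral_prod2 R _ _ _ _ (mu d) (mu d)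
  (fun x : 'rV[R]_d => (g x * gauss (2 * t) (x - a))%:E) (fun x : 'rV[R]_d => (h x * gauss (2 * t) (x - a))%:E))//.
- by meas.
- by meas.
- by move=> x; rewrite lee_fin mulr_ge0// gauss_ge0.
- by move=> x; rewrite lee_fin mulr_ge0// gauss_ge0.
Qed.

(* Positive definiteness of the heat kernel. *)
Lemma heat_pairing_le d t (g h : 'rV[R]_d -> R) : (0 < t)%R ->
  measurable_fun setT g -> measurable_fun setT h ->
  (forall x, (0 <= g x)%R) -> (forall x, (0 <= h x)%R) ->
  heat_pairing t g h + heat_pairing t g h <=
  heat_pairing t g g + heat_pairing t h h.
Proof.
move=> t0 mg mh g0 h0.
rewrite (heat_pairingE t0 mg mh g0 h0) (heat_pairingE t0 mg mg g0 g0).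
rewrite (heat_pairingE t0 mh mh h0 h0).
set G := fun a : 'rV[R]_d => \int[mu d]_x (g x * gauss (2 * t) (x - a))%:E.
set H := fun a : 'rV[R]_d => \int[mu d]_x (h x * gauss (2 * t) (x - a))%:E.
have mG : measurable_fun setT G.
  apply: (@measurable_integral_section _ _ _ _ R (mu d)
    (fun a x : 'rV[R]_d => (g x * gauss (2 * t) (x - a))%:E)); first by meas.
  by move=> a x; rewrite lee_fin mulr_ge0// gauss_ge0.
have mH : measurable_fun setT H.
  apply: (@measurable_integral_section _ _ _ _ R (mu d)
    (fun a x : 'rV[R]_d => (h x * gauss (2 * t) (x - a))%:E)); first by meas.
  by move=> a x; rewrite lee_fin mulr_ge0// gauss_ge0.
have G0 a : 0 <= G a.
  by apply: integralT_ge0 => x; rewrite lee_fin mulr_ge0// gauss_ge0.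
have H0 a : 0 <= H a.
  by apply: integralT_ge0 => x; rewrite lee_fin mulr_ge0// gauss_ge0.
have mM (f f' : 'rV[R]_d -> \bar R) : measurable_fun setT f -> measurable_fun setT f' ->
  measurable_fun setT (fun a => f a * f' a) by move=> mf' mg'; exact: emeasurable_funM.
have M0 (f f' : 'rV[R]_d -> \bar R) : (forall a, 0 <= f a) -> (forall a, 0 <= f' a) ->
  forall a, 0 <= f a * f' a by move=> f0 g0' a; exact: mule_ge0.
rewrite -[leLHS](integralT_ge0D _ (mM _ _ mG mH) (mM _ _ mG mH) (M0 _ _ G0 H0) (M0 _ _ G0 H0)).
rewrite -[leRHS](integralT_ge0D _ (mM _ _ mG mG) (mM _ _ mH mH) (M0 _ _ G0 G0) (M0 _ _ H0 H0)).
apply: integralT_ge0_le.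
- by apply: emeasurable_funD; exact: mM.
- by apply: emeasurable_funD; exact: mM.
- by move=> a; rewrite adde_ge0// mule_ge0.
- by move=> a; exact: lee_amgm.
Qed.

End heat_form.

(** * Heat forms of tensor products *)

Definition tensor (R : realType) n k (v : 'rV[R]_n -> R) (w : 'rV[R]_k -> R) :
    'rV[R]_(n + k) -> R :=
  fun z => v (lsubmx z) * w (rsubmx z).

Section tensor.
Context (R : realType) (n k : nat) (v : 'rV[R]_n -> R) (w : 'rV[R]_k -> R).
Hypotheses (mv : measurable_fun setT v) (mw : measurable_fun setT w).
Local Open Scope ereal_scope.

Lemma measurable_tensor : measurable_fun setT (tensor v w).
Proof. by rewrite /tensor; meas. Qed.

Lemma integral_tensor_sqr : \int[mu (n + k)]_z (tensor v w z ^+ 2)%:E =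
  \int[mu n]_x (v x ^+ 2)%:E * \int[mu k]_y (w y ^+ 2)%:E.
Proof.
have mt := measurable_tensor.
rewrite integral_row_mx; [|by meas|by nn].
rewrite -[RHS](@iterated_integralM _ _ _ _ R (mu n) (mu k)
  (fun x => v x ^+ 2)%R (fun y => w y ^+ 2)%R); [|by meas|by meas|by nn|by nn].
apply: eq_integralT => x; apply: eq_integralT => y.
by rewrite /tensor row_mxKl row_mxKr exprMn.
Qed.

(* With [a = v x], [a' = v x'], [b = w y] and [b' = w y'], integrate
   2 (a b - a' b')^2 + (a - a')^2 (b - b')^2 + a^2 b'^2 + a'^2 b^2
   = a^2 b^2 + a'^2 b'^2 + (a^2 + a'^2) (b - b')^2 + (a - a')^2 (b^2 + b'^2)
   against the product of the heat kernels. *)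
Lemma heat_form_tensor t : (0 < t)%R ->
  let A := \int[mu n]_x (v x ^+ 2)%:E in let B := \int[mu k]_x (w x ^+ 2)%:E in
  A < +oo -> B < +oo ->
  heat_form t (tensor v w) + heat_form t (tensor v w) + heat_form t v * heat_form t w =
  (A + A) * heat_form t w + heat_form t v * (B + B).
Proof.
move=> t0 A B Aoo Boo.
have mt := measurable_tensor.
pose a1 (p : 'rV[R]_n * 'rV[R]_n) := (v p.1 ^+ 2 * gauss t (p.1 - p.2))%R.
pose a2 (p : 'rV[R]_n * 'rV[R]_n) := (v p.2 ^+ 2 * gauss t (p.1 - p.2))%R.
pose a3 (p : 'rV[R]_n * 'rV[R]_n) := ((v p.1 - v p.2) ^+ 2 * gauss t (p.1 - p.2))%R.
pose b1 (p : 'rV[R]_k * 'rV[R]_k) := (w p.1 ^+ 2 * gauss t (p.1 - p.2))%R.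
pose b2 (p : 'rV[R]_k * 'rV[R]_k) := (w p.2 ^+ 2 * gauss t (p.1 - p.2))%R.
pose b3 (p : 'rV[R]_k * 'rV[R]_k) := ((w p.1 - w p.2) ^+ 2 * gauss t (p.1 - p.2))%R.
have ma1 : measurable_fun setT a1 by rewrite /a1; meas.
have ma2 : measurable_fun setT a2 by rewrite /a2; meas.
have ma3 : measurable_fun setT a3 by rewrite /a3; meas.
have mb1 : measurable_fun setT b1 by rewrite /b1; meas.
have mb2 : measurable_fun setT b2 by rewrite /b2; meas.
have mb3 : measurable_fun setT b3 by rewrite /b3; meas.
have a10 p : (0 <= a1 p)%R by rewrite /a1; nn.
have a20 p : (0 <= a2 p)%R by rewrite /a2; nn.
have a30 p : (0 <= a3 p)%R by rewrite /a3; nn.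
have b10 p : (0 <= b1 p)%R by rewrite /b1; nn.
have b20 p : (0 <= b2 p)%R by rewrite /b2; nn.
have b30 p : (0 <= b3 p)%R by rewrite /b3; nn.
have ia1 : \int[mm n]_p (a1 p)%:E = A.
  under eq_integral do rewrite EFinM.
  by apply: (integral_gauss_fst (f := fun x => (v x ^+ 2)%:E)) => //; [meas|nn].
have ia2 : \int[mm n]_p (a2 p)%:E = A.
  under eq_integral do rewrite EFinM.
  by apply: (integral_gauss_snd (f := fun x => (v x ^+ 2)%:E)) => //; [meas|nn].
have ib1 : \int[mm k]_p (b1 p)%:E = B.
  under eq_integral do rewrite EFinM.
  by apply: (integral_gauss_fst (f := fun x => (w x ^+ 2)%:E)) => //; [meas|nn].
have ib2 : \int[mm k]_p (b2 p)%:E = B.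
  under eq_integral do rewrite EFinM.
  by apply: (integral_gauss_snd (f := fun x => (w x ^+ 2)%:E)) => //; [meas|nn].
pose I := @iterated_integral _ _ _ _ R (mm n) (mm k).
pose T p q := ((tensor v w (row_mx p.1 q.1) - tensor v w (row_mx p.2 q.2)) ^+ 2 *
  gauss t (row_mx p.1 q.1 - row_mx p.2 q.2))%R.
have T0 p q : (0 <= T p q)%R by rewrite /T; nn.
have mT : measurable_fun setT (fun x => T x.1 x.2) by rewrite /T; meas.
have IT : I T = heat_form t (tensor v w).
  by rewrite /heat_form integral_row_mx2//; [meas|nn].
pose ok (F : 'rV[R]_n * 'rV[R]_n -> 'rV[R]_k * 'rV[R]_k -> R) :=
  measurable_fun setT (fun x : ('rV[R]_n * 'rV[R]_n) * ('rV[R]_k * 'rV[R]_k) =>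
    F x.1 x.2) /\ forall p q, (0 <= F p q)%R.
have okD F G : ok F -> ok G -> ok (fun p q => F p q + G p q)%R.
  by move=> [mF F0] [mG G0]; split; [exact: measurable_funD|nn].
have okM (f : 'rV[R]_n * 'rV[R]_n -> R) (g : 'rV[R]_k * 'rV[R]_k -> R) : measurable_fun setT f -> measurable_fun setT g ->
    (forall p, 0 <= f p)%R -> (forall q, 0 <= g q)%R -> ok (fun p q => f p * g q)%R.
  by move=> mf mg f0 g0; split; [meas|nn].
have ID F G : ok F -> ok G -> I (fun p q => F p q + G p q)%R = I F + I G.
  by move=> [mF F0] [mG G0]; exact: iterated_integralD.
have IM (f : 'rV[R]_n * 'rV[R]_n -> R) (g : 'rV[R]_k * 'rV[R]_k -> R) : measurable_fun setT f -> measurable_fun setT g ->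
    (forall p, 0 <= f p)%R -> (forall q, 0 <= g q)%R ->
    I (fun p q => f p * g q)%R = \int[mm n]_p (f p)%:E * \int[mm k]_q (g q)%:E.
  by move=> mf mg f0 g0; exact: iterated_integralM.
have okT : ok T by [].
have ok11 := okM _ _ ma1 mb1 a10 b10.
have ok22 := okM _ _ ma2 mb2 a20 b20.
have ok12 := okM _ _ ma1 mb2 a10 b20.
have ok21 := okM _ _ ma2 mb1 a20 b10.
have ok33 := okM _ _ ma3 mb3 a30 b30.
have ok13 := okM _ _ ma1 mb3 a10 b30.
have ok23 := okM _ _ ma2 mb3 a20 b30.
have ok31 := okM _ _ ma3 mb1 a30 b10.
have ok32 := okM _ _ ma3 mb2 a30 b20.
have key : I (fun p q => (T p q + T p q + a3 p * b3 q) + (a1 p * b2 q + a2 p * b1 q))%R =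
   I (fun p q => (a1 p * b1 q + a2 p * b2 q) +
     ((a1 p * b3 q + a2 p * b3 q) + (a3 p * b1 q + a3 p * b2 q)))%R.
  congr (iterated_integral _ _ _); apply/funext => p; apply/funext => q.
  rewrite /T /tensor !row_mxKl !row_mxKr opp_row_mx add_row_mx gauss_row_mx.
  by rewrite /a1 /a2 /a3 /b1 /b2 /b3; ring.
move: key.
rewrite (ID _ _ (okD _ _ (okD _ _ okT okT) ok33) (okD _ _ ok12 ok21)).
rewrite (ID _ _ (okD _ _ okT okT) ok33) (ID _ _ okT okT) (ID _ _ ok12 ok21).
rewrite (ID _ _ (okD _ _ ok11 ok22) (okD _ _ (okD _ _ ok13 ok23) (okD _ _ ok31 ok32))).
rewrite (ID _ _ ok11 ok22) (ID _ _ (okD _ _ ok13 ok23) (okD _ _ ok31 ok32)).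
rewrite (ID _ _ ok13 ok23) (ID _ _ ok31 ok32) IT.
rewrite (IM _ _ ma1 mb1 a10 b10) (IM _ _ ma2 mb2 a20 b20) (IM _ _ ma1 mb2 a10 b20).
rewrite (IM _ _ ma2 mb1 a20 b10) (IM _ _ ma3 mb3 a30 b30) (IM _ _ ma1 mb3 a10 b30).
rewrite (IM _ _ ma2 mb3 a20 b30) (IM _ _ ma3 mb1 a30 b10) (IM _ _ ma3 mb2 a30 b20).
rewrite ia1 ia2 ib1 ib2 -/(heat_form t v) -/(heat_form t w) => key.
have A0 : 0 <= A by apply: integralT_ge0 => x; rewrite lee_fin sqr_ge0.
have B0 : 0 <= B by apply: integralT_ge0 => x; rewrite lee_fin sqr_ge0.
(* This term stands on both sides of the integrated identity; finiteness of [A] and [B] is what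
   allows cancelling it in [\bar R]. *)
have ABfin : A * B + A * B \is a fin_num.
  by rewrite fin_numD !fin_numM// ge0_fin_numE.
have v0 := heat_form_ge0 t v; have w0 := heat_form_ge0 t w.
rewrite -[LHS](addeK _ ABfin) key [X in X - _]addeC (addeK _ ABfin).
by rewrite [(A + A) * _]ge0_muleDl// [_ * (B + B)]ge0_muleDr.
Qed.

End tensor.

(** The heat form of u when heat diffuses in the first n coordinates only, the other k coordinates
    being mere parameters. *)
Definition heat_form_slices (R : realType) n k (t : R) (u : 'rV[R]_(n + k) -> R) : \bar R :=
  (\int[mu k]_y heat_form t (fun x : 'rV[R]_n => u (row_mx x y)))%E.

Section slices.
Context (R : realType) (n k : nat) (u : 'rV[R]_(n + k) -> R).
Hypotheses (mu0 : measurable_fun setT u) (u0 : forall z, 0 <= u z).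
Local Open Scope ereal_scope.
Let s (y : 'rV[R]_k) (x : 'rV[R]_n) := u (row_mx x y).

Lemma integral_slices (f : 'rV[R]_(n + k) -> \bar R) : measurable_fun setT f ->
  (forall z, 0 <= f z) ->
  \int[mu (n + k)]_z f z = \int[mu k]_y \int[mu n]_x f (row_mx x y).
Proof.
move=> mf f0; rewrite integral_row_mx// integral_swap//; meas.
Qed.

Lemma measurable_slice y : measurable_fun setT (s y).
Proof. by rewrite /s; meas. Qed.

Lemma measurable_heat_form_slice t : measurable_fun setT (fun y => heat_form t (s y)).
Proof.
apply: (@measurable_integral_section _ _ _ _ R (mm n)
  (fun (y : 'rV[R]_k) (p : 'rV[R]_n * 'rV[R]_n) =>
    ((s y p.1 - s y p.2) ^+ 2 * gauss t (p.1 - p.2))%:E)); first by rewrite /s; meas.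
by nn.
Qed.

Lemma measurable_heat_pairing_slice t :
  measurable_fun setT (fun q : 'rV[R]_k * 'rV[R]_k => heat_pairing t (s q.1) (s q.2)).
Proof.
apply: (@measurable_integral_section _ _ _ _ R (mm n)
  (fun (q : 'rV[R]_k * 'rV[R]_k) (p : 'rV[R]_n * 'rV[R]_n) =>
    (s q.1 p.1 * s q.2 p.2 * gauss t (p.1 - p.2))%:E)); first by rewrite /s; meas.
by move=> q p; rewrite lee_fin !mulr_ge0// ?gauss_ge0// /s.
Qed.

Lemma heat_pairing_ge0 d t (g h : 'rV[R]_d -> R) :
  (forall x, 0 <= g x)%R -> (forall x, 0 <= h x)%R -> 0 <= heat_pairing t g h.
Proof. by move=> g0 h0; apply: integralT_ge0; nn. Qed.

Lemma heat_form_slicesD t : (0 < t)%R ->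
  let b := \int[mu k]_y heat_pairing t (s y) (s y) in
  let M := \int[mu (n + k)]_z (u z ^+ 2)%:E in
  heat_form_slices t u + (b + b) = M + M.
Proof.
move=> t0 b M.
have mb : measurable_fun setT (fun y => heat_pairing t (s y) (s y)).
  have md : measurable_fun setT (fun y : 'rV[R]_k => (y, y)) by meas.
  exact: (measurableT_comp (measurable_heat_pairing_slice t) md).
have b0 y : 0 <= heat_pairing t (s y) (s y) by apply: heat_pairing_ge0 => x; exact: u0.
have mN : measurable_fun setT (fun y => \int[mu n]_x (s y x ^+ 2)%:E).
  apply: (@measurable_integral_section _ _ _ _ R (mu n)
    (fun (y : 'rV[R]_k) (x : 'rV[R]_n) => (s y x ^+ 2)%:E)); first by rewrite /s; meas.
  by nn.
have N0 y : 0 <= \int[mu n]_x (s y x ^+ 2)%:E by apply: integralT_ge0 => x; rewrite lee_fin sqr_ge0.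
have mJ := measurable_heat_form_slice t.
have J0 y := heat_form_ge0 t (s y).
have MN : M = \int[mu k]_y \int[mu n]_x (s y x ^+ 2)%:E.
  by rewrite /M integral_slices//; [meas|nn].
rewrite MN /b /heat_form_slices.
rewrite -[RHS](integralT_ge0D _ mN mN N0 N0) -[X in _ + X](integralT_ge0D _ mb mb b0 b0).
have mbb : measurable_fun setT (fun y => heat_pairing t (s y) (s y) + heat_pairing t (s y) (s y)).
  exact: emeasurable_funD.
have bb0 y : 0 <= heat_pairing t (s y) (s y) + heat_pairing t (s y) (s y).
  exact: adde_ge0.
rewrite -[LHS](integralT_ge0D _ mJ mbb J0 bb0).
apply: eq_integralT => y; apply: heat_formD => //; first exact: measurable_slice.
by rewrite /s.
Qed.

(** The factorization of the Gaussian turns the full pairing into a Gaussian average, over pairs (y,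
    y'), of pairings of slices. Positive definiteness can then be applied to each pair. *)
Lemma heat_pairing_row_mx t :
  heat_pairing t u u =
  \int[mm k]_q ((gauss t (q.1 - q.2))%:E * heat_pairing t (s q.1) (s q.2)).
Proof.
rewrite /heat_pairing integral_row_mx2; [|by meas|by nn].
rewrite integral_swap; last 2 first.
- by meas.
- by nn.
apply: eq_integralT => q.
rewrite -integralT_ge0Zl; last 3 first.
- by rewrite /s; meas.
- by rewrite lee_fin gauss_ge0.
- by move=> p; rewrite lee_fin !mulr_ge0 ?gauss_ge0// /s.
apply: eq_integralT => p; rewrite -EFinM; congr EFin.
by rewrite opp_row_mx add_row_mx gauss_row_mx /s /=; ring.
Qed.

Lemma heat_form_slices_ge0 t : 0 <= heat_form_slices t u.
Proof. by apply: integralT_ge0 => y; exact: heat_form_ge0. Qed.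

Section confined.
Variables (t : R) (K : set 'rV[R]_k) (kappa : R).
Hypotheses (t0 : (0 < t)%R) (mK : measurable K) (k0 : (0 <= kappa)%R) (k1 : (kappa <= 1)%R).
Hypothesis uK : forall z, ~ K (rsubmx z) -> u z = 0%R.
Hypothesis escape : forall y, K y ->
  \int[mu k]_y' (\1_K y' * gauss t (y - y'))%:E <= (1 - kappa)%:E.

(** By [heat_pairing_le], the pairing of the slices at y and y' is at most the mean of their
    self-pairings [h y] and [h y']. Each self-pairing then depends on one variable only, and
    integrating the weight [w] over the other one gives at most 1 - kappa, by [escape]. The choice K
    = [setT], kappa = 0 is the case without confinement. *)
Lemma heat_pairing_confined :
  heat_pairing t u u + heat_pairing t u u <=
  (1 - kappa)%:E * (\int[mu k]_y heat_pairing t (s y) (s y) +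
                    \int[mu k]_y heat_pairing t (s y) (s y)).
Proof.
set b := \int[mu k]_y _.
have m1 : measurable_fun setT (\1_K : 'rV[R]_k -> R) by exact: measurable_indic.
pose c (q : 'rV[R]_k * 'rV[R]_k) := heat_pairing t (s q.1) (s q.2).
pose w (q : 'rV[R]_k * 'rV[R]_k) := (\1_K q.1 * \1_K q.2 * gauss t (q.1 - q.2))%R.
pose h (y : 'rV[R]_k) := heat_pairing t (s y) (s y).
have mc : measurable_fun setT c := measurable_heat_pairing_slice t.
have mw : measurable_fun setT w by rewrite /w; meas.
have md : measurable_fun setT (fun y : 'rV[R]_k => (y, y)) by meas.
have mh : measurable_fun setT h.
  exact: (measurableT_comp (measurable_heat_pairing_slice t) md).
have s0 y x : (0 <= s y x)%R by exact: u0.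
have c0 q : 0 <= c q by apply: heat_pairing_ge0 => x; exact: s0.
have h0 y : 0 <= h y by apply: heat_pairing_ge0 => x; exact: s0.
have w0 q : (0 <= w q)%R by rewrite /w !mulr_ge0 ?gauss_ge0.
have g0 (q : 'rV[R]_k * 'rV[R]_k) : 0 <= (gauss t (q.1 - q.2))%:E by rewrite lee_fin gauss_ge0.
have mg : measurable_fun setT (fun q : 'rV[R]_k * 'rV[R]_k => (gauss t (q.1 - q.2))%:E).
  by meas.
have mwE : measurable_fun setT (fun q => (w q)%:E) by exact: measurable_fineE.
have mgc : measurable_fun setT (fun q : 'rV[R]_k * 'rV[R]_k => (gauss t (q.1 - q.2))%:E * c q).
  exact: emeasurable_funM.
have gc0 (q : 'rV[R]_k * 'rV[R]_k) : 0 <= (gauss t (q.1 - q.2))%:E * c q by exact: mule_ge0.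
have mwh1 : measurable_fun setT (fun q => (w q)%:E * h q.1).
  by apply: emeasurable_funM => //; exact: measurableT_comp mh measurable_fst.
have mwh2 : measurable_fun setT (fun q => (w q)%:E * h q.2).
  by apply: emeasurable_funM => //; exact: measurableT_comp mh measurable_snd.
have wh10 q : 0 <= (w q)%:E * h q.1 by rewrite mule_ge0// lee_fin.
have wh20 q : 0 <= (w q)%:E * h q.2 by rewrite mule_ge0// lee_fin.
have mass y : \int[mu k]_y' (w (y, y'))%:E <= (1 - kappa)%:E.
  have [yK|yK] := pselect (K y).
    apply: le_trans (escape yK); rewrite le_eqVlt; apply/orP; left; apply/eqP.
    by apply: eq_integralT => y'; rewrite /w /= indicE mem_set// mul1r.
  rewrite (eq_integralT _ (g := cst 0)) ?integral0 ?lee_fin ?subr_ge0//.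
  by move=> y'; rewrite /w /= indicE memNset// !mul0r.
have wC y y' : w (y', y) = w (y, y') by rewrite /w /= gaussC [(\1_K y' * _)%R]mulrC.
have mwy y : measurable_fun setT (fun y' => (w (y, y'))%:E).
  by rewrite /w; meas.
have int1 : \int[mm k]_q ((w q)%:E * h q.1) <= (1 - kappa)%:E * b.
  rewrite (integral_leb2l mwh1 wh10) -(integralT_ge0Zl _ mh _ h0); last by rewrite lee_fin subr_ge0.
  apply: integralT_ge0_le => [||y|y].
  - by apply: (@measurable_integral_section _ _ _ _ R (mu k) (fun y y' => (w (y, y'))%:E * h y)).
  - by apply: emeasurable_funM.
  - by apply: integralT_ge0 => y'; exact: (wh10 (y, y')).
  rewrite /=; under eq_integral do rewrite muleC.
  rewrite (integralT_ge0Zl _ (mwy y))//; last by move=> y'; rewrite lee_fin.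
  by rewrite muleC lee_wpmul2r.
have int2 : \int[mm k]_q ((w q)%:E * h q.2) <= (1 - kappa)%:E * b.
  rewrite (integral_leb2r mwh2 wh20); apply: le_trans int1.
  rewrite (integral_leb2l mwh1 wh10) le_eqVlt; apply/orP; left; apply/eqP.
  by apply: eq_integralT => y; apply: eq_integralT => y'; rewrite /= wC.
rewrite (heat_pairing_row_mx t) -/c.
rewrite -[leLHS](integralT_ge0D _ mgc mgc gc0 gc0) [leRHS]ge0_muleDr; last 2 first.
- by apply: integralT_ge0.
- by apply: integralT_ge0.
apply: le_trans (leeD int1 int2).
rewrite -[leRHS](integralT_ge0D _ mwh1 mwh2 wh10 wh20).
apply: integralT_ge0_le.
- exact: emeasurable_funD.
- exact: emeasurable_funD.
- by move=> q; exact: adde_ge0.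
move=> q; rewrite -[leLHS]ge0_muleDr//.
have [qK|qK] := pselect (K q.1 /\ K q.2); last first.
  rewrite (_ : c q = 0) ?adde0 ?mule0 ?adde_ge0//.
  rewrite /c /heat_pairing (eq_integralT _ (g := cst 0)) ?integral0// => p.
  have [q1|q1] := pselect (K q.1); last first.
    by rewrite /s uK ?mul0r// row_mxKr.
  by rewrite {2}/s [u (row_mx _ q.2)]uK ?mulr0 ?mul0r// row_mxKr => q2; apply: qK.
rewrite -[leRHS]ge0_muleDr// /w !indicE !mem_set ?mul1r; [|exact: qK.2|exact: qK.1].
apply: lee_wpmul2l => //; apply: heat_pairing_le => //; exact: measurable_slice.
Qed.

(* By [heat_formD] and its analogue for slices, the two forms are 2 |u|^2 minus
   twice a pairing, and [heat_pairing_confined] compares these pairings. *)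
Lemma heat_form_confined :
  let M := \int[mu (n + k)]_z (u z ^+ 2)%:E in M < +oo ->
  heat_form_slices t u + kappa%:E * (M + M) <= heat_form t u + kappa%:E * heat_form_slices t u.
Proof.
move=> M Moo.
have := heat_formD t0 mu0 u0; rewrite -/M.
have := heat_form_slicesD t0; rewrite -/M.
have := heat_pairing_confined.
set b := \int[mu k]_y _.
have M0 : 0 <= M by apply: integralT_ge0 => x; rewrite lee_fin sqr_ge0.
have b0 : 0 <= b by apply: integralT_ge0 => y; apply: heat_pairing_ge0 => x; exact: u0.
move: Moo M0 b0 (heat_form_ge0 t u) (heat_form_slices_ge0 t) (heat_pairing_ge0 t u0 u0).
move: M b (heat_form t u) (heat_form_slices t u) (heat_pairing t u u).
(* All terms are nonnegative, so the two identities make every quantity finite once [M] is; what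
   remains is an inequality between real numbers. *)
move=> [M| |]// [b| |]// [J| |]// [X| |]// [S| |]// _.
move=> M0 b0 J0 X0 S0 Sb XM JM.
have {}M0 : (0 <= M)%R by exact: M0.
have {}b0 : (0 <= b)%R by exact: b0.
have {}Sb : (S + S <= (1 - kappa) * (b + b))%R by exact: Sb.
have {}XM : (X + (b + b) = M + M)%R by case: XM.
have {}JM : (J + (S + S) = M + M)%R by case: JM.
change (X + kappa * (M + M) <= J + kappa * X)%R.
nra.
Qed.

End confined.

End slices.

(** * Subordination *)

Section power_integrals.
Context (R : realType).
Local Notation leb := (@lebesgue_measure R).
Implicit Types a c x : R.

Lemma powR_continuous a x : 0 < x -> {for x, continuous (fun t : R => t `^ a)}.
Proof.
move=> x0; apply/differentiable_continuous/derivable1_diffP.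
by apply: derivable_powR; rewrite in_itv/= x0.
Qed.

Let primitive a (x : R) := a^-1 * x `^ a.

Let is_derive_primitive a x : a != 0 -> 0 < x ->
  is_derive x 1 (primitive a) (x `^ (a - 1)).
Proof.
move=> a0 x0; rewrite (_ : primitive a = a^-1 *: (fun t : R => t `^ a)); last first.
  by apply/funext.
have /= := @is_deriveZ _ _ _ (fun t : R => t `^ a) a^-1 x 1 _ (is_derive1_powR a x0).
by move=> /is_derive_eq; apply; rewrite /GRing.scale/= mulrA mulVf// mul1r.
Qed.

Let primitive_continuous a x : a != 0 -> 0 < x -> {for x, continuous (primitive a)}.
Proof.
move=> a0 x0; apply/differentiable_continuous/derivable1_diffP.
by have [] := is_derive_primitive a0 x0.
Qed.

Let derive_primitive a x : a != 0 -> 0 < x -> (primitive a)^`()%classic x = x `^ (a - 1).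
Proof.
by move=> a0 x0; rewrite derive1E; have [_ ->] := is_derive_primitive a0 x0.
Qed.

Lemma integral_powR_itv0 a : 0 < a ->
  (\int[leb]_(t in `]0%R, 1%R]) (t `^ (a - 1))%:E <= (a^-1)%:E)%E.
Proof.
move=> a0; have an0 := lt0r_neq0 a0.
(* The exhaustion starts at 1/2 so that every left endpoint is strictly below 1, as the fundamental
   theorem of calculus requires. Since an upper bound suffices, the value of the primitive at the
   left endpoint is simply dropped. *)
pose F (i : nat) : set (measurableTypeR R) := `[(i.+2%:R^-1 : R), 1]%classic.
have -> : `]0%R, 1%R]%classic = \bigcup_i F i.
  apply/seteqP; split => [x /=|x [i _]]; rewrite /F /= !in_itv/=.
    move=> /andP[x0 x1].
    have [k _ kP] := near_infty_natSinv_lt (PosNum x0).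
    exists k => //=; rewrite in_itv/= x1 andbT ltW//.
    by have /= := kP k.+1; apply; exact: leqnSn.
  by move=> /andP[ix ->]; rewrite andbT (lt_le_trans _ ix)// invr_gt0.
have mf D : measurable_fun D (fun t : measurableTypeR R => (t `^ (a - 1))%:E).
  by apply: measurable_funTS; meas.
have := @ge0_nondecreasing_set_cvg_integral _ _ R F (fun t => (t `^ (a - 1))%:E) leb.
move=> /(_ _ _ (fun i => mf _)) H; apply: (cvge_to_le (H _ _ _)).
- apply/nondecreasing_seqP => i; apply/subsetPset => x; rewrite /F /= !in_itv/=.
  move=> /andP[ix ->]; rewrite andbT (le_trans _ ix)// lef_pV2 ?posrE//.
  by rewrite ler_nat.
- by move=> i; exact: measurable_itv.
- by move=> i x _; rewrite lee_fin powR_ge0.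
near=> i; have i0 : (0 : R) < i.+2%:R^-1 by rewrite invr_gt0.
have i1 : (i.+2%:R^-1 : R) < 1 by rewrite invf_lt1// ltr1n.
rewrite (@continuous_FTC2 _ _ (primitive a))//.
- rewrite -EFinB lee_fin /primitive powR1 mulr1 gerBl mulr_ge0 ?powR_ge0//.
  by rewrite invr_ge0 ltW.
- apply: continuous_in_subspaceT => x; rewrite inE/= in_itv/= => /andP[ix _].
  by apply: powR_continuous; exact: lt_le_trans ix.
- split.
  + move=> x; rewrite in_itv/= => /andP[ix _].
    by have [] := is_derive_primitive an0 (lt_trans i0 ix).
  + by apply: cvg_at_right_filter; exact: primitive_continuous.
  + by apply: cvg_at_left_filter; exact: primitive_continuous.
- move=> x; rewrite in_itv/= => /andP[ix _].
  by rewrite derive_primitive// (lt_trans i0 ix).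
Unshelve. all: by end_near. Qed.

Lemma integral_powR_itvy c : 0 < c ->
  (\int[leb]_(t in `[1%R, +oo[) (t `^ (- c - 1))%:E = (c^-1)%:E)%E.
Proof.
move=> c0; have cn0 : - c != 0 by rewrite oppr_eq0 lt0r_neq0.
rewrite (@ge0_continuous_FTC2y _ _ (primitive (- c)) _ 0).
- by rewrite -EFinB sub0r /primitive powR1 mulr1 invrN opprK.
- by move=> x _; exact: powR_ge0.
- apply: continuous_in_subspaceT => x; rewrite inE/= in_itv/= andbT => x1.
  by apply: powR_continuous; exact: lt_le_trans x1.
- rewrite -[0](mulr0 ((- c)^-1)); apply: cvgM; first exact: cvg_cst.
  under eq_fun do rewrite powRN.
  have p0 : \forall x \near +oo, 0 < x `^ c by near=> x; rewrite powR_gt0.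
  apply/(gtr0_cvgV0 p0).
  apply/cvgryPge => A.
  (* x^c exceeds A as soon as x is at least max(A, 1)^(1/c); the maximum keeps the base of the power
     nonnegative. *)
  near=> x; apply: (@le_trans _ _ (((Num.max A 1) `^ c^-1) `^ c)).
    by rewrite -powRrM mulVf ?powRr1 ?le_max ?lexx ?ler01 ?orbT// lt0r_neq0.
  apply: ge0_ler_powR; rewrite ?nnegrE ?powR_ge0 ?ltW//.
- move=> x x1.
  by have [] := is_derive_primitive cn0 (lt_trans ltr01 x1).
- by apply: cvg_at_right_filter; exact: primitive_continuous.
- move=> x; rewrite in_itv/= andbT => x1.
  by rewrite derive_primitive// (lt_trans ltr01 x1).
Unshelve. all: by end_near. Qed.

End power_integrals.

(** * Convergence, positivity and scaling of the Gamma integral *)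

Section gamma.
Context (R : realType).
Local Notation leb := (@lebesgue_measure R).
Implicit Types a x : R.

Let f a (t : R) := t `^ (a - 1) * expR (- t).

Let f_ge0 a t : 0 <= f a t.
Proof. by rewrite mulr_ge0 ?powR_ge0 ?expR_ge0. Qed.

Let mf a D : measurable_fun D (fun t : measurableTypeR R => (f a t)%:E).
Proof. by apply: measurable_funTS; rewrite /f; meas. Qed.

Lemma Gamma_integral_lty a : 0 < a -> (\int[leb]_(t in `]0%R, +oo[) (f a t)%:E < +oo)%E.
Proof.
move=> a0.
have -> : `]0%R, +oo[%classic = `]0%R, 1%R] `|` `]1%R, +oo[ :> set R.
  by rewrite -itv_bndbnd_setU// bnd_simp.
rewrite ge0_integral_setU//=; last 2 first.
- by move=> t _; rewrite lee_fin.
- apply/disj_set2P; apply/seteqP; split => // t [] /=.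
  by rewrite !in_itv/= => /andP[_ t1]; rewrite andbT ltNge t1.
apply: lte_add_pinfty.
  apply: (@le_lt_trans _ _ (\int[leb]_(t in `]0%R, 1%R]) (t `^ (a - 1))%:E)%E).
    apply: ge0_le_integral.
    - exact: measurable_itv.
    - by move=> t _; rewrite lee_fin.
    - exact: mf.
    - by apply: measurable_funTS; meas.
    - move=> t /=; rewrite in_itv/= => /andP[t0 _]; rewrite lee_fin /f.
      by rewrite ler_piMr ?powR_ge0// -expR0 ler_expR oppr_le0 ltW.
  by apply: le_lt_trans (integral_powR_itv0 a0) _; rewrite ltry.
(* As N > a + 1, for t >= 1 one has t^(a+1) <= t^(N+1) <= (N+1)! exp(t), so the integrand is at most
   C t^(-2). *)
pose N := (Num.truncn (a + 1)).+1; pose C : R := N.+1`!%:R.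
apply: (@le_lt_trans _ _ (\int[leb]_(t in `[1%R, +oo[) (C%:E * (t `^ (- 1 - 1))%:E))%E).
  apply: (@le_trans _ _ (\int[leb]_(t in `[1%R, +oo[) (f a t)%:E)%E).
    apply: ge0_subset_integral.
    - exact: measurable_itv.
    - exact: measurable_itv.
    - exact: mf.
    - by move=> t _; rewrite lee_fin.
    - by apply: subset_itvr; rewrite bnd_simp.
  apply: ge0_le_integral.
  - exact: measurable_itv.
  - by move=> t _; rewrite lee_fin.
  - exact: mf.
  - by apply: measurable_funTS; meas.
  - move=> t /=; rewrite in_itv/= andbT => t1; rewrite -EFinM lee_fin /f.
    have t0 : 0 < t by exact: lt_le_trans t1.
    rewrite (_ : a - 1 = (a + 1) + (-1 - 1)); last by ring.
    rewrite powRD; last by rewrite (gt_eqF t0) implybT.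
    rewrite mulrAC ler_pM2r ?powR_gt0// expRN ler_pdivrMr ?expR_gt0//.
    have tN : t `^ (a + 1) <= t ^+ N.+1.
      rewrite -powR_mulrn ?(ltW t0)//; apply: ler_powR => //.
      by rewrite (le_trans (ltW (truncnS_gt _)))// ler_nat.
    apply: (le_trans tN).
    have := expR_ge1Dxn N (ltW t0); rewrite -/C => H.
    have C0 : 0 < C by rewrite ltr0n fact_gt0.
    rewrite -ler_pdivrMl// mulrC; apply: le_trans H.
    by rewrite lerDr.
rewrite ge0_integralZl//; last 3 first.
- by apply: measurable_funTS; meas.
- by move=> t _; rewrite lee_fin powR_ge0.
- by rewrite lee_fin.
rewrite integral_powR_itvy// -EFinM ltry//.
Qed.

(** [Gamma] is a real-valued integral obtained through [fine], which would send an infinite value to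
    0; convergence is what makes it the genuine integral. *)
Lemma GammaE a : 0 < a -> ((Gamma a)%:E = \int[leb]_(t in `]0%R, +oo[) (f a t)%:E)%E.
Proof.
move=> a0; rewrite /Gamma /Rintegral fineK// ge0_fin_numE; first exact: Gamma_integral_lty.
by apply: integral_ge0 => t _; rewrite lee_fin; exact: f_ge0.
Qed.

Lemma Gamma_gt0 a : 0 < a -> 0 < Gamma a.
Proof.
move=> a0; rewrite -lte_fin GammaE//.
(* On ]1, 2], t^(a-1) = t^a / t is at least 1/2 whatever the sign of a - 1, and exp(-t) is at least
   exp(-2). *)
apply: (@lt_le_trans _ _ (\int[leb]_(t in `]1%R, 2%R]) (2^-1 * expR (- 2))%:E)%E).
  rewrite integral_cst/=; last exact: measurable_itv.
  rewrite lebesgue_measure_itv/= lte_fin ltr1n/= -EFinB -EFinM lte_fin.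
  by rewrite mulr_gt0// ?mulr_gt0 ?expR_gt0// subr_gt0 ltr1n.
apply: (@le_trans _ _ (\int[leb]_(t in `]1%R, 2%R]) (f a t)%:E)%E).
  apply: ge0_le_integral.
  - exact: measurable_itv.
  - by move=> t _; rewrite lee_fin mulr_ge0 ?expR_ge0.
  - exact: measurable_cst.
  - exact: mf.
  - move=> t /=; rewrite in_itv/= => /andP[t1 t2]; rewrite lee_fin /f.
    have t0 : 0 < t by exact: lt_trans t1.
    apply: ler_pM; rewrite ?expR_ge0 ?ler_expR ?lerN2//.
    rewrite powRB ?(gt_eqF t0) ?implybT// powRr1 ?(ltW t0)//.
    rewrite ler_pdivlMr// (@le_trans _ _ 1)//.
      by rewrite mulrC ler_pdivrMr// mul1r.
    by rewrite -(powRr0 t); apply: ler_powR; exact: ltW.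
apply: ge0_subset_integral.
- exact: measurable_itv.
- exact: measurable_itv.
- exact: mf.
- by move=> t _; rewrite lee_fin.
- by move=> t /=; rewrite !in_itv/= => /andP[t1 _]; rewrite (lt_trans _ t1).
Qed.

Lemma Gamma_scale a x : 0 < a -> 0 < x ->
  (\int[leb]_t (\1_`]0%R, +oo[ t * (t `^ (a - 1) * expR (- (t * x))))%:E =
   (Gamma a / x `^ a)%:E)%E.
Proof.
move=> a0 x0.
(* Chosen so that [g (x * t)] is the integrand: the factor x^(1-a) cancels the x^(a-1) coming out of
   (x t)^(a-1). *)
pose g (t : R) := (x `^ (1 - a) * (\1_`]0%R, +oo[ t * f a t))%:E.
have mg : measurable_fun setT g.
  by rewrite /g /f; have mi := measurable_indic (measurable_itv `]0%R, +oo[ : measurable (`]0%R, +oo[%classic : set R)); meas.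
have g0 t : (0 <= g t)%E by rewrite lee_fin !mulr_ge0 ?powR_ge0.
transitivity (\int[leb]_t g (x * t)%R)%E.
  apply: eq_integralT => t; rewrite /g; congr EFin; rewrite !indicE.
  have -> : ((x * t : R) \in `]0%R, +oo[%classic) = ((t : R) \in `]0%R, +oo[%classic).
    by apply/idP/idP; rewrite !inE/= !in_itv/= !andbT pmulr_rgt0.
  have [|] := boolP (t \in _); rewrite ?mul0r ?mulr0// inE/= in_itv/= andbT => t0.
  rewrite !mul1r /f powRM ?(ltW x0) ?(ltW t0)// !mulrA -powRD ?(gt_eqF x0) ?implybT//.
  by rewrite (_ : 1 - a + (a - 1) = 0) ?powRr0 ?mul1r ?[t * x]mulrC//; ring.
rewrite lebesgue_integral_scale//.
have -> : (\int[leb]_t g t = (x `^ (1 - a))%:E * (Gamma a)%:E)%E.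
  rewrite GammaE// [in RHS]integral_mkcond -integralT_ge0Zl.
  - apply: eq_integralT => t; rewrite /g patchE indicE.
    by case: ifPn => _; rewrite ?mul1r ?mul0r ?mulr0 ?mule0.
  - exact/(measurable_restrictT _ _).1.
  - by rewrite lee_fin powR_ge0.
  - by move=> t; rewrite patchE; case: ifPn; rewrite ?lee_fin.
rewrite -!EFinM powRB ?(gt_eqF x0) ?implybT// powRr1 ?(ltW x0)//; congr EFin.
by field; rewrite ?lt0r_neq0 ?powR_gt0.
Qed.

End gamma.

(* The weight in the subordination formula
   |xi|^(2s) = c \int_0^oo (1 - exp (- |xi|^2 / (4t))) t^(s - 1) dt,
   written with the inverse time as variable of integration. *)
Definition subordinator (R : realType) (s t : R) : R :=
  s * 2 `^ (2 * s) / Gamma (1 - s) / 2 * (\1_`]0, +oo[ t * t `^ (s - 1)).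

(** * The energy as a weighted integral of heat forms *)

Section energy.
Context (R : realType) (s : R).
Hypothesis s01 : 0 < s < 1.
Local Notation leb := (@lebesgue_measure R).

Lemma subordinator_const_gt0 : 0 < s * 2 `^ (2 * s) / Gamma (1 - s) / 2.
Proof.
move: s01 => /andP[s0 s1].
by rewrite !divr_gt0// ?mulr_gt0 ?powR_gt0// Gamma_gt0// subr_gt0.
Qed.

Lemma subordinator_ge0 t : 0 <= subordinator s t.
Proof. by rewrite mulr_ge0 ?(ltW subordinator_const_gt0)// mulr_ge0 ?powR_ge0. Qed.

Lemma measurable_subordinatorT d (T : measurableType d) (f : T -> R) :
  measurable_fun setT f -> measurable_fun setT (fun x => subordinator s (f x)).
Proof.
move=> mf; have mi : measurable_fun setT (\1_`]0%R, +oo[ : R -> R).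
  by apply: measurable_indic; exact: measurable_itv.
by rewrite /subordinator; meas.
Qed.

Lemma measurable_subordinator :
  measurable_fun (setT : set (measurableTypeR R)) (subordinator s).
Proof. by apply: (measurable_subordinatorT (f := id)); exact: measurable_id. Qed.

Lemma measurable_heat_form d (w : 'rV[R]_d -> R) : measurable_fun setT w ->
  measurable_fun (setT : set (measurableTypeR R)) (fun t => heat_form t w).
Proof.
move=> mw.
apply: (@measurable_integral_section _ _ _ _ R (mm d)
  (fun (t : measurableTypeR R) (p : 'rV[R]_d * 'rV[R]_d) =>
    ((w p.1 - w p.2) ^+ 2 * gauss t (p.1 - p.2))%:E)); first by meas.
by nn.
Qed.

Lemma measurable_weighted_heat_form d (w : 'rV[R]_d -> R) : measurable_fun setT w ->
  measurable_fun (setT : set (measurableTypeR R))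
    (fun t => (subordinator s t)%:E * heat_form t w)%E.
Proof.
move=> mw; apply: emeasurable_funM; last exact: measurable_heat_form.
by apply: measurable_fineE; exact: measurable_subordinator.
Qed.

Lemma Cds_ge0 d : 0 <= Cds d s.
Proof.
move: s01 => /andP[s0 s1]; rewrite /Cds.
rewrite mulr_ge0 ?divr_ge0 ?mulr_ge0 ?powR_ge0 ?(ltW s0)// ltW// Gamma_gt0 ?subr_gt0//.
by rewrite divr_gt0// ltr_wpDl// mulr_gt0.
Qed.

(** After the Gaussian prefactor t^(d/2) joins the weight t^(s-1), the integral in t is a Gamma
    integral of exponent [a = (d + 2s) / 2] scaled by |z|^2. It yields the second Gamma factor of
    [Cds], the normalization of the Gaussian yields pi^(d/2), and the constant of [subordinator] is
    the rest. *)
Lemma riesz_kernel_subordination d (z : 'rV[R]_d) : z != 0 ->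
  (\int[leb]_t (subordinator s t * gauss t z)%:E =
   (Cds d s / 2 / enorm z `^ (d%:R + 2 * s))%:E)%E.
Proof.
move=> z0; move: s01 => /andP[s0 s1].
set S := \sum_(i < d) z 0 i ^+ 2.
have S0 : 0 < S.
  rewrite lt0r sumr_ge0 ?andbT; last by move=> i _; exact: sqr_ge0.
  apply: contra z0; rewrite psumr_eq0; last by move=> i _; exact: sqr_ge0.
  move=> /allP H; apply/eqP/rowP => i; rewrite mxE; apply/eqP.
  by have := H i (mem_index_enum i); rewrite sqrf_eq0.
pose a := (d%:R + 2 * s) / 2.
have a0 : 0 < a by rewrite divr_gt0// ltr_wpDl// mulr_gt0.
pose c := s * 2 `^ (2 * s) / Gamma (1 - s) / 2 / pi `^ (d%:R / 2).
pose g t := (\1_`]0%R, +oo[ t * (t `^ (a - 1) * expR (- (t * S))))%:E.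
have mi : measurable_fun setT (\1_`]0%R, +oo[ : R -> R).
  by apply: measurable_indic; exact: measurable_itv.
have mg : measurable_fun (setT : set (measurableTypeR R)) g by rewrite /g; meas.
have c0 : 0 <= c by rewrite divr_ge0 ?powR_ge0// ltW// subordinator_const_gt0.
have g0 t : (0 <= g t)%E by rewrite lee_fin !mulr_ge0 ?powR_ge0 ?expR_ge0.
transitivity (\int[leb]_t (c%:E * g t))%E.
  apply: eq_integralT => t; rewrite /g /subordinator -EFinM; congr EFin.
  rewrite !indicE; have [|] := boolP (t \in _); rewrite ?mul0r ?mulr0 ?mul0r//.
  rewrite inE/= in_itv/= andbT => t0; rewrite !mul1r gaussE// -/S /c.
  rewrite (_ : a - 1 = (s - 1) + d%:R / 2); last by rewrite /a; field.
  by rewrite (powRD (r := s - 1)) ?(gt_eqF t0) ?implybT//; ring.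
rewrite (integralT_ge0Zl _ mg)// Gamma_scale// -EFinM; congr EFin.
rewrite /enorm -/S -powR12_sqrt ?(ltW S0)// -powRrM.
rewrite (_ : 2^-1 * _ = a); last by rewrite /a mulrC.
rewrite /Cds -/a /c.
have P0 : pi `^ (d%:R / 2) != 0 :> R by rewrite lt0r_neq0// powR_gt0// pi_gt0.
have G0 : Gamma (1 - s) != 0 by rewrite lt0r_neq0// Gamma_gt0// subr_gt0.
have Sa0 : S `^ a != 0 by rewrite lt0r_neq0// powR_gt0.
move: (pi `^ _) (Gamma (1 - s)) (S `^ a) (2 `^ _) P0 G0 Sa0 => p G q e p0 G0 q0.
by field; rewrite p0 G0 q0.
Qed.

Lemma measurable_gagliardo d (u : 'rV[R]_d -> R) : measurable_fun setT u ->
  measurable_fun setT (fun p : 'rV[R]_d * 'rV[R]_d =>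
    ((u p.1 - u p.2) ^+ 2 / enorm (p.1 - p.2) `^ (d%:R + 2 * s))%:E).
Proof.
move=> mu0.
have me : measurable_fun setT (@enorm R d).
  rewrite /enorm; have ms : measurable_fun setT (@Num.sqrt R).
    by apply: continuous_measurable_fun => x; exact: sqrt_continuous.
  apply: (measurableT_comp ms); apply: measurable_sum => i; meas.
rewrite (_ : (fun _ => _) = fun p =>
  ((u p.1 - u p.2) ^+ 2 * enorm (p.1 - p.2) `^ (- (d%:R + 2 * s)))%:E); last first.
  by apply/funext => p; rewrite powRN.
by meas.
Qed.

Lemma energy_subordination d (u : 'rV[R]_d -> R) : measurable_fun setT u ->
  (energy s u = \int[leb]_t ((subordinator s t)%:E * heat_form t u))%E.
Proof.
move=> mu0.
pose K (p : 'rV[R]_d * 'rV[R]_d) :=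
  ((u p.1 - u p.2) ^+ 2 / enorm (p.1 - p.2) `^ (d%:R + 2 * s))%:E.
have mK : measurable_fun setT K by exact: measurable_gagliardo.
have K0 p : (0 <= K p)%E by rewrite lee_fin divr_ge0 ?sqr_ge0 ?powR_ge0.
have C0 : (0 <= (Cds d s / 2)%:E)%E by rewrite lee_fin divr_ge0 ?Cds_ge0.
transitivity (\int[mm d]_p ((Cds d s / 2)%:E * K p))%E.
  by rewrite (integralT_ge0Zl _ mK C0 K0).
pose F t (p : 'rV[R]_d * 'rV[R]_d) :=
  (subordinator s t * ((u p.1 - u p.2) ^+ 2 * gauss t (p.1 - p.2)))%:E.
have F0 t p : (0 <= F t p)%E by rewrite lee_fin mulr_ge0 ?subordinator_ge0// mulr_ge0 ?sqr_ge0 ?gauss_ge0.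
have msub := measurable_subordinator.
have mF : measurable_fun setT (fun x : measurableTypeR R * ('rV[R]_d * 'rV[R]_d) => F x.1 x.2).
  by rewrite /F; meas.
transitivity (\int[mm d]_p \int[leb]_t F t p)%E; last first.
  rewrite -integral_swap//; apply: eq_integralT => t.
  rewrite -integralT_ge0Zl//.
  - by meas.
  - by rewrite lee_fin subordinator_ge0.
  - by move=> p; rewrite lee_fin mulr_ge0 ?sqr_ge0 ?gauss_ge0.
apply: eq_integralT => p; rewrite /K -EFinM.
have [E|E] := eqVneq p.1 p.2.
  rewrite (eq_integralT _ (g := cst 0%E)); last first.
    by move=> t; rewrite /F E subrr expr0n/= mul0r mulr0.
  by rewrite integral0 E [u _ - _]subrr expr0n/= mul0r mulr0.
transitivity (\int[leb]_t (((u p.1 - u p.2) ^+ 2)%:E * (subordinator s t * gauss t (p.1 - p.2))%:E))%E.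
  rewrite integralT_ge0Zl.
  - by rewrite riesz_kernel_subordination ?subr_eq0// -EFinM; congr EFin; ring.
  - by meas.
  - by rewrite lee_fin sqr_ge0.
  - by move=> t; rewrite lee_fin mulr_ge0 ?gauss_ge0 ?subordinator_ge0.
by apply: eq_integralT => t; rewrite /F -EFinM; congr EFin; ring.
Qed.

End energy.

(** * Competitors for the infimum *)

Section Lfun2.
Context d (T : measurableType d) (R : realType) (m : {measure set T -> \bar R}).

Lemma Lfun2P (f : T -> R) : f \in Lfun m 2%:E <->
  measurable_fun setT f /\ (\int[m]_x ((f x) ^+ 2)%:E < +oo)%E.
Proof.
have E : (\int[m]_x (`|(f x)%:E| `^ 2) = \int[m]_x ((f x) ^+ 2)%:E)%E.
  apply: eq_integralT => x; rewrite abse_EFin poweR_EFin powR_mulrn//.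
  by rewrite real_normK ?num_real.
split => [fL|[mf foo]].
  split; first by move/sub_Lfun_mfun: fL; rewrite inE.
  move/sub_Lfun_finLfun: fL; rewrite inE/= /finite_norm Lnorm.unlock/= E.
  by move=> /lty_poweRy; apply; rewrite invr_eq0 pnatr_eq0.
rewrite inE; apply/andP; split; rewrite inE//= /finite_norm Lnorm.unlock/= E.
by apply: poweR_lty.
Qed.

End Lfun2.

Section ae_product.
Context (R : realType) (d : nat).

Lemma ae_leb2 (P : 'rV[R]_d -> Prop) : {ae mu d, forall x, P x} ->
  {ae leb2 R d, forall p, P p.1 /\ P p.2}.
Proof.
move=> [N [mN N0 PN]]; exists ((N `*` setT) `|` (setT `*` N)).
have mNT : measurable (N `*` [set: 'rV[R]_d]) by exact: measurableX.
have mTN : measurable ([set: 'rV[R]_d] `*` N) by exact: measurableX.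
split; [exact: measurableU| |].
  have NT0 : leb2 R d (N `*` setT) = 0%E.
    transitivity (0 * lebesgue_rV R d setT)%E; last by rewrite mul0e.
    by rewrite [LHS](product_measure1E (mu d) (mu d) mN measurableT); congr (_ * _)%E.
  have TN0 : leb2 R d (setT `*` N) = 0%E.
    transitivity (lebesgue_rV R d setT * 0)%E; last by rewrite mule0.
    by rewrite [LHS](product_measure1E (mu d) (mu d) measurableT mN); congr (_ * _)%E.
  apply/eqP; rewrite -measure_le0 -[leRHS](adde0 0%E) -{1}NT0 -{1}TN0.
  exact: measureU2.
move=> p /= /not_andP[H|H]; [left|right]; split => //; exact: PN.
Qed.

End ae_product.

Section competitors.
Context (R : realType) (d : nat) (s : R) (U : set 'rV[R]_d).
Hypotheses (s01 : 0 < s < 1) (mU : measurable U).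
Local Open Scope ereal_scope.
Implicit Type u : 'rV[R]_d -> R.

Definition l2sqr u : \bar R := \int[mu d]_x ((u x) ^+ 2)%:E.

Lemma l2sqr_ge0 u : 0 <= l2sqr u.
Proof. by apply: integralT_ge0 => x; rewrite lee_fin sqr_ge0. Qed.

Lemma l2sqr_eq0 u : measurable_fun setT u ->
  l2sqr u = 0 <-> {ae mu d, forall x, u x = 0%R}.
Proof.
move=> mu0; have m2 : measurable_fun setT (fun x => (u x ^+ 2)%:E) by meas.
have E : l2sqr u = \int[mu d]_x `|(u x ^+ 2)%:E|.
  by apply: eq_integralT => x; rewrite gee0_abs// lee_fin sqr_ge0.
rewrite E; rewrite ae_eq_integral_abs//; split.
  by apply: filterS => x /(_ I)[] /eqP; rewrite sqrf_eq0 => /eqP.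
by apply: filterS => x ux _; rewrite ux expr0n.
Qed.

(* When the boundary of [U] is null, replacing u by |u| 1_U preserves the L^2 norm
   and does not increase the energy, so competitors suffice to compute [lambda]. *)
Definition competitor u : Prop :=
  [/\ measurable_fun setT u, forall x, (0 <= u x)%R,
      forall x, ~ U x -> u x = 0%R & 0 < l2sqr u < +oo].

Lemma energy_ge0 u : 0 <= energy s u.
Proof.
apply: mule_ge0; first by rewrite lee_fin divr_ge0 ?Cds_ge0.
by apply: integral_ge0 => p _; rewrite lee_fin divr_ge0 ?sqr_ge0 ?powR_ge0.
Qed.

Lemma sqnormL2E u : (forall x, ~ U x -> u x = 0%R) -> sqnormL2 U u = l2sqr u.
Proof.
move=> uU; rewrite /sqnormL2 integral_mkcond; apply: eq_integralT => x.
rewrite patchE; case: ifPn => // xU; rewrite uU ?expr0n//.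
by move/negP: xU; apply: contra_not => /mem_set.
Qed.

Lemma lambda_ge0 : 0 <= lambda s U.
Proof.
apply: le_ereal_inf_tmp => _ [u _ <-].
apply: mule_ge0; first exact: energy_ge0.
have : 0 <= sqnormL2 U u by apply: integral_ge0 => x _; rewrite lee_fin sqr_ge0.
by rewrite inve_ge0.
Qed.

(** A competitor may have infinite energy, in which case the bound is trivial; otherwise u belongs
    to the set whose infimum is [lambda]. The product form avoids dividing by the norm in later
    estimates. *)
Lemma lambda_le_energy u : competitor u -> lambda s U * l2sqr u <= energy s u.
Proof.
move=> [mu0 u0 uU /andP[N0 Noo]].
have [Eoo|Eoo] := ltP (energy s u) +oo; last first.
  by move: Eoo; rewrite leye_eq => /eqP ->; rewrite leey.
have [N NE] : exists N, l2sqr u = N%:E.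
  by exists (fine (l2sqr u)); rewrite fineK// ge0_fin_numE// ltW.
move: N0; rewrite NE lte_fin => N0.
rewrite -lee_pdivlMr//; apply: ereal_inf_lbound; exists u.
  split; last first.
    by rewrite -l2sqr_eq0// NE => -[] /eqP; rewrite (gt_eqF N0).
  split; last by apply/aeW => x xU; apply: uU; apply: contra_not xU => /subset_closure.
  by split => //; apply/Lfun2P; rewrite -/(l2sqr u) NE ltry.
by rewrite (sqnormL2E uU) NE inver (gt_eqF N0).
Qed.

Lemma le_energy u (v : 'rV[R]_d -> R) : measurable_fun setT u -> measurable_fun setT v ->
  {ae leb2 R d, forall p, ((v p.1 - v p.2) ^+ 2 <= (u p.1 - u p.2) ^+ 2)%R} ->
  energy s v <= energy s u.
Proof.
move=> mu0 mv uv.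
rewrite (energy_subordination s01 mu0) (energy_subordination s01 mv).
have mh := @measurable_weighted_heat_form R s d.
apply: integralT_ge0_le; [exact: mh mv|exact: mh mu0| |] => t.
  by rewrite mule_ge0 ?heat_form_ge0// lee_fin subordinator_ge0.
apply: lee_wpmul2l; first by rewrite lee_fin subordinator_ge0.
apply: ae_ge0_le_integral => //.
- by nn.
- by meas.
- by nn.
- by meas.
apply: filterS uv => p uvp _; rewrite lee_fin ler_wpM2r ?gauss_ge0//.
Qed.

Hypothesis nullU : mu d (closure U `\` U) = 0.

Lemma energy_lt_lambda (c : R) : lambda s U < c%:E ->
  exists u, competitor u /\ energy s u <= c%:E * l2sqr u.
Proof.
move=> /ereal_inf_lt[_ [u [[[uL uE] uU] un0] <-]] uc.
have [mu0 u2] := (Lfun2P _ _).1 uL.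
pose v x := (`|u x| * \1_U x)%R.
have mv : measurable_fun setT v by have mi := measurable_indic mU; rewrite /v; meas.
(* [Hs_tilde] gives vanishing off the closure only; the null boundary extends it to almost all of
   the complement of [U]. *)
have uU' : {ae mu d, forall x, ~ U x -> u x = 0%R}.
  have nU : {ae mu d, forall x, ~ (closure U `\` U) x}.
    exists (closure U `\` U); split => //; last by move=> x /= /contrapT.
    apply: measurableD => //; rewrite -[closure U]setCK.
    by apply: measurableC; apply: open_measurable_rV; apply: closed_openC; exact: closed_closure.
  apply: filterS2 uU nU => x xU xnU nUx; apply: xU => cUx; exact: xnU.
have vu : {ae mu d, forall x, v x = `|u x|%R}.
  apply: filterS uU' => x xU; rewrite /v indicE.
  have [Ux|Ux] := pselect (U x); first by rewrite mem_set// mulr1.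
  by rewrite xU// normr0 mul0r.
have NE : l2sqr v = l2sqr u.
  apply: ae_eq_integral => //; [by meas|by meas|].
  by apply: filterS vu => x vx _; rewrite vx real_normK ?num_real.
exists v; split.
  split => //.
  - by move=> x; rewrite /v mulr_ge0.
  - by move=> x Ux; rewrite /v indicE memNset// mulr0.
  - rewrite NE u2 andbT lt0e l2sqr_ge0 andbT.
    by apply/eqP => /l2sqr_eq0 => /(_ mu0).
have vE : energy s v <= energy s u.
  apply: le_energy => //; apply: filterS (ae_leb2 vu) => p [-> ->].
  rewrite -[leLHS]real_normK ?num_real// -[leRHS]real_normK ?num_real//.
  by rewrite lerXn2r ?nnegrE// ler_dist_dist.
rewrite NE; apply: (le_trans vE).
have N0 : 0 < l2sqr u.
  by rewrite lt0e l2sqr_ge0 andbT; apply/eqP => /l2sqr_eq0 => /(_ mu0).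
have SE : sqnormL2 U u = l2sqr u.
  have <- : sqnormL2 U v = l2sqr u.
    by rewrite (sqnormL2E) ?NE// => x Ux; rewrite /v indicE memNset// mulr0.
  apply: eq_integral => x; rewrite inE => Ux.
  by rewrite /v indicE mem_set// mulr1 real_normK ?num_real.
move: uc; rewrite SE; move: u2 N0; rewrite -/(l2sqr u).
case: (l2sqr u) => [N| |]//; rewrite lte_fin => _ N0.
by rewrite inver (gt_eqF N0) lte_pdivrMr// => /ltW.
Qed.

End competitors.

(** * Null boundaries *)

Section null_criterion.
Context d (T : measurableType d) (R : realType) (m : {measure set T -> \bar R}).

(** N disjoint copies inside [D] give N m(S) <= m(D) for every N, which is impossible for large N if
    m(S) > 0. Both kinds of boundary below are shown to be null in this way, by dilation in the
    convex case and by translation in the Lipschitz case. *)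
Lemma null_of_disjoint_copies (S D : set T) (F : nat -> set T) :
  measurable D -> (m D < +oo)%E ->
  (forall j, measurable (F j)) -> trivIset setT F -> (forall j, F j `<=` D) ->
  (forall j, m S <= m (F j))%E -> m S = 0%E.
Proof.
move=> mD Doo mF tF FD SF.
have S0 : (0 <= m S)%E by exact: measure_ge0.
have D0 : (0 <= m D)%E by exact: measure_ge0.
have H N : (m S *+ N <= m D)%E.
  have -> : (m S *+ N = \sum_(j < N) m S)%E.
    by rewrite big_const_ord iter_addr_0.
  apply: (@le_trans _ _ (\sum_(j < N) m (F j))%E); first exact: lee_sum.
  rewrite -measure_semi_additive_ord_I//; last 2 first.
  - exact: sub_trivIset tF.
  - exact: bigsetU_measurable.
  rewrite le_measure ?inE//; first exact: bigsetU_measurable.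
  by rewrite -bigcup_mkord => x [j _ /FD].
move: S0 D0 Doo H; case: (m S) (m D) => [r| |] [c| |]//; rewrite !lee_fin => r0 c0 _ H.
  apply/eqP; rewrite eqe; apply: contraT => rn0.
  have {rn0}r0 : 0 < r by rewrite lt0r rn0.
  have := H (Num.truncn (c / r)).+1; rewrite -EFin_natmul lee_fin.
  by rewrite -mulr_natl -ler_pdivlMr// leNgt truncnS_gt.
by have := H 1%N.
Qed.

End null_criterion.

Lemma measure_indicE d (T : measurableType d) (R : realType)
    (m : {measure set T -> \bar R}) (A : set T) : measurable A ->
  m A = (\int[m]_x (\1_A x)%:E)%E.
Proof. by move=> mA; rewrite integral_indic// setIT. Qed.

Section rV_geometry.
Context (R : realType).
Implicit Type d : nat.

Lemma rV_normP d (w : 'rV[R]_d) b : 0 <= b ->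
  (`|w| <= b) <-> (forall j, `|w 0 j| <= b).
Proof.
move=> b0; rewrite [`|w|]mx_normrE; split.
  by move=> /bigmax_leP[_ H] j; exact: (H (0, j)).
by move=> H; apply/bigmax_leP; split => // -[i j] _ /=; rewrite (ord1 i).
Qed.

Lemma rV_coord_le d (w : 'rV[R]_d) j : `|w 0 j| <= `|w|.
Proof. by move: j; apply/rV_normP. Qed.

Lemma finite_measure_box d b : (mu d [set x : 'rV[R]_d | forall i, (`|x 0%R i| <= b)%R] < +oo)%E.
Proof.
have mI : forall i : 'I_d, measurable ([set x : measurableTypeR R | `|x| <= b]).
  move=> _; rewrite (_ : mkset _ = `[- b, b]%classic); first exact: measurable_itv.
  by apply/seteqP; split => x /=; rewrite in_itv/= ler_norml.
rewrite [X in (X < _)%E](lebesgue_rV_box (A := fun _ => [set x | `|x| <= b]))//.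
have E : lebesgue_measure [set x : measurableTypeR R | `|x| <= b] \is a fin_num.
  rewrite (_ : mkset _ = `[- b, b]%classic); last first.
    by apply/seteqP; split => x /=; rewrite in_itv/= ler_norml.
  by rewrite lebesgue_measure_itv/=; case: ifP.
rewrite -(fineK E) prodEFin ltry//.
Qed.

Lemma finite_measure_bounded d (A : set 'rV[R]_d) b : measurable A ->
  (forall x, A x -> `|x| <= b) -> (mu d A < +oo)%E.
Proof.
move=> mA Ab; apply: le_lt_trans (finite_measure_box d b).
rewrite le_measure ?inE//.
  apply: (measurable_box_rV (A := fun _ => [set x | `|x| <= b])) => _.
  rewrite (_ : mkset _ = `[- b, b]%classic); first exact: measurable_itv.
  by apply/seteqP; split => x /=; rewrite in_itv/= ler_norml.
by move=> x /Ab xb i; exact: le_trans (rV_coord_le x i) xb.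
Qed.

Lemma measure_translate d (a : 'rV[R]_d) (A : set 'rV[R]_d) : measurable A ->
  mu d [set x | A (x + a)] = mu d A.
Proof.
move=> mA; have mi : measurable_fun setT (\1_A : 'rV[R]_d -> R) by exact: measurable_indic.
have mAa : measurable [set x | A (x + a)].
  have ma : measurable_fun setT (fun x : 'rV[R]_d => x + a) by meas.
  by rewrite -[X in measurable X]setTI; exact: ma.
rewrite !measure_indicE//.
rewrite -(integral_rV_translate a (f := fun x => (\1_A x)%:E))//; by meas.
Qed.

Lemma measure_scale d (c : R) (A : set 'rV[R]_d) : 0 < c -> measurable A ->
  (mu d [set x | A (c *: x)] = (c ^- d)%:E * mu d A)%E.
Proof.
move=> c0 mA; have mi : measurable_fun setT (\1_A : 'rV[R]_d -> R) by exact: measurable_indic.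
have mAa : measurable [set x | A (c *: x)].
  have ma : measurable_fun setT (fun x : 'rV[R]_d => c *: x) by meas.
  by rewrite -[X in measurable X]setTI; exact: ma.
rewrite !measure_indicE//.
rewrite -(integral_rV_scale (f := fun x => (\1_A x)%:E) c0)//; by meas.
Qed.

Lemma closed_measurable_rV d (A : set 'rV[R]_d) : closed A -> measurable A.
Proof.
move=> cA; rewrite -[A]setCK; apply: measurableC.
by apply: open_measurable_rV; exact: closed_openC.
Qed.

Lemma closure_ballP d (A : set 'rV[R]_d) x : closure A x <->
  forall e, 0 < e -> exists2 y, A y & `|x - y| < e.
Proof.
split=> [cAx e e0|H B /nbhs_ballP[e /= e0 eB]].
  have [y [Ay]] := cAx _ (nbhsx_ballx x e e0).
  by rewrite -ball_normE /= => xy; exists y.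
have [y Ay xy] := H e e0; exists y; split => //; apply: eB.
by rewrite -ball_normE.
Qed.

Definition boundary_null d (U : set 'rV[R]_d) := mu d (closure U `\` U) = 0%E.

Lemma measurable_boundary d (U : set 'rV[R]_d) : measurable U ->
  measurable (closure U `\` U).
Proof.
by move=> mU; apply: measurableD => //; apply: closed_measurable_rV; exact: closed_closure.
Qed.

(** The boundary of the product lies in two strips, each the product of one boundary with the whole
    other space. Their measures are of the form 0 * oo or oo * 0, hence 0 by the convention of
    [\bar R]. *)
Lemma boundary_null_prod n k (A : set 'rV[R]_n) (B : set 'rV[R]_k) :
  measurable A -> measurable B -> boundary_null A -> boundary_null B ->
  measurable (prod_rV A B) /\ boundary_null (prod_rV A B).
Proof.
move=> mA mB nA nB.
have mP (C : set 'rV[R]_n) (D : set 'rV[R]_k) : measurable C -> measurable D ->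
    measurable (prod_rV C D).
  move=> mC mD; have ml : measurable_fun setT (fun z : 'rV[R]_(n + k) => lsubmx z) by meas.
  have mr : measurable_fun setT (fun z : 'rV[R]_(n + k) => rsubmx z) by meas.
  rewrite (_ : prod_rV C D = (@lsubmx R 1 n k @^-1` C) `&` (@rsubmx R 1 n k @^-1` D))//.
  by apply: measurableI; rewrite -[X in measurable X]setTI; [exact: ml|exact: mr].
have prodE (C : set 'rV[R]_n) (D : set 'rV[R]_k) : measurable C -> measurable D ->
    (mu (n + k) (prod_rV C D) = mu n C * mu k D)%E.
  move=> mC mD; have miC : measurable_fun setT (\1_C : 'rV[R]_n -> R) by exact: measurable_indic.
  have miD : measurable_fun setT (\1_D : 'rV[R]_k -> R) by exact: measurable_indic.
  have miP : measurable_fun setT (\1_(prod_rV C D) : 'rV[R]_(n + k) -> R).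
    by apply: measurable_indic; exact: mP.
  rewrite [LHS]measure_indicE; last exact: mP.
  rewrite integral_row_mx; last 2 first.
  - by apply: measurable_fineE.
  - by move=> z; rewrite lee_fin.
  rewrite (measure_indicE (mu n) mC) (measure_indicE (mu k) mD).
  transitivity (iterated_integral (mu n) (mu k) (fun x y => \1_C x * \1_D y)%R); last first.
    by apply: (iterated_integralM _ _ miC miD).
  apply: eq_integralT => x; apply: eq_integralT => y; rewrite !indicE; congr EFin.
  rewrite -natrM mulnb; congr (_%:R); congr nat_of_bool.
  apply/idP/idP; first by rewrite inE => -[]; rewrite row_mxKl row_mxKr => *; rewrite !mem_set.
  by move=> /andP[]; rewrite !inE => *; rewrite /prod_rV/= row_mxKl row_mxKr.
split; first exact: mP.
have mbA := measurable_boundary mA; have mbB := measurable_boundary mB.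
apply/eqP; rewrite /boundary_null -measure_le0.
have -> : (0 = mu (n + k) (prod_rV (closure A `\` A) setT) +
              mu (n + k) (prod_rV setT (closure B `\` B)))%E.
  rewrite !prodE//.
  rewrite [X in (X * _)%E]nA mul0e.
  by rewrite [X in (_ * X)%E]nB mule0 adde0.
apply: (@le_trans _ _ (mu (n + k) (prod_rV (closure A `\` A) setT `|`
              prod_rV setT (closure B `\` B)))%E); last first.
  by apply: measureU2; exact: mP.
rewrite le_measure ?inE//.
- by apply: measurable_boundary; exact: mP.
- by apply: measurableU; exact: mP.
move=> z [/closure_ballP cz nz].
have cl : closure A (lsubmx z).
  apply/closure_ballP => e e0; have [y [Ay _] zy] := cz e e0.
  exists (lsubmx y) => //; apply: le_lt_trans zy; apply/rV_normP => // j.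
  by have := rV_coord_le (z - y) (lshift k j); rewrite !mxE.
have cr : closure B (rsubmx z).
  apply/closure_ballP => e e0; have [y [_ By] zy] := cz e e0.
  exists (rsubmx y) => //; apply: le_lt_trans zy; apply/rV_normP => // j.
  by have := rV_coord_le (z - y) (rshift n j); rewrite !mxE.
have [Az|Az] := pselect (A (lsubmx z)); last by left.
by right; split => //; split => // Bz; apply: nz.
Qed.

Lemma boundary_null_setT d : boundary_null [set: 'rV[R]_d].
Proof. by rewrite /boundary_null closureT setDv measure0. Qed.

End rV_geometry.

Section convex_boundary.
Context (R : realType).
Implicit Type d : nat.

Lemma bounded_setP d (A : set 'rV[R]_d) : bounded_set A ->
  exists2 M, 0 < M & forall x, A x -> `|x| <= M.
Proof.
move=> /ex_strict_bound_gt0[M M0 AM]; exists M => // x Ax.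
by apply: ltW; exact: AM.
Qed.

Lemma closure_bounded d (A : set 'rV[R]_d) M : (forall x, A x -> `|x| <= M) ->
  forall x, closure A x -> `|x| <= M.
Proof.
move=> AM x /closure_ballP cx; apply/ler_addgt0Pr => e e0.
have [y Ay xy] := cx e e0.
rewrite -(subrK y x) (le_trans (ler_normD _ _))// addrC lerD ?AM//; exact: ltW.
Qed.

(* The dilates of the boundary of a convex neighbourhood of the origin are
   pairwise disjoint. *)
Lemma boundary_null_convex d (B : set 'rV[R]_d) :
  bounded_set B -> open B -> convex_set B -> B 0 -> boundary_null B.
Proof.
move=> /bounded_setP[M M0 BM] oB cB B0.
have mB := open_measurable_rV oB.
pose S := closure B `\` B.
have mS : measurable S := measurable_boundary mB.
have shrink c y : 0 < c < 1 -> closure B y -> B (c *: y).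
  move=> /andP[c0 c1] /closure_ballP cy.
  have [r /= r0 rB] : exists2 r, 0 < r & ball (0 : 'rV[R]_d) r `<=` B.
    by have /nbhs_ballP := open_nbhs_nbhs (conj oB B0).
  have c10 : 0 < 1 - c by rewrite subr_gt0.
  (* This tolerance puts w = c / (1 - c) (y - b) in the ball of radius r about the origin, and c y =
     c b + (1 - c) w is then a convex combination of points of [B]. *)
  have e0 : 0 < r * ((1 - c) / c) by rewrite mulr_gt0 ?divr_gt0.
  have [b Bb yb] := cy _ e0.
  pose w := (c / (1 - c)) *: (y - b).
  have Bw : B w.
    apply: rB; rewrite -ball_normE /= sub0r normrN normrZ gtr0_norm ?divr_gt0//.
    by rewrite mulrC -ltr_pdivlMr ?divr_gt0// invf_div.
  have c01 : (0 <= c <= 1) by rewrite !ltW.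
  have /set_mem := cB b w (Itv01 (ltW c0) (ltW c1)) (mem_set Bb) (mem_set Bw).
  congr (B _); transitivity (c *: b + (1 - c) *: w); first by [].
  rewrite /w scalerA mulrCA mulfV ?lt0r_neq0// mulr1.
  by rewrite scalerBr addrC subrK.
(* Increasing factors in [1/2, 1[. The copy [F j] is the boundary dilated by 1 / c_j, a number in
   ]1, 2]: its measure is at least that of [S] and it stays in the box of half-side 2 M. *)
pose c (j : nat) : R := 1 - j.+2%:R^-1.
have c1 j : c j < 1 by rewrite /c gtrBl invr_gt0.
have c2 j : 2^-1 <= c j.
  rewrite /c lerBrDr -lerBrDl (_ : 1 - 2^-1 = 2^-1); last by field.
  by rewrite lef_pV2 ?posrE// ler_nat.
have c0 j : 0 < c j by rewrite (lt_le_trans _ (c2 j)).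
have cinj j k : (j < k)%N -> c j < c k.
  by move=> jk; rewrite /c ltrD2l ltrN2 ltf_pV2 ?posrE// ltr_nat.
pose F j := [set x | S (c j *: x)].
have disj j k x : (j < k)%N -> F j x -> F k x -> False.
  move=> jk [_ nB] [cB' _]; apply: nB.
  have -> : c j *: x = (c j / c k) *: (c k *: x).
    by rewrite scalerA -mulrA mulVf ?mulr1// lt0r_neq0.
  apply: shrink => //; rewrite divr_gt0//= ltr_pdivrMr// mul1r; exact: cinj.
apply: (@null_of_disjoint_copies _ _ _ (mu d) S [set x | forall i, `|x 0 i| <= 2 * M] F).
- apply: (measurable_box_rV (A := fun _ => [set x | `|x| <= 2 * M])) => _.
  rewrite (_ : mkset _ = `[- (2 * M), 2 * M]%classic); first exact: measurable_itv.
  by apply/seteqP; split => x /=; rewrite in_itv/= ler_norml.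
- exact: finite_measure_box.
- move=> j; have ma : measurable_fun setT (fun x : 'rV[R]_d => c j *: x) by meas.
  by rewrite -[X in measurable X]setTI; exact: ma.
- apply/trivIsetP => j k _ _; rewrite neq_ltn => /orP[jk|jk];
    apply/seteqP; split => // x [Fj Fk]; [exact: (disj j k x)|exact: (disj k j x)].
- move=> j x [clx _] i; apply: le_trans (rV_coord_le x i) _.
  have := closure_bounded BM clx; rewrite normrZ gtr0_norm// => H.
  rewrite -ler_pdivrMl ?ltr0n//; apply: le_trans H.
  by rewrite ler_wpM2r.
- move=> j; rewrite [leRHS](_ : _ = (c j ^- d)%:E * mu d S)%E; last exact: measure_scale.
  rewrite -[leLHS]mul1e lee_wpmul2r ?measure_ge0//.
  rewrite lee_fin invf_ge1 ?exprn_gt0// exprn_ile1 ?(ltW (c0 _))//; exact: ltW.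
Qed.

Lemma dilationE d (l : R) (B : set 'rV[R]_d) : 0 < l ->
  dilation l B = [set x | B (l^-1 *: x)].
Proof.
move=> l0; have ln0 := lt0r_neq0 l0; apply/seteqP; split => [_ [x Bx <-]|x Bx].
  by rewrite /= scalerA mulVf// scale1r.
by exists (l^-1 *: x) => //; rewrite scalerA mulfV// scale1r.
Qed.

Lemma boundary_null_dilation d (l : R) (B : set 'rV[R]_d) : 0 < l ->
  measurable B -> boundary_null B ->
  measurable (dilation l B) /\ boundary_null (dilation l B).
Proof.
move=> l0 mB nB; have li0 : 0 < l^-1 by rewrite invr_gt0.
have ml : measurable_fun setT (fun x : 'rV[R]_d => l^-1 *: x) by meas.
have mP (A : set 'rV[R]_d) : measurable A -> measurable [set x | A (l^-1 *: x)].
  by move=> mA; rewrite -[X in measurable X]setTI; exact: ml.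
rewrite dilationE//; split; first exact: mP.
have mb := measurable_boundary mB.
apply/eqP; rewrite /boundary_null -measure_le0.
have -> : (0 = mu d [set x | (closure B `\` B) (l^-1 *: x)])%E.
  by rewrite measure_scale// [X in (_ * X)%E]nB mule0.
rewrite le_measure ?inE//.
- exact: measurable_boundary (mP _ mB).
- exact: (mP _ mb).
move=> x [/closure_ballP cx nx]; split => //; apply/closure_ballP => e e0.
have [y By xy] := cx (l * e) (mulr_gt0 l0 e0).
exists (l^-1 *: y) => //; rewrite -scalerBr normrZ gtr0_norm//.
by rewrite mulrC ltr_pdivrMr// mulrC.
Qed.

End convex_boundary.

Section lipschitz_boundary.
Context (R : realType) (d : nat).

Lemma mulmx_norm_le (Q : 'M[R]_d) : exists2 C, 0 < C &
  forall (x : 'rV[R]_d) j, `|(x *m Q) 0 j| <= C * `|x|.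
Proof.
exists (1 + \sum_i \sum_j `|Q i j|).
  by rewrite ltr_pwDl// sumr_ge0// => i _; apply: sumr_ge0.
move=> x j; rewrite mxE (le_trans (ler_norm_sum _ _ _))//.
apply: (@le_trans _ _ (\sum_i `|Q i j| * `|x|)).
  apply: ler_sum => i _; rewrite normrM mulrC ler_wpM2l//; exact: rV_coord_le.
rewrite -mulr_suml ler_wpM2r// (@le_trans _ _ (\sum_i \sum_j0 `|Q i j0|))//.
  apply: ler_sum => i _; rewrite (bigD1 j)//= lerDl; exact: sumr_ge0.
by rewrite lerDr.
Qed.

Section graph.
Variables (U : set 'rV[R]_d) (Q : 'M[R]_d) (i : 'I_d) (g : 'rV[R]_d.-1 -> R^o)
  (x : 'rV[R]_d) (e : R).
Hypotheses (oU : open U) (lg : lipschitz g) (QQ : Q *m Q^T = 1%:M) (e0 : 0 < e).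
Hypothesis Ug : forall y, `|x - y| < e -> U y <-> g (col' i (y *m Q)) < (y *m Q) 0 i.

(** A boundary point is not in U, hence not strictly above the graph. If it were strictly below, the
    Lipschitz bound would keep all nearby points below, and none of them would be in U. *)
Lemma boundary_on_graph y : (closure U `\` U) y -> `|x - y| < e ->
  (y *m Q) 0 i = g (col' i (y *m Q)).
Proof.
move=> [/closure_ballP cy nUy] xy; apply/eqP; rewrite eq_le.
rewrite leNgt; apply/andP; split.
  by apply/negP => /(Ug xy).
rewrite leNgt; apply/negP => gy.
have [L L0 gL] : exists2 L, 0 < L & forall a b, `|g a - g b| <= L * `|a - b|.
  have /pinfty_ex_gt0[L L0 gL] := lg; exists L => // a b.
  by have := gL (a, b); apply; split.
have [C C0 QC] := mulmx_norm_le Q.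
set eta := g (col' i (y *m Q)) - (y *m Q) 0 i.
have eta0 : 0 < eta by rewrite subr_gt0.
(* The first bound keeps z inside the chart around x. The second uses that moving by r changes the
   height by at most C r and the value of g by at most L C r, in total less than the gap [eta]. *)
pose delta := Num.min (e - `|x - y|) (eta / ((L + 1) * C)).
have LC : 0 < (L + 1) * C by rewrite mulr_gt0// addr_gt0.
have delta0 : 0 < delta by rewrite lt_min subr_gt0 xy divr_gt0.
have [z Uz yz] := cy delta delta0.
have yz1 : `|y - z| < e - `|x - y| by rewrite (lt_le_trans yz)// ge_min lexx.
have yz2 : `|y - z| < eta / ((L + 1) * C) by rewrite (lt_le_trans yz)// ge_min lexx orbT.
have xz : `|x - z| < e.
  rewrite -(subrK y x) -addrA (le_lt_trans (ler_normD _ _))//.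
  by rewrite -ltrBrDl.
have /(Ug xz) gz := Uz.
have h1 : `|(y *m Q) 0 i - (z *m Q) 0 i| <= C * `|y - z|.
  by have := QC (y - z) i; rewrite mulmxBl !mxE.
have h2 : `|g (col' i (y *m Q)) - g (col' i (z *m Q))| <= L * (C * `|y - z|).
  apply: (le_trans (gL _ _)); rewrite ler_pM2l//; apply/rV_normP => [|j].
    by rewrite mulr_ge0// ltW.
  by have := QC (y - z) (lift i j); rewrite mulmxBl !mxE.
have h3 : (L + 1) * C * `|y - z| < eta by rewrite mulrC -ltr_pdivlMr.
have : eta <= L * (C * `|y - z|) + C * `|y - z|.
  move: h1 h2; rewrite !ler_norml /eta => /andP[h1 _] /andP[_ h2].
  move: gz h1 h2; lra.
move=> h4; move: h3; rewrite ltNge => /negP; apply.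
by rewrite (le_trans h4)// mulrDl mul1r mulrDl mulrA.
Qed.

(* The translates of the boundary along the [i]-th axis of the rotated frame
   are translates of a piece of a graph, hence disjoint. *)
Lemma graph_null : mu d ((closure U `\` U) `&` ball x e) = 0%E.
Proof.
have mU := open_measurable_rV oU.
have mS : measurable ((closure U `\` U) `&` ball x e).
  apply: measurableI; first exact: measurable_boundary.
  by apply: open_measurable_rV; exact: ball_open.
(* The direction that is the i-th basis vector in rotated coordinates: shifting along it changes the
   height and leaves the argument of g fixed. *)
pose v : 'rV[R]_d := delta_mx 0 i *m Q^T.
have vQ t y : (y + t *: v) *m Q = y *m Q + t *: delta_mx 0 i.
  rewrite mulmxDl -scalemxAl /v -mulmxA.
  by have /mulmx1C -> := QQ; rewrite mulmx1.
(* Pairwise distinct shifts bounded by 1, so that infinitely many copies fit in one box. *)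
pose c (j : nat) : R := j.+1%:R^-1.
have c0 j : 0 < c j by rewrite invr_gt0.
have c1 j : c j <= 1 by rewrite invf_le1// ler1n.
pose F j := [set y | ((closure U `\` U) `&` ball x e) (y + c j *: v)].
have disj j k y : j != k -> F j y -> F k y -> False.
  move=> jk [Sj]; rewrite -ball_normE/= => xj [Sk]; rewrite -ball_normE /= => xk.
  have := boundary_on_graph Sk xk; have := boundary_on_graph Sj xj.
  rewrite !vQ.
  have E t : col' i (y *m Q + t *: delta_mx 0 i) = col' i (y *m Q).
    apply/rowP => l; rewrite !mxE eqxx/= eq_sym (negbTE (neq_lift _ _)).
    by rewrite mulr0 addr0.
  rewrite !E => <-; rewrite !mxE !eqxx !mulr1 => /addrI.
  move=> /invr_inj /eqP; rewrite eqr_nat eqSS => kj.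
  by move: jk; rewrite eq_sym kj.
pose b := `|x| + e + `|v|.
apply: (@null_of_disjoint_copies _ _ _ (mu d) _ [set x | forall i, `|x 0 i| <= b] F).
- apply: (measurable_box_rV (A := fun _ => [set x | `|x| <= b])) => _.
  rewrite (_ : mkset _ = `[- b, b]%classic); first exact: measurable_itv.
  by apply/seteqP; split => y /=; rewrite in_itv/= ler_norml.
- exact: finite_measure_box.
- move=> j; have ma : measurable_fun setT (fun y : 'rV[R]_d => y + c j *: v) by meas.
  by rewrite -[X in measurable X]setTI; exact: ma.
- apply/trivIsetP => j k _ _ jk.
  by apply/seteqP; split => // y [Fj Fk]; exact: (disj j k y).
- move=> j y [_]; rewrite -ball_normE /= => xy l.
  apply: le_trans (rV_coord_le y l) _.
  rewrite (_ : y = x - (x - (y + c j *: v)) - c j *: v); last first.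
    by rewrite opprB addrCA subrr addr0 addrK.
  rewrite (le_trans (ler_normB _ _))// /b lerD//.
    by rewrite (le_trans (ler_normB _ _))// lerD// ltW.
  by rewrite normrZ gtr0_norm// ler_piMl.
- move=> j; rewrite le_eqVlt; apply/orP; left; apply/eqP/esym.
  exact: measure_translate.
Qed.

End graph.

(** The boundary of a bounded open set is compact, so finitely many charts cover it, and
    [graph_null] applies in each. *)
Lemma boundary_null_lipschitz (U : set 'rV[R]_d) :
  lipschitz_domain U -> bounded_set U -> boundary_null U.
Proof.
move=> [oU _ _ lU] /bounded_setP[M M0 UM].
pose S := closure U `\` U.
have /choice[r rP] : forall x, exists r : R, 0 < r /\
    (S x -> mu d (S `&` ball x r) = 0%E).
  move=> x; have [Sx|Sx] := pselect (S x); last by exists 1.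
  have [Q [i [g [QQ lg]]]] := lU x Sx.
  move=> /nbhs_ballP[e /= e0 eU]; exists e; split => // _.
  have Ug y : `|x - y| < e -> U y <-> g (col' i (y *m Q)) < (y *m Q) 0 i.
    by move=> xy; apply: eU; rewrite -ball_normE.
  exact: (graph_null oU lg QQ Ug).
have cS : compact S.
  apply: bounded_closed_compact.
    exists M; split; first exact: num_real.
    move=> M' MM' x [clx _]; apply: le_trans (ltW MM').
    exact: (closure_bounded UM).
  by rewrite /S setDE; apply: closedI; [exact: closed_closure|exact: open_closedC].
move: cS; rewrite compact_cover => /(_ _ S (fun x => ball x (r x))).
have oB x : S x -> open (ball x (r x)).
  by move=> _; apply: ball_open; have [] := rP x.
have cov : S `<=` cover S (fun x => ball x (r x)).
  by move=> x Sx; exists x => //; apply: ballxx; have [] := rP x.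
move=> /(_ oB cov)[D DS SD].
have mU := open_measurable_rV oU.
have H : (mu d).-negligible (\big[setU/set0]_(x <- finmap.enum_fset D | x \in finmap.enum_fset D)
    (S `&` ball x (r x))).
  apply: (big_ind (fun A => (mu d).-negligible A)).
  - exact: negligible_set0.
  - by move=> A B; exact: negligibleU.
  - move=> x xD; have Sx : S x by apply: set_mem; exact: DS.
    exists (S `&` ball x (r x)); split => //; last by have [_] := rP x; apply.
    apply: measurableI; first exact: measurable_boundary.
    by apply: open_measurable_rV; exact: oB.
rewrite /boundary_null -/S; apply/negligibleP; first exact: measurable_boundary.
apply: negligibleS H => x Sx; have [y yD xy] := SD x Sx.
rewrite -bigcup_seq_cond; exists y; first by rewrite /= yD andbT.
by split.
Qed.

End lipschitz_boundary.

(** * Strict bounds on product domains *)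

Section escape.
Context (R : realType) (d : nat) (M T : R).
Hypotheses (d0 : (0 < d)%N) (M0 : 0 < M).
Local Open Scope ereal_scope.

Definition box : set 'rV[R]_d := [set x | forall i, (`|x 0%R i| <= M)%R].

(** A cube of volume 1, so that a pointwise bound integrates over it without a volume factor; it
    misses [box] because d > 0. *)
Let far : set 'rV[R]_d := [set x | forall i, `]M, (M + 1)%R]%classic (x 0%R i)].

(* A lower bound for the Gaussian mass of the cube ]M, M + 1]^d seen from a point
   of the box: the coordinates differ by at most 2 M + 1. *)
Definition escape_rate : R :=
  ((Num.sqrt (1 / pi) * expR (- (T * (2 * M + 1) ^+ 2))) ^+ d)%R.

Lemma escape_rate_gt0 : (0 < escape_rate)%R.
Proof. by rewrite exprn_gt0// mulr_gt0 ?expR_gt0// sqrtr_gt0 divr_gt0 ?pi_gt0. Qed.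

Lemma measurable_box : measurable box.
Proof.
apply: (measurable_box_rV (A := fun _ => [set x | (`|x| <= M)%R])) => _.
rewrite (_ : mkset _ = `[(- M)%R, M]%classic); first exact: measurable_itv.
by apply/seteqP; split => x /=; rewrite in_itv/= ler_norml.
Qed.

Let measurable_far : measurable far.
Proof. by apply: (measurable_box_rV (A := fun _ => `]M, (M + 1)%R]%classic)) => _; exact: measurable_itv. Qed.

Let mu_far : mu d far = 1.
Proof.
rewrite [LHS](lebesgue_rV_box (A := fun _ => `]M, (M + 1)%R]%classic)); last first.
  by move=> _; exact: measurable_itv.
rewrite big1// => i _; rewrite lebesgue_measure_itv/= lte_fin ltrDl ltr01 -EFinB.
by rewrite addrAC subrr add0r.
Qed.

Let box_far x : box x -> far x -> False.
Proof.
move=> bx fx; have := bx (Ordinal d0); have /= := fx (Ordinal d0).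
rewrite in_itv/= => /andP[Mx _]; rewrite leNgt => /negP; apply.
by rewrite (lt_le_trans Mx)// ler_norm.
Qed.

Let mi_far : measurable_fun setT (\1_far : 'rV[R]_d -> R).
Proof. exact: measurable_indic. Qed.

Let mi_box : measurable_fun setT (\1_box : 'rV[R]_d -> R).
Proof. by apply: measurable_indic; exact: measurable_box. Qed.

Let far_mass t x : (1 <= t <= T)%R -> box x ->
  escape_rate%:E <= \int[mu d]_y (\1_far y * gauss t (x - y))%:E.
Proof.
move=> tT bx; rewrite -[leLHS]mule1 -mu_far (measure_indicE (mu d) measurable_far).
rewrite -integralT_ge0Zl; last 3 first.
- by apply: measurable_fineE.
- by rewrite lee_fin ltW// escape_rate_gt0.
- by move=> y; rewrite lee_fin.
apply: integralT_ge0_le.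
- by meas.
- by meas.
- by move=> y; rewrite -EFinM lee_fin mulr_ge0// ltW// escape_rate_gt0.
move=> y; rewrite -EFinM lee_fin indicE; have [fy|fy] := pselect (far y); last first.
  by rewrite memNset// mulr0 mul0r.
rewrite mem_set// mulr1 mul1r; apply: gauss_ge => // i.
have := bx i; have /= := fy i; rewrite in_itv/= !mxE => /andP[y1 y2].
rewrite !ler_norml => /andP[x1 x2]; move: M0 => M0'.
by apply/andP; split; lra.
Qed.

Lemma escape_rate_le1 : (1 <= T)%R -> (escape_rate <= 1)%R.
Proof.
move=> T1; rewrite -lee_fin; have b0 : box 0%R.
  by move=> i; rewrite mxE normr0 ltW.
have t1 : (1 <= (1 : R) <= T)%R by rewrite lexx.
apply: le_trans (far_mass t1 b0) _.
rewrite -[leRHS](integral_gaussl (0%R : 'rV[R]_d) ltr01).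
apply: integralT_ge0_le; [by meas|by meas| |] => y.
  by rewrite lee_fin mulr_ge0 ?gauss_ge0.
by rewrite lee_fin indicE; case: (_ \in _); rewrite ?mul1r// mul0r gauss_ge0.
Qed.

Lemma box_escape t x : (1 <= t <= T)%R -> box x ->
  \int[mu d]_y (\1_box y * gauss t (x - y))%:E <= (1 - escape_rate)%:E.
Proof.
move=> tT bx; have t0 : (0 < t)%R by move: tT => /andP[t1 _]; exact: lt_le_trans t1.
have e0 : 0 <= escape_rate%:E by rewrite lee_fin ltW// escape_rate_gt0.
rewrite EFinB leeBrDr//.
apply: le_trans (leeD2l _ (far_mass tT bx)) _.
rewrite -integralT_ge0D; [|by meas|by meas|by nn|by nn].
rewrite -[leRHS](integral_gaussl x t0); apply: integralT_ge0_le.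
- by meas.
- by meas.
- by nn.
move=> y; rewrite -EFinD lee_fin !indicE.
have [by1|by1] := pselect (box y).
  rewrite (mem_set by1) memNset ?mul1r ?mul0r ?addr0// => fy; exact: (box_far by1 fy).
by rewrite (memNset by1) mul0r add0r; case: (_ \in _); rewrite ?mul1r// mul0r gauss_ge0.
Qed.

(** A Poincaré inequality at a fixed time: keep only the pairs whose second point lies in the far
    cube, where u vanishes and the squared difference is u(x)^2. *)
Lemma heat_form_ge t (u : 'rV[R]_d -> R) : (1 <= t <= T)%R -> measurable_fun setT u ->
  (forall x, ~ box x -> u x = 0%R) ->
  escape_rate%:E * l2sqr u <= heat_form t u.
Proof.
move=> tT mu0 ub; have e0 : 0 <= escape_rate%:E by rewrite lee_fin ltW// escape_rate_gt0.
have t0 : (0 < t)%R by move: tT => /andP[t1 _]; exact: lt_le_trans t1.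
apply: (@le_trans _ _ (\int[mm d]_p ((u p.1 ^+ 2)%:E * (\1_far p.2 * gauss t (p.1 - p.2))%:E))).
  rewrite integral_leb2l; [|by meas|by nn].
  rewrite /l2sqr -integralT_ge0Zl; [|by meas|by []|by nn].
  apply: integralT_ge0_le.
  - by meas.
  - apply: (@measurable_integral_section _ _ _ _ R (mu d)
      (fun x y : 'rV[R]_d => (u x ^+ 2)%:E * (\1_far y * gauss t (x - y))%:E)).
      by meas.
    by nn.
  - by nn.
  move=> x; rewrite /= integralT_ge0Zl; [|by meas|by rewrite lee_fin sqr_ge0|by nn].
  have [bx|/ub ->] := pselect (box x); last by rewrite expr0n mule0 mul0e.
  by rewrite muleC; apply: lee_wpmul2l; [rewrite lee_fin sqr_ge0|exact: far_mass].
apply: integralT_ge0_le; [by meas|by meas|by nn|] => p.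
rewrite -EFinM lee_fin mulrA ler_wpM2r ?gauss_ge0// indicE.
have [fp|fp] := pselect (far p.2); last by rewrite memNset// mulr0 sqr_ge0.
by rewrite mem_set// mulr1 [u p.2]ub ?subr0// => bp; exact: (box_far bp fp).
Qed.

End escape.

(** * The subordination weight of a compact range of times *)

Section time_weight.
Context (R : realType) (s : R).
Hypothesis s01 : 0 < s < 1.
Local Notation leb := (@lebesgue_measure R).
Local Notation c := (s * 2 `^ (2 * s) / Gamma (1 - s) / 2).

Definition time_weight (T : R) : \bar R :=
  (\int[leb]_t (subordinator s t * \1_`[1%R, T] t)%:E)%E.

Let mi T : measurable_fun (setT : set (measurableTypeR R)) (\1_`[1%R, T] : R -> R).
Proof. by apply: measurable_indic; exact: measurable_itv. Qed.

Lemma measurable_subordinator_itv T : measurable_fun (setT : set (measurableTypeR R))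
  (fun t => (subordinator s t * \1_`[1%R, T] t)%:E).
Proof.
have ms := measurable_subordinator s; have mt := mi T.
by apply: measurable_fineE; apply: measurable_funM.
Qed.

Let integral_cst_itv (a T : R) : 0 <= a -> 1 <= T ->
  (\int[leb]_t (a * \1_`[1%R, T] t)%:E = (a * (T - 1))%:E)%E.
Proof.
move=> a0 T1.
have mI : measurable (`[1%R, T]%classic : set (measurableTypeR R)) by exact: measurable_itv.
transitivity (a%:E * \int[leb]_t (\1_`[1%R, T] t)%:E)%E.
  rewrite -integralT_ge0Zl//.
  by apply: measurable_fineE; exact: mi.
have E : leb `[1%R, T]%classic = (T - 1)%:E.
  rewrite lebesgue_measure_itv/= lte_fin.
  move: T1; rewrite le_eqVlt => /orP[/eqP <-|->]; last by rewrite -EFinB.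
  by rewrite ltxx subrr.
by rewrite EFinM -E (measure_indicE leb mI).
Qed.

Let subordinator_itv t : 1 <= t -> subordinator s t = c * t `^ (s - 1).
Proof.
by move=> t1; rewrite /subordinator indicE mem_set ?mul1r//= in_itv/= andbT (lt_le_trans _ t1).
Qed.

Let powR_nonincreasing (x y : R) : 1 <= x -> x <= y -> y `^ (s - 1) <= x `^ (s - 1).
Proof.
move: s01 => /andP[s0 s1] x1 xy; have x0 : 0 < x by exact: lt_le_trans x1.
have y0 : 0 < y by exact: lt_le_trans xy.
rewrite -opprB !powRN lef_pV2 ?posrE ?powR_gt0//.
by apply: ge0_ler_powR; rewrite ?nnegrE ?subr_ge0 ?(ltW s1) ?(ltW x0) ?(ltW y0).
Qed.

Lemma time_weight_ge T : 1 <= T ->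
  ((c * T `^ (s - 1) * (T - 1))%:E <= time_weight T)%E.
Proof.
move=> T1; have c0 := subordinator_const_gt0 s01.
rewrite -integral_cst_itv//; last by rewrite mulr_ge0 ?powR_ge0// ltW.
apply: integralT_ge0_le.
- by apply: measurable_fineE; apply: measurable_funM; [exact: measurable_cst|exact: mi].
- exact: measurable_subordinator_itv.
- by move=> t; rewrite lee_fin mulr_ge0// mulr_ge0 ?powR_ge0// (ltW c0).
move=> t; rewrite lee_fin indicE; have [|] := boolP (t \in _); rewrite ?mulr0// ?mulr1.
rewrite inE/= in_itv/= => /andP[t1 tT]; rewrite subordinator_itv// ler_pM2l//.
exact: powR_nonincreasing.
Qed.

Lemma time_weight_lty T : 1 <= T -> (time_weight T < +oo)%E.
Proof.
move=> T1; have c0 := subordinator_const_gt0 s01.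
apply: (@le_lt_trans _ _ (c * (T - 1))%:E); last by rewrite ltry.
rewrite -integral_cst_itv//; last by rewrite ltW.
apply: integralT_ge0_le.
- exact: measurable_subordinator_itv.
- by apply: measurable_fineE; apply: measurable_funM; [exact: measurable_cst|exact: mi].
- by move=> t; rewrite lee_fin mulr_ge0 ?subordinator_ge0.
move=> t; rewrite lee_fin indicE; have [|] := boolP (t \in _); rewrite ?mulr0// ?mulr1.
rewrite inE/= in_itv/= => /andP[t1 tT]; rewrite subordinator_itv// ger_pMr//.
by have := powR_nonincreasing (lexx 1) t1; rewrite powR1.
Qed.

Lemma time_weightE T : 1 < T -> exists2 w, 0 < w & time_weight T = w%:E.
Proof.
move=> T1; have [TW0 TWoo] := (time_weight_ge (ltW T1), time_weight_lty (ltW T1)).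
have p0 : (0 < (c * T `^ (s - 1) * (T - 1))%:E)%E.
  rewrite lte_fin mulr_gt0 ?subr_gt0// mulr_gt0 ?subordinator_const_gt0//.
  by rewrite powR_gt0// (lt_trans _ T1).
have TW := lt_le_trans p0 TW0.
exists (fine (time_weight T)); first by rewrite fine_gt0// TW.
by rewrite fineK// ge0_fin_numE// ltW.
Qed.

(** The density t^(s-1) is not integrable at infinity because s > 0. *)
Lemma time_weight_unbounded (a : R) : exists2 T, 1 < T & (a%:E <= time_weight T)%E.
Proof.
move: (s01) => /andP[s0 s1]; have c0 := subordinator_const_gt0 s01.
pose b := Num.max 0 (2 * a / c).
(* T >= 2 gives T - 1 >= T / 2, so the weight is at least c T^s / 2, and T^s >= b makes this at
   least a. The maximum with 0 in [b] keeps the base of the power nonnegative. *)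
pose T := Num.max 2 (b `^ s^-1).
have T2 : 2 <= T by rewrite le_max lexx.
have T1 : 1 < T by rewrite (lt_le_trans _ T2)// ltr1n.
have T0 : 0 < T by exact: lt_trans T1.
exists T => //; apply: le_trans (time_weight_ge (ltW T1)); rewrite lee_fin.
have bT : b <= T `^ s.
  have b0 : 0 <= b by rewrite le_max lexx.
  rewrite -[leLHS]powRr1// -(mulVf (lt0r_neq0 s0)) powRrM.
  by apply: ge0_ler_powR; rewrite ?nnegrE ?powR_ge0 ?(ltW s0) ?(ltW T0)// le_max lexx orbT.
have ab : 2 * a / c <= T `^ s by apply: le_trans bT; rewrite le_max lexx orbT.
have TE : T `^ s = T `^ (s - 1) * T.
  by rewrite powRB ?(gt_eqF T0) ?implybT// powRr1 ?(ltW T0)// mulfVK// lt0r_neq0.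
move: ab; rewrite ler_pdivrMr// TE.
have P0 : 0 < T `^ (s - 1) by rewrite powR_gt0.
have : T `^ (s - 1) * 2 <= T `^ (s - 1) * T by rewrite ler_pM2l.
move: (T `^ (s - 1)) P0 c0 => p p0; rewrite -/b; move: (s * 2 `^ _ / _ / _) => e c0 pT.
rewrite -subr_ge0 => ab.
rewrite -subr_ge0 -(@pmulr_rge0 _ 2)//.
rewrite (_ : 2 * _ = (p * T * e - 2 * a) + (p * T - p * 2) * e); last by ring.
nra.
Qed.

End time_weight.

(** * Lower bound through slices *)

Section lower_bound.
Context (R : realType) (n k : nat) (s : R) (U : set 'rV[R]_n).
Hypotheses (s01 : 0 < s < 1) (mU : measurable U).
Local Open Scope ereal_scope.
Local Notation leb := (@lebesgue_measure R).

(** The integral over y of the energies of the slices u(., y), by [energy_slicesE]. Writing it as an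
    integral in time allows comparing it with [energy] time by time. *)
Definition energy_slices (u : 'rV[R]_(n + k) -> R) : \bar R :=
  \int[leb]_t ((subordinator s t)%:E * heat_form_slices t u).

Lemma measurable_heat_form_slices (u : 'rV[R]_(n + k) -> R) : measurable_fun setT u ->
  measurable_fun (setT : set (measurableTypeR R)) (fun t => heat_form_slices t u).
Proof.
move=> mu0.
apply: (@measurable_integral_section _ _ _ _ R (mu k)
  (fun (t : measurableTypeR R) (y : 'rV[R]_k) => heat_form t (fun x : 'rV[R]_n => u (row_mx x y)))).
  apply: (@measurable_integral_section _ _ _ _ R (mm n)
    (fun (z : measurableTypeR R * 'rV[R]_k) (p : 'rV[R]_n * 'rV[R]_n) =>
     ((u (row_mx p.1 z.2) - u (row_mx p.2 z.2)) ^+ 2 * gauss z.1 (p.1 - p.2))%:E)).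
    by meas.
  by nn.
by move=> t y; exact: heat_form_ge0.
Qed.

Lemma energy_slicesE (u : 'rV[R]_(n + k) -> R) : measurable_fun setT u ->
  energy_slices u = \int[mu k]_y energy s (fun x : 'rV[R]_n => u (row_mx x y)).
Proof.
move=> mu0.
have m1 : measurable_fun setT (fun z : measurableTypeR R * 'rV[R]_k =>
    (subordinator s z.1)%:E * heat_form z.1 (fun x : 'rV[R]_n => u (row_mx x z.2))).
  apply: emeasurable_funM.
    by apply: measurable_fineE; apply: measurable_subordinatorT; meas.
  apply: (@measurable_integral_section _ _ _ _ R (mm n)
    (fun (z : measurableTypeR R * 'rV[R]_k) (p : 'rV[R]_n * 'rV[R]_n) =>
     ((u (row_mx p.1 z.2) - u (row_mx p.2 z.2)) ^+ 2 * gauss z.1 (p.1 - p.2))%:E)).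
    by meas.
  by nn.
have h0 t y : 0 <= (subordinator s t)%:E * heat_form t (fun x : 'rV[R]_n => u (row_mx x y)).
  by rewrite mule_ge0 ?heat_form_ge0// lee_fin subordinator_ge0.
transitivity (\int[leb]_t \int[mu k]_y
   ((subordinator s t)%:E * heat_form t (fun x : 'rV[R]_n => u (row_mx x y)))).
  apply: eq_integralT => t; rewrite -integralT_ge0Zl//.
  - exact: measurable_heat_form_slice.
  - by rewrite lee_fin subordinator_ge0.
  - by move=> y; exact: heat_form_ge0.
rewrite (integral_swap _ _ m1 h0); apply: eq_integralT => y.
by rewrite energy_subordination//; meas.
Qed.

End lower_bound.

Section lower_bound.
Context (R : realType) (n k : nat) (s : R) (U : set 'rV[R]_n) (V : set 'rV[R]_k).
Hypotheses (s01 : 0 < s < 1) (mU : measurable U).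
Hypothesis lamoo : (lambda s U < +oo)%E.
Local Open Scope ereal_scope.
Local Notation leb := (@lebesgue_measure R).

(** The bound by [lambda] is applied to each slice and integrated. Almost every slice has finite
    norm because the squared norms integrate to that of u; a slice of norm 0 is no competitor, but
    there the bound is trivial. *)
Lemma energy_slices_ge u : competitor (prod_rV U V) u ->
  lambda s U * l2sqr u <= energy_slices s u.
Proof.
move=> [mu0 u0 uU /andP[N0 Noo]].
pose v (y : 'rV[R]_k) := fun x : 'rV[R]_n => u (row_mx x y).
have mv y : measurable_fun setT (v y) by rewrite /v; meas.
have mN : measurable_fun setT (fun y => l2sqr (v y)).
  apply: (@measurable_integral_section _ _ _ _ R (mu n)
    (fun (y : 'rV[R]_k) (x : 'rV[R]_n) => (v y x ^+ 2)%:E)); first by rewrite /v; meas.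
  by nn.
have NE : l2sqr u = \int[mu k]_y l2sqr (v y).
  by rewrite /l2sqr integral_slices//; [meas|nn].
have l0 := lambda_ge0 U s01.
rewrite energy_slicesE// NE -integralT_ge0Zl//; last by move=> y; exact: l2sqr_ge0.
have mE : measurable_fun setT (fun y => energy s (v y)).
  have -> : (fun y => energy s (v y)) = (fun y => \int[leb]_t ((subordinator s t)%:E * heat_form t (v y))).
    by apply/funext => y; rewrite energy_subordination.
  apply: (@measurable_integral_section _ _ _ _ R leb
    (fun (y : 'rV[R]_k) (t : measurableTypeR R) => (subordinator s t)%:E * heat_form t (v y))).
    apply: emeasurable_funM.
      by apply: measurable_fineE; apply: measurable_subordinatorT; meas.
    apply: (@measurable_integral_section _ _ _ _ R (mm n)
      (fun (z : 'rV[R]_k * measurableTypeR R) (p : 'rV[R]_n * 'rV[R]_n) =>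
       ((u (row_mx p.1 z.1) - u (row_mx p.2 z.1)) ^+ 2 * gauss z.2 (p.1 - p.2))%:E)).
      by meas.
    by nn.
  by move=> y t; rewrite mule_ge0 ?heat_form_ge0// lee_fin subordinator_ge0.
have finN : {ae mu k, forall y, l2sqr (v y) < +oo}.
  have iN : (mu k).-integrable setT (fun y => l2sqr (v y)).
    apply/integrableP; split => //.
    under eq_integral do rewrite gee0_abs ?l2sqr_ge0//.
    by rewrite -NE.
  apply: filterS (integrable_ae measurableT iN) => y /(_ I).
  by rewrite ge0_fin_numE// l2sqr_ge0.
apply: ae_ge0_le_integral => //.
- by move=> y _; rewrite mule_ge0// l2sqr_ge0.
- exact: emeasurable_funM.
- by move=> y _; exact: energy_ge0.
apply: filterS finN => y Nyoo _.
have [Ny0|Ny0] := eqVneq (l2sqr (v y)) 0; first by rewrite Ny0 mule0 energy_ge0.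
apply: lambda_le_energy => //; split => //.
- by move=> x; exact: u0.
- by move=> x Ux; apply: uU => -[]; rewrite row_mxKl.
- by rewrite Nyoo lt0e Ny0 l2sqr_ge0.
Qed.

(** This is [heat_form_confined] on the whole space with kappa = 0; for t <= 0 the weight
    vanishes. *)
Lemma subordinated_slices_le (u : 'rV[R]_(n + k) -> R) t : measurable_fun setT u -> (forall z, 0 <= u z)%R ->
  l2sqr u < +oo ->
  (subordinator s t)%:E * heat_form_slices t u <= (subordinator s t)%:E * heat_form t u.
Proof.
move=> mu0 u0 Noo; have [t0|t0] := ltP 0%R t; last first.
  rewrite /subordinator indicE memNset ?mul0r ?mulr0 ?mul0e//=.
  by rewrite in_itv/= andbT; apply/negP; rewrite -leNgt.
apply: lee_wpmul2l; first by rewrite lee_fin subordinator_ge0.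
have escape0 y : [set: 'rV[R]_k] y ->
    \int[mu k]_y' (\1_[set: 'rV[R]_k] y' * gauss t (y - y'))%:E <= (1 - 0)%:E.
  move=> _; rewrite subr0 -(integral_gaussl y t0) le_eqVlt; apply/orP; left; apply/eqP.
  by apply: eq_integralT => y'; rewrite indicE in_setT mul1r.
have := @heat_form_confined R n k u mu0 u0 t setT 0%R t0 measurableT ler01
  (fun z nz => False_ind _ (nz I)) escape0 Noo.
by rewrite !mul0e !adde0.
Qed.

Lemma energy_slices_le u : competitor (prod_rV U V) u -> energy_slices s u <= energy s u.
Proof.
move=> [mu0 u0 uU /andP[N0 Noo]]; rewrite energy_subordination//.
apply: integralT_ge0_le.
- apply: emeasurable_funM; last exact: measurable_heat_form_slices.
  by apply: measurable_fineE; exact: measurable_subordinator.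
- exact: measurable_weighted_heat_form.
- by move=> t; rewrite mule_ge0 ?heat_form_slices_ge0// lee_fin subordinator_ge0.
- by move=> t; exact: subordinated_slices_le.
Qed.

(* The weight of [1, T] diverges with [T]; a weight of at least lambda + 1 makes
   the defect 2 kappa w |u|^2 absorb the factor 1 - kappa on the slice energies. *)
Lemma lower_bound_gap (M : R) : (0 < k)%N -> (0 < M)%R ->
  (forall y, V y -> `|y| <= M)%R ->
  exists2 delta : R, (0 < delta)%R & forall u, competitor (prod_rV U V) u ->
    (fine (lambda s U) + delta)%:E * l2sqr u <= energy s u.
Proof.
move=> k0 M0 VM.
have l0 := lambda_ge0 U s01.
have lE : lambda s U = (fine (lambda s U))%:E by rewrite fineK// ge0_fin_numE.
have {}l0 : (0 <= fine (lambda s U))%R by rewrite fine_ge0.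
have [T T1 wT] := time_weight_unbounded s01 (fine (lambda s U) + 1).
have [w w0 wE] := time_weightE s01 T1.
move: wT; rewrite wE lee_fin => wT.
pose kap := escape_rate k M T.
have kap0 : (0 < kap)%R := escape_rate_gt0 k M T.
have kap1 : (kap <= 1)%R by apply: escape_rate_le1 => //; exact: ltW.
exists kap => // u cu.
have h1 := energy_slices_ge cu; have h2 := energy_slices_le cu.
have [mu0 u0 uU /andP[N0 Noo]] := cu.
have mHS := measurable_heat_form_slices mu0.
have mS := measurable_subordinator s.
have mSE : measurable_fun (setT : set (measurableTypeR R)) (fun t => (subordinator s t)%:E).
  exact: measurable_fineE.
have mSX : measurable_fun (setT : set (measurableTypeR R)) (fun t => (subordinator s t)%:E * heat_form_slices t u).
  exact: emeasurable_funM.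
have mSI := @measurable_subordinator_itv R s T.
have s0 t : 0 <= (subordinator s t)%:E by rewrite lee_fin subordinator_ge0.
have SI0 t : 0 <= (subordinator s t * \1_`[1%R, T] t)%:E.
  by rewrite lee_fin mulr_ge0// subordinator_ge0.
have X0 t : 0 <= heat_form_slices t u by exact: heat_form_slices_ge0.
have J0 t : 0 <= heat_form t u by exact: heat_form_ge0.
have uK z : ~ box M (rsubmx z) -> u z = 0%R.
  move=> nb; apply: uU => -[_ Vz]; apply: nb => i.
  exact: le_trans (rV_coord_le _ i) (VM _ Vz).
(* The confined inequality is integrated with its defect for t in [1, T]; at other times the
   inequality without defect is used, and the nonnegative term in kap is added to its right side. *)
have key : energy_slices s u + kap%:E * ((l2sqr u + l2sqr u) * w%:E) <=
    energy s u + kap%:E * energy_slices s u.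
  rewrite energy_subordination// -wE /time_weight /energy_slices.
  have NN0 : 0 <= kap%:E * (l2sqr u + l2sqr u).
    by apply: mule_ge0; [rewrite lee_fin ltW|rewrite adde_ge0 ?l2sqr_ge0].
  rewrite muleA -(integralT_ge0Zl leb mSI NN0 SI0) -(integralT_ge0Zl leb mSX _ (fun t => mule_ge0 (s0 t) (X0 t))); last first.
    by rewrite lee_fin ltW.
  have mL : measurable_fun (setT : set (measurableTypeR R))
    (fun t => kap%:E * (l2sqr u + l2sqr u) * (subordinator s t * \1_`[1%R, T] t)%:E).
    exact: emeasurable_funM.
  have mJ := measurable_weighted_heat_form s mu0.
  have mR : measurable_fun (setT : set (measurableTypeR R))
    (fun t => kap%:E * ((subordinator s t)%:E * heat_form_slices t u)).
    exact: emeasurable_funM.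
  have kX0 t : 0 <= kap%:E * ((subordinator s t)%:E * heat_form_slices t u).
    by apply: mule_ge0; [rewrite lee_fin ltW|exact: mule_ge0].
  rewrite -[leLHS](integralT_ge0D leb mSX mL (fun t => mule_ge0 (s0 t) (X0 t)) (fun t => mule_ge0 NN0 (SI0 t))).
  rewrite -[leRHS](integralT_ge0D leb mJ mR (fun t => mule_ge0 (s0 t) (J0 t)) kX0).
  apply: integralT_ge0_le.
  - exact: emeasurable_funD.
  - exact: emeasurable_funD.
  - by move=> t; rewrite adde_ge0// mule_ge0.
  move=> t; rewrite indicE; have [|tT] := boolP (t \in _).
    rewrite inE/= in_itv/= => tT; rewrite mulr1.
    have t0 : (0 < t)%R by move: tT => /andP[t1 _]; exact: lt_le_trans t1.
    have := @heat_form_confined R n k u mu0 u0 t (box M) kap t0 (@measurable_box R k M)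
      kap1 uK (fun y => box_escape k0 M0 tT) Noo.
    move=> /(lee_wpmul2l (s0 t)).
    have kN0 : 0 <= kap%:E * (l2sqr u + l2sqr u) by exact: NN0.
    have kX : 0 <= kap%:E * heat_form_slices t u by apply: mule_ge0; [rewrite lee_fin ltW|].
    rewrite (ge0_muleDr _ (X0 t) kN0) (ge0_muleDr _ (J0 t) kX).
    by rewrite [(_ * (kap%:E * (_ + _)))]muleC [(_ * (kap%:E * heat_form_slices _ _))]muleCA.
  rewrite mulr0 mule0 adde0; apply: le_trans (subordinated_slices_le t mu0 u0 Noo) _.
  by rewrite leeDl.
move: h1 h2 key N0 Noo (energy_ge0 s01 u) (energy_ge0 s01 u); rewrite lE.
have : 0 <= energy_slices s u by apply: integralT_ge0 => t; exact: mule_ge0.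
move: (energy_slices s u) (l2sqr u) (fine _) l0 wT => X N lam l0 wT.
case: (energy s u) => [E| |]; [|by move=> *; rewrite leey|by []].
case: N => [N| |]//; case: X => [X| |]// X0' h1 h2 key' N0' _ E0' _.
have {}h1 : (lam * N <= X)%R by exact: h1.
have {}h2 : (X <= E)%R by exact: h2.
have {}key' : (X + kap * ((N + N) * w) <= E + kap * X)%R by exact: key'.
have {}N0' : (0 < N)%R by exact: N0'.
change ((lam + kap) * N <= E)%R.
(* Of the defect 2 kap N w, one copy of kap N w covers kap N (lam + 1), that is the loss caused by
   the factor 1 - kap plus the gain [kap]; the other copy is given away as [p3]. *)
have p1 : (0 <= (1 - kap) * (X - lam * N))%R by rewrite mulr_ge0// subr_ge0.
have p2 : (0 <= kap * N * (w - (lam + 1)))%R.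
  by rewrite !mulr_ge0 ?(ltW kap0) ?(ltW N0')// subr_ge0.
have p3 : (0 <= kap * N * w)%R by rewrite !mulr_ge0 ?(ltW kap0) ?(ltW N0') ?(ltW w0).
rewrite -subr_ge0.
rewrite (_ : _ - _ = (E + kap * X - (X + kap * ((N + N) * w))) + (1 - kap) * (X - lam * N) +
   kap * N * (w - (lam + 1)) + kap * N * w)%R; last by ring.
have p0 : (0 <= E + kap * X - (X + kap * ((N + N) * w)))%R by rewrite subr_ge0.
exact: (addr_ge0 (addr_ge0 (addr_ge0 p0 p1) p2) p3).
Qed.

End lower_bound.

(** * Upper bound through tensor products *)

Section upper_bound.
Context (R : realType) (n k : nat) (s : R) (U : set 'rV[R]_n) (V : set 'rV[R]_k) (M : R).
Hypotheses (s01 : 0 < s < 1) (mU : measurable U) (mV : measurable V).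
Hypotheses (n0 : (0 < n)%N) (k0 : (0 < k)%N) (M0 : 0 < M).
Hypotheses (UM : forall x, U x -> `|x| <= M) (VM : forall y, V y -> `|y| <= M).
Local Open Scope ereal_scope.
Local Notation leb := (@lebesgue_measure R).

Lemma competitor_tensor v w : competitor U v -> competitor V w ->
  competitor (prod_rV U V) (tensor v w) /\ l2sqr (tensor v w) = l2sqr v * l2sqr w.
Proof.
move=> [mv v0 vU /andP[A0 Aoo]] [mw w0 wV /andP[B0 Boo]].
have E : l2sqr (tensor v w) = l2sqr v * l2sqr w by exact: integral_tensor_sqr.
split => //; split.
- exact: measurable_tensor.
- by move=> z; rewrite mulr_ge0.
- move=> z /not_andP[Uz|Vz]; rewrite /tensor.
    by rewrite vU// mul0r.
  by rewrite [w _]wV// mulr0.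
- rewrite E; move: A0 Aoo B0 Boo; case: (l2sqr v) (l2sqr w) => [A| |] [B| |]//.
  by rewrite -EFinM !lte_fin => A0 _ B0 _; rewrite mulr_gt0 ?ltry.
Qed.

(** [heat_form_tensor] is integrated in time. Its extra term, the product of the heat forms of v and
    w, is bounded below on [1, 2] by applying [heat_form_ge] to each factor, so delta is the product
    of two escape rates and the weight of [1, 2]. The endpoint 2 is an arbitrary number above 1. *)
Lemma upper_bound_gap :
  exists2 delta : R, (0 < delta)%R & forall v w, competitor U v -> competitor V w ->
    energy s (tensor v w) + energy s (tensor v w) + delta%:E * (l2sqr v * l2sqr w) <=
    (l2sqr v + l2sqr v) * energy s w + (l2sqr w + l2sqr w) * energy s v.
Proof.
have T1 : (1 < (2 : R))%R by rewrite ltr1n.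
have [om om0 omE] := time_weightE s01 T1.
pose kn := escape_rate n M 2; pose kk := escape_rate k M 2.
have kn0 : (0 < kn)%R := escape_rate_gt0 n M 2.
have kk0 : (0 < kk)%R := escape_rate_gt0 k M 2.
exists (kn * kk * om)%R; first by rewrite !mulr_gt0.
move=> v w cv cw.
have [mv v0 vU /andP[A0 Aoo]] := cv; have [mw w0 wV /andP[B0 Boo]] := cw.
have [[mt _ _ _] _] := competitor_tensor cv cw.
have vb x : ~ box M x -> v x = 0%R.
  move=> nb; apply: vU => Ux; apply: nb => i; exact: le_trans (rV_coord_le _ i) (UM Ux).
have wb x : ~ box M x -> w x = 0%R.
  move=> nb; apply: wV => Vx; apply: nb => i; exact: le_trans (rV_coord_le _ i) (VM Vx).
rewrite (energy_subordination s01 mt) (energy_subordination s01 mv) (energy_subordination s01 mw).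
rewrite EFinM -omE /time_weight.
have hv t : (1 <= t <= 2)%R -> kn%:E * l2sqr v <= heat_form t v.
  by move=> tT; exact: heat_form_ge.
have hw t : (1 <= t <= 2)%R -> kk%:E * l2sqr w <= heat_form t w.
  by move=> tT; exact: heat_form_ge.
move: A0 Aoo B0 Boo (@heat_form_tensor R n k v w mv mw) hv hw.
rewrite -/(l2sqr v) -/(l2sqr w).
case: (l2sqr v) => [A| |]//; case: (l2sqr w) => [B| |]// A0 _ B0 _ ht hv hw.
have {}A0 : (0 < A)%R by exact: A0.
have {}B0 : (0 < B)%R by exact: B0.
have mWt := measurable_weighted_heat_form s mt.
have mWv := measurable_weighted_heat_form s mv.
have mWw := measurable_weighted_heat_form s mw.
have s0 t : 0 <= (subordinator s t)%:E by rewrite lee_fin subordinator_ge0.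
have W0 d (f : 'rV[R]_d -> R) t : 0 <= (subordinator s t)%:E * heat_form t f.
  by rewrite mule_ge0 ?heat_form_ge0.
have mSI := @measurable_subordinator_itv R s 2.
have SI0 t : 0 <= (subordinator s t * \1_`[1%R, 2%R] t)%:E.
  by rewrite lee_fin mulr_ge0// subordinator_ge0.
have AA0 : 0 <= A%:E + A%:E by rewrite adde_ge0 ?lee_fin ?(ltW A0).
have BB0 : 0 <= B%:E + B%:E by rewrite adde_ge0 ?lee_fin ?(ltW B0).
pose C : R := (kn * kk * (A * B))%R.
have C0 : 0 <= C%:E by rewrite lee_fin !mulr_ge0 ?ltW.
rewrite (_ : (kn * kk)%:E * _ * _ = C%:E * \int[leb]_t (subordinator s t * \1_`[1%R, 2%R] t)%:E); last first.
  by rewrite /C -EFinM muleAC -EFinM mulrA.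
rewrite -(integralT_ge0Zl leb mSI C0 SI0).
rewrite -(integralT_ge0Zl leb mWw AA0 (W0 _ _)) -(integralT_ge0Zl leb mWv BB0 (W0 _ _)).
have mTT := emeasurable_funD mWt mWt.
have TT0 t := adde_ge0 (W0 _ (tensor v w) t) (W0 _ (tensor v w) t).
have mCS : measurable_fun (setT : set (measurableTypeR R)) (fun t => C%:E * (subordinator s t * \1_`[1%R, 2%R] t)%:E).
  exact: emeasurable_funM.
have mAw : measurable_fun (setT : set (measurableTypeR R)) (fun t => (A%:E + A%:E) * ((subordinator s t)%:E * heat_form t w)).
  by apply: emeasurable_funM => //; exact: measurable_cst.
have mBv : measurable_fun (setT : set (measurableTypeR R)) (fun t => (B%:E + B%:E) * ((subordinator s t)%:E * heat_form t v)).
  by apply: emeasurable_funM => //; exact: measurable_cst.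
rewrite -(integralT_ge0D leb mWt mWt (W0 _ _) (W0 _ _)).
rewrite -[leLHS](integralT_ge0D leb mTT mCS TT0 (fun t => mule_ge0 C0 (SI0 t))).
rewrite -[leRHS](integralT_ge0D leb mAw mBv (fun t => mule_ge0 AA0 (W0 _ _ t)) (fun t => mule_ge0 BB0 (W0 _ _ t))).
apply: integralT_ge0_le.
- exact: emeasurable_funD.
- exact: emeasurable_funD.
- by move=> t; apply: adde_ge0; [exact: TT0|exact: mule_ge0].
move=> t; have [t0|t0] := ltP 0%R t; last first.
  have S0 : subordinator s t = 0%R.
    rewrite /subordinator indicE memNset ?mul0r ?mulr0//=.
    by rewrite in_itv/= andbT; apply/negP; rewrite -leNgt.
  by rewrite S0 !mul0e !mul0r !mule0 !adde0.
rewrite (muleCA _ _ (heat_form t w)) (muleCA _ _ (heat_form t v)).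
have JJ := heat_form_ge0 t (tensor v w); have Jv := heat_form_ge0 t v; have Jw := heat_form_ge0 t w.
rewrite -ge0_muleDr// -[leRHS]ge0_muleDr ?mule_ge0//.
have H := ht t t0 (ltry _) (ltry _).
(* The right side becomes twice the heat form of the tensor product plus the product of the two heat
   forms; only this product is left to be compared with the constant [C]. *)
rewrite [in leRHS](muleC (B%:E + B%:E)) -H.
rewrite [leRHS](ge0_muleDr _ (adde_ge0 JJ JJ) (mule_ge0 Jv Jw)); apply: leeD2l.
rewrite indicE; have [|_] := boolP (t \in _); last by rewrite mulr0 mule0 mule_ge0// mule_ge0.
rewrite inE/= in_itv/= => tT; rewrite mulr1 muleC; apply: lee_wpmul2l => //.
apply: (@le_trans _ _ ((kn%:E * A%:E) * (kk%:E * B%:E))).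
  by rewrite -!EFinM lee_fin /C le_eqVlt; apply/orP; left; apply/eqP; ring.
by apply: lee_pmul; [rewrite -EFinM lee_fin mulr_ge0// ltW|rewrite -EFinM lee_fin mulr_ge0// ltW|exact: hv|exact: hw].
Qed.

Lemma lambda_prod_lt : boundary_null U -> boundary_null V ->
  lambda s U < +oo -> lambda s V < +oo ->
  lambda s (prod_rV U V) < lambda s U + lambda s V.
Proof.
move=> nU nV; have lU0 := lambda_ge0 U s01; have lV0 := lambda_ge0 V s01.
have [delta d0 gap] := upper_bound_gap.
have := energy_lt_lambda s01 mU nU; have := energy_lt_lambda s01 mV nV.
move: lU0 lV0; case: (lambda s U) => [a| |]//; case: (lambda s V) => [b| |]// _ _ hV hU _ _.
(* Divided by twice the squared norm of the tensor product, the gap is delta / 2, while the two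
   near-minimizers lose only delta / 8 each. *)
have d8 : (0 < delta / 8)%R by rewrite divr_gt0.
have ae : a%:E < (a + delta / 8)%:E by rewrite lte_fin ltrDl.
have be : b%:E < (b + delta / 8)%:E by rewrite lte_fin ltrDl.
have [v [cv Ev]] := hU _ ae; have [w [cw Ew]] := hV _ be.
have [ct tE] := competitor_tensor cv cw.
have := @lambda_le_energy R _ s _ _ ct; rewrite tE.
have := gap v w cv cw.
have := energy_ge0 s01 (tensor v w); have := energy_ge0 s01 v; have := energy_ge0 s01 w.
have := lambda_ge0 (prod_rV U V) s01.
case: cv => _ _ _; case: cw => _ _ _; move: Ev Ew.
case: (l2sqr v) => [A| |]; rewrite ?ltxx ?andbF//; case: (l2sqr w) => [B| |]; rewrite ?ltxx ?andbF//.
case: (energy s v) => [Ev| |]//; case: (energy s w) => [Ew| |]//.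
move=> hv hw /andP[B0 _] /andP[A0 _].
have {}A0 : (0 < A)%R by exact: A0.
have {}B0 : (0 < B)%R by exact: B0.
have {}hv : (Ev <= (a + delta / 8) * A)%R by exact: hv.
have {}hw : (Ew <= (b + delta / 8) * B)%R by exact: hw.
case: (energy s (tensor v w)) => [E| |]//.
case: (lambda s (prod_rV U V)) => [l| |]//; last first.
  by move=> _ _ _ _ _; rewrite -EFinM mulyr gtr0_sg ?mulr_gt0// mul1e.
move=> _ _ _ _ h1 h2.
have {}h1 : (E + E + delta * (A * B) <= (A + A) * Ew + (B + B) * Ev)%R by exact: h1.
have {}h2 : (l * (A * B) <= E)%R by exact: h2.
rewrite -EFinD lte_fin.
have AB0 : (0 < A * B)%R by rewrite mulr_gt0.
rewrite -(ltr_pM2r AB0).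
have h3 : (A * Ew <= A * ((b + delta / 8) * B))%R by rewrite ler_pM2l.
have h4 : (B * Ev <= B * ((a + delta / 8) * A))%R by rewrite ler_pM2l.
have h5 : (0 < delta * (A * B))%R by rewrite mulr_gt0.
lra.
Qed.

End upper_bound.

Lemma mule_lty (R : realDomainType) (x y : \bar R) :
  (0 <= x -> x < +oo -> 0 <= y -> y < +oo -> x * y < +oo)%E.
Proof. by move=> x0 xoo y0 yoo; rewrite lte_mul_pinfty// ge0_fin_numE. Qed.

(** * Finiteness and scaling *)

Section tent.
Context (R : realType) (d : nat).
Local Open Scope ereal_scope.
Local Notation leb := (@lebesgue_measure R).

Lemma continuous_measurable_rV (f : 'rV[R]_d -> R) : continuous f ->
  measurable_fun setT f.
Proof.
move=> /continuousP cf.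
apply: (measurability _ (RGenOpens.measurableE R)) => _ [_ [a [b ->] <-]].
rewrite setTI; apply: open_measurable_rV; apply: cf; exact: interval_open.
Qed.

(* [q <= 2 / t * expR (t * q / 2)] trades half of the Gaussian exponent for a
   factor [1 / t]. *)
Lemma sqr_gauss_le t (z : 'rV[R]_d) : (0 < t)%R ->
  ((\sum_(i < d) z 0 i ^+ 2) * gauss t z <=
   2 / t * 2 `^ (d%:R / 2) * gauss (t / 2) z)%R.
Proof.
move=> t0; have t20 : (0 < t / 2)%R by rewrite divr_gt0.
rewrite !gaussE//; set q := (\sum_(i < d) _)%R.
have q0 : (0 <= q)%R by apply: sumr_ge0 => i _; exact: sqr_ge0.
have -> : (t `^ (d%:R / 2) = 2 `^ (d%:R / 2) * (t / 2) `^ (d%:R / 2))%R.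
  by rewrite -powRM ?(ltW t20)// mulrCA divff ?mulr1// pnatr_eq0.
have E : (expR (- (t * q)) = expR (- (t / 2 * q)) * expR (- (t / 2 * q)))%R.
  by rewrite -expRD; congr expR; field.
have : (t / 2 * q * expR (- (t / 2 * q)) <= 1)%R.
  rewrite expRN ler_pdivrMr ?expR_gt0// mul1r.
  by apply: le_trans (expR_ge1Dx _); rewrite lerDr.
rewrite E; move: (expR_gt0 (- (t / 2 * q))) => + h.
have h2 := powR_ge0 (2 : R) (d%:R / 2); have h3 := powR_ge0 (t / 2) (d%:R / 2).
have h4 := powR_ge0 (pi : R) (d%:R / 2).
move: h h2 h3 h4; move: (expR _) (2 `^ _)%R ((t/2) `^ _)%R (pi `^ _)%R => e p2 pt pp.
move=> h h2 h3 h4 e0.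
have -> : (q * (p2 * pt / pp * (e * e)) = 2 / t * (t / 2 * q * e) * (p2 * pt / pp * e))%R.
  by move: (pp^-1)%R => ip; field; rewrite gt_eqF.
have -> : (2 / t * p2 * (pt / pp * e) = 2 / t * 1 * (p2 * pt / pp * e))%R by ring.
apply: ler_wpM2r; first by rewrite !mulr_ge0 ?invr_ge0 ?(ltW e0).
by apply: ler_wpM2l => //; rewrite divr_ge0 ?(ltW t0).
Qed.

(** The squared difference is at most |x - y|^2, which [sqr_gauss_le] trades for a factor 1/t, and
    it vanishes unless x or y is in K. The remaining Gaussian has unit mass in the other variable,
    whence twice the measure of K. *)
Lemma heat_form_lipschitz_le t (u : 'rV[R]_d -> R) (K : set 'rV[R]_d) : (0 < t)%R ->
  measurable_fun setT u -> measurable K ->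
  (forall x y, `|u x - u y| <= `|x - y|)%R -> (forall x, ~ K x -> u x = 0%R) ->
  heat_form t u <= (2 / t * 2 `^ (d%:R / 2))%:E * (mu d K + mu d K).
Proof.
move=> t0 mu0 mK ulip uK; have t20 : (0 < t / 2)%R by rewrite divr_gt0.
pose c : R := (2 / t * 2 `^ (d%:R / 2))%R.
have c0 : (0 <= c)%R by rewrite mulr_ge0 ?powR_ge0// divr_ge0// ltW.
have mI := measurable_indic mK : measurable_fun setT (\1_K : 'rV[R]_d -> R).
have mE : measurable_fun setT (fun x : 'rV[R]_d => (\1_K x)%:E : \bar R) by meas.
have E0 (x : 'rV[R]_d) : 0 <= (\1_K x)%:E :> \bar R by rewrite lee_fin indicE.
have mF : measurable_fun setT (fun p : 'rV[R]_d * 'rV[R]_d =>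
  (\1_K p.1)%:E * (gauss (t / 2) (p.1 - p.2))%:E : \bar R) by meas.
have mS : measurable_fun setT (fun p : 'rV[R]_d * 'rV[R]_d =>
  (\1_K p.2)%:E * (gauss (t / 2) (p.1 - p.2))%:E : \bar R) by meas.
have F0 (x z : 'rV[R]_d) : 0 <= (\1_K x)%:E * (gauss (t / 2) z)%:E :> \bar R.
  by rewrite mule_ge0// lee_fin gauss_ge0.
have Ef := integral_gauss_fst t20 mE E0; have Es := integral_gauss_snd t20 mE E0.
rewrite (measure_indicE (mu d) mK) -{1}Ef -Es.
rewrite -(integralT_ge0D (mm d) mF mS (fun p => F0 p.1 _) (fun p => F0 p.2 _)).
have cE0 : 0 <= c%:E by rewrite lee_fin.
rewrite -(integralT_ge0Zl (mm d) (emeasurable_funD mF mS) cE0 (fun p => adde_ge0 (F0 p.1 _) (F0 p.2 _))).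
apply: integralT_ge0_le.
- by meas.
- by meas.
- by move=> p; nn.
move=> p; have := sqr_gauss_le (p.1 - p.2) t0; rewrite -/c => H.
have G0 := gauss_ge0 t (p.1 - p.2); have G20 := gauss_ge0 (t / 2) (p.1 - p.2).
suff h : ((u p.1 - u p.2) ^+ 2 * gauss t (p.1 - p.2) <=
  c * (\1_K p.1 * gauss (t / 2) (p.1 - p.2) + \1_K p.2 * gauss (t / 2) (p.1 - p.2)))%R.
  exact: h.
have [K1|nK1] := pselect (K p.1 \/ K p.2); last first.
  move/not_orP: nK1 => [n1 n2]; rewrite (uK _ n1) (uK _ n2) subrr expr0n/= mul0r.
  by rewrite mulr_ge0// addr_ge0// mulr_ge0// indicE.
apply: (@le_trans _ _ (c * gauss (t / 2) (p.1 - p.2))%R).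
  apply: le_trans H; apply: ler_wpM2r => //.
  apply: (@le_trans _ _ (`|p.1 - p.2| ^+ 2)%R).
    by rewrite -real_normK ?num_real// ler_sqr ?nnegrE.
  have q0 : (0 <= \sum_(i < d) (p.1 - p.2) 0 i ^+ 2)%R by apply: sumr_ge0 => i _; exact: sqr_ge0.
  rewrite -[leRHS]sqr_sqrtr// ler_sqr ?nnegrE ?sqrtr_ge0//.
  apply/rV_normP => [|j]; first exact: sqrtr_ge0.
  rewrite -sqrtr_sqr ler_wsqrtr// (bigD1 j)//= lerDl.
  by apply: sumr_ge0 => i _; exact: sqr_ge0.
apply: ler_wpM2l => //; rewrite -mulrDl ler_peMl// !indicE.
by case: K1 => /mem_set ->; rewrite ?lerDl ?lerDr.
Qed.

(** For t <= 1 the heat form is at most 2 |u|^2 and t^(s-1) is integrable at 0 since s > 0. For t >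
    1 it is O(1/t), and t^(s-2) is integrable at infinity since s < 1. The functions [f] and [g] are
    these two profiles. *)
Lemma energy_lipschitz_lty s (u : 'rV[R]_d -> R) (K : set 'rV[R]_d) : (0 < s < 1)%R ->
  measurable_fun setT u -> measurable K -> mu d K < +oo ->
  (forall x, 0 <= u x)%R -> l2sqr u < +oo ->
  (forall x y, `|u x - u y| <= `|x - y|)%R -> (forall x, ~ K x -> u x = 0%R) ->
  energy s u < +oo.
Proof.
move=> s01 mu0 mK Koo u0 Noo ulip uK; have /andP[s0 s1] := s01.
rewrite (energy_subordination s01 mu0).
have S0 := subordinator_const_gt0 s01.
set c := (s * 2 `^ (2 * s) / Gamma (1 - s) / 2)%R in S0.
pose f t : \bar R := (\1_`]0%R, 1%R] t * t `^ (s - 1))%:E.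
pose g t : \bar R := (\1_`[1%R, +oo[ t * t `^ (- (1 - s) - 1))%:E.
have f0 t : 0 <= f t by rewrite lee_fin mulr_ge0 ?powR_ge0// indicE.
have g0 t : 0 <= g t by rewrite lee_fin mulr_ge0 ?powR_ge0// indicE.
have mf : measurable_fun (setT : set (measurableTypeR R)) f.
  have mi : measurable_fun (setT : set (measurableTypeR R)) (\1_`]0%R, 1%R] : R -> R).
    exact: measurable_indic.
  by rewrite /f; meas.
have mg : measurable_fun (setT : set (measurableTypeR R)) g.
  have mi : measurable_fun (setT : set (measurableTypeR R)) (\1_`[1%R, +oo[ : R -> R).
    exact: measurable_indic.
  by rewrite /g; meas.
have If : \int[leb]_t f t < +oo.
  apply: le_lt_trans (ltry s^-1); apply: le_trans (integral_powR_itv0 s0).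
  rewrite [leRHS]integral_mkcond le_eqVlt; apply/orP; left; apply/eqP.
  by apply: eq_integralT => t; rewrite patchE /f indicE; case: ifP => _; rewrite ?mul1r ?mul0r.
have Ig : \int[leb]_t g t < +oo.
  have s10 : (0 < 1 - s)%R by rewrite subr_gt0.
  apply: le_lt_trans (ltry (1 - s)^-1); rewrite -(integral_powR_itvy s10).
  rewrite [leRHS]integral_mkcond le_eqVlt; apply/orP; left; apply/eqP.
  by apply: eq_integralT => t; rewrite patchE /g indicE; case: ifP => _; rewrite ?mul1r ?mul0r.
have N0 := l2sqr_ge0 u; have K0 : 0 <= mu d K by [].
pose a := c%:E * (l2sqr u + l2sqr u).
pose b := (c * (2 * 2 `^ (d%:R / 2)))%:E * (mu d K + mu d K).
have a0 : 0 <= a by apply: mule_ge0; [rewrite lee_fin ltW|exact: adde_ge0].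
have b0 : 0 <= b.
  apply: mule_ge0; last exact: adde_ge0.
  by rewrite lee_fin; apply: mulr_ge0; [exact: ltW|rewrite mulr_ge0// powR_ge0].
have aoo : a < +oo.
  apply: mule_lty; [by rewrite lee_fin ltW|exact: ltry|exact: adde_ge0|].
  exact: lte_add_pinfty.
have boo : b < +oo.
  apply: mule_lty; [|exact: ltry|exact: adde_ge0|exact: lte_add_pinfty].
  by rewrite lee_fin; apply: mulr_ge0; [exact: ltW|rewrite mulr_ge0// powR_ge0].
have maf : measurable_fun (setT : set (measurableTypeR R)) (fun t => a * f t).
  by apply: emeasurable_funM => //; exact: measurable_cst.
have mbg : measurable_fun (setT : set (measurableTypeR R)) (fun t => b * g t).
  by apply: emeasurable_funM => //; exact: measurable_cst.
apply: (@le_lt_trans _ _ (\int[leb]_t (a * f t + b * g t))); last first.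
  rewrite (integralT_ge0D leb maf mbg (fun t => mule_ge0 a0 (f0 t)) (fun t => mule_ge0 b0 (g0 t))).
  rewrite (integralT_ge0Zl leb mf a0 f0) (integralT_ge0Zl leb mg b0 g0).
  have fi : 0 <= \int[leb]_t f t by apply: integralT_ge0.
  have gi : 0 <= \int[leb]_t g t by apply: integralT_ge0.
  exact: lte_add_pinfty (mule_lty a0 aoo fi If) (mule_lty b0 boo gi Ig).
apply: integralT_ge0_le.
- exact: measurable_weighted_heat_form.
- exact: emeasurable_funD.
- by move=> t; rewrite mule_ge0 ?heat_form_ge0// lee_fin subordinator_ge0.
move=> t; have [t0|t0] := ltP 0%R t; last first.
  have -> : subordinator s t = 0%R.
    rewrite /subordinator indicE memNset ?mul0r ?mulr0//=.
    by rewrite in_itv/= andbT; apply/negP; rewrite -leNgt.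
  by rewrite mul0e adde_ge0// mule_ge0.
have SE : subordinator s t = (c * t `^ (s - 1))%R.
  by rewrite /subordinator indicE mem_set ?mul1r//= in_itv/= t0.
have ct0 : 0 <= (c * t `^ (s - 1))%:E by rewrite lee_fin mulr_ge0 ?powR_ge0 ?ltW.
rewrite SE; have [t1|t1] := leP t 1%R.
  apply: (@le_trans _ _ (a * f t)); last by rewrite leeDl// mule_ge0.
  rewrite /f indicE mem_set/= ?in_itv/= ?t0// mul1r /a muleAC -EFinM.
  apply: lee_wpmul2l => //.
  have := heat_formD t0 mu0 u0; rewrite -/(l2sqr u) => <-; rewrite leeDl// adde_ge0//;
    by apply: integral_ge0 => p _; nn.
apply: (@le_trans _ _ (b * g t)); last by rewrite leeDr// mule_ge0.
rewrite /g indicE mem_set/= ?in_itv/= ?(ltW t1)// mul1r.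
apply: le_trans (lee_wpmul2l ct0 (heat_form_lipschitz_le t0 mu0 mK ulip uK)) _.
rewrite /b muleAC muleA -!EFinM.
apply: lee_wpmul2r; first by rewrite adde_ge0.
have -> : (t `^ (- (1 - s) - 1) = t `^ (s - 1) / t)%R.
  rewrite (_ : - (1 - s) - 1 = s - 1 + - 1)%R; last by ring.
  by rewrite [LHS]powRD ?powR_inv1 ?(ltW t0)// (gt_eqF t0) implybT.
by rewrite lee_fin le_eqVlt; apply/orP; left; apply/eqP; ring.
Qed.

Lemma lambda_lty s (U : set 'rV[R]_d) : (0 < s < 1)%R -> open U -> U !=set0 ->
  lambda s U < +oo.
Proof.
move=> s01 oU [a Ua].
have [r r0 rU] : exists2 r : R, (0 < r)%R & forall x, (`|x - a| < r)%R -> U x.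
  have /nbhs_ballP[r /= r0 rU] := open_nbhs_nbhs (conj oU Ua).
  by exists r => // x xr; apply: rU; rewrite -ball_normE/= distrC.
(* A tent over a ball contained in [U], with slope 1 in the sup norm. *)
pose u (x : 'rV[R]_d) : R := Num.max 0%R (r - `|x - a|)%R.
pose K : set 'rV[R]_d := [set x | (`|x - a| <= r)%R].
have mN : measurable_fun setT (fun x : 'rV[R]_d => `|x - a|%R).
  apply: continuous_measurable_rV => x.
  apply: (@cvg_norm R _ _ (nbhs x) _ (fun y : 'rV[R]_d => y - a)%R (x - a)%R).
  by apply: (@cvgB R _ _ (nbhs x) _ id (cst a) x a); [exact: cvg_id|exact: cvg_cst].
have mu0 : measurable_fun setT u.
  by apply: measurable_maxr; [exact: measurable_cst|apply: measurable_funB => //; exact: measurable_cst].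
have u0 x : (0 <= u x)%R by rewrite le_max lexx.
have mK : measurable K.
  by rewrite -[K]setTI; apply: measurable_fun_le => //; exact: measurable_cst.
have uK x : ~ K x -> u x = 0%R.
  by move=> /negP; rewrite -ltNge => h; apply/max_idPl; rewrite subr_le0 ltW.
have uU x : ~ U x -> u x = 0%R.
  move=> Ux; apply/max_idPl; rewrite subr_le0 leNgt; apply/negP => /rU; exact: Ux.
have Koo : mu d K < +oo.
  apply: (finite_measure_bounded (b := (`|a| + r)%R)) => // x; rewrite /K/= => h.
  by rewrite -[x](subrK a) (le_trans (ler_normD _ _))// addrC lerD2l.
have mKr : measurable_fun setT (\1_K : 'rV[R]_d -> R) by exact: measurable_indic.
have Noo : l2sqr u < +oo.
  apply: (@le_lt_trans _ _ ((r ^+ 2)%:E * mu d K)); last first.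
    apply: mule_lty => //; [by rewrite lee_fin sqr_ge0|exact: ltry].
  have mE : measurable_fun setT (fun x : 'rV[R]_d => (\1_K x)%:E : \bar R) by meas.
  have E0 (x : 'rV[R]_d) : 0 <= (\1_K x)%:E :> \bar R by rewrite lee_fin indicE.
  have r2 : 0 <= (r ^+ 2)%:E by rewrite lee_fin sqr_ge0.
  rewrite (measure_indicE (mu d) mK) -(integralT_ge0Zl (mu d) mE r2 E0).
  apply: integralT_ge0_le.
  - by meas.
  - by meas.
  - by move=> x; rewrite lee_fin sqr_ge0.
  move=> x; rewrite -EFinM lee_fin indicE.
  have [xK|xK] := boolP (x \in K); last first.
    by rewrite uK ?expr0n ?mulr0//; apply/negP; move: xK; rewrite notin_setE => /negP.
  rewrite mulr1 ler_sqr ?nnegrE// ?(ltW r0)// ge_max (ltW r0)/= lerBlDr lerDl//.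
have ulip x y : (`|u x - u y| <= `|x - y|)%R.
  have : (`| `|x - a| - `|y - a| | <= `|x - y|)%R.
    by apply: le_trans (ler_dist_dist _ _) _; rewrite opprB addrA subrK.
  rewrite ler_norml => /andP[h2 h3]; rewrite /u /Num.max.
  by rewrite ler_norml; do 2!case: ltP => ?; lra.
have N0 : 0 < l2sqr u.
  rewrite lt_neqAle l2sqr_ge0 andbT eq_sym; apply/eqP => /(l2sqr_eq0 mu0)[N [mN0 N0 uN]].
  (* On this cube the tent is at least r / 2, so if it vanished almost everywhere the cube would be
     null, whereas its volume is r^d. *)
  pose A i : set (measurableTypeR R) := `[(a 0 i - r / 2)%R, (a 0 i + r / 2)%R]%classic.
  have mA i : measurable (A i) by exact: measurable_itv.
  have r20 : (0 < r / 2)%R by rewrite divr_gt0.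
  have := lebesgue_rV_box mA.
  have -> : mu d [set x : 'rV[R]_d | forall i, A i (x 0%R i)] = 0.
    apply/eqP; rewrite -measure_le0 -N0.
    apply: le_measure; rewrite ?inE//; first exact: measurable_box_rV.
    move=> x Ax; apply: uN => /= ux.
    have : (`|x - a| <= r / 2)%R.
      apply/rV_normP; first exact: ltW.
      move=> j; have := Ax j; rewrite /A/= in_itv/= !mxE => /andP[h1 h2].
      by rewrite ler_norml; apply/andP; split; lra.
    have : (r - `|x - a| <= u x)%R by rewrite le_max lexx orbT.
    rewrite ux; lra.
  have -> : \prod_(i < d) leb (A i) = (r ^+ d)%:E.
    rewrite (eq_bigr (fun=> r%:E)); last first.
      move=> i _; rewrite /A lebesgue_measure_itv/= lte_fin.
      rewrite ifT; last by lra.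
      by rewrite -EFinB; congr (_%:E); field.
    by rewrite big_const_ord; elim: (d) => //= m ->; rewrite exprS.
  by move=> [] /esym/eqP; rewrite gt_eqF// exprn_gt0.
have cu : competitor U u by split => //; rewrite N0.
have := @lambda_le_energy _ _ s _ _ cu.
have := energy_lipschitz_lty s01 mu0 mK Koo u0 Noo ulip uK.
move: N0 Noo (lambda_ge0 U s01); case: (l2sqr u) => [N| |]//.
case: (lambda s U) => [l| |]//; first by move=> *; exact: ltry.
move=> h _ _; have {}h : (0 < N)%R by exact: h.
by rewrite mulyr gtr0_sg// mul1e => /lt_le_trans h2 /h2; rewrite ltxx.
Qed.

End tent.

(** * Monotonicity and scaling of the Poincaré constant *)

Section comparison.
Context (R : realType) (d : nat) (s : R).
Hypothesis s01 : 0 < s < 1.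
Local Open Scope ereal_scope.

Lemma competitor_cancel (U : set 'rV[R]_d) u (x : \bar R) (c : R) : competitor U u ->
  x * l2sqr u <= c%:E * l2sqr u -> x <= c%:E.
Proof.
move=> [_ _ _]; case: (l2sqr u) => [N| |]; rewrite ?ltxx ?andbF//.
by move=> /andP[N0 _]; rewrite lee_pmul2r// ?fin_numE.
Qed.

Lemma lambda_le_competitor (U : set 'rV[R]_d) u (c : R) : competitor U u ->
  energy s u <= c%:E * l2sqr u -> lambda s U <= c%:E.
Proof.
move=> cu Eu; apply: (competitor_cancel cu); apply: le_trans Eu.
exact: lambda_le_energy.
Qed.

Lemma lambda_approx (U : set 'rV[R]_d) (e : R) : measurable U -> boundary_null U ->
  lambda s U < +oo -> (0 < e)%R ->
  exists2 u, competitor U u & energy s u <= (fine (lambda s U) + e)%:E * l2sqr u.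
Proof.
move=> mU nU Uoo e0.
have [|u [cu Eu]] := @energy_lt_lambda _ _ s _ s01 mU nU (fine (lambda s U) + e)%R; last by exists u.
rewrite -[ltLHS]fineK ?lte_fin ?ltrDl// ge0_fin_numE//; exact: lambda_ge0.
Qed.

Lemma lambda_anti (U V : set 'rV[R]_d) : measurable U -> boundary_null U ->
  U `<=` V -> lambda s V <= lambda s U.
Proof.
move=> mU nU UV; have [Uoo|] := ltP (lambda s U) +oo; last by rewrite leye_eq => /eqP ->; rewrite leey.
apply/lee_addgt0Pr => e e0; have [u [mu0 u0 uU N0] Eu] := lambda_approx mU nU Uoo e0.
have cu : competitor V u by split => // x xV; apply: uU; by move=> Ux; exact: xV (UV _ Ux).
rewrite -[X in X + _](@fineK _ (lambda s U)) ?ge0_fin_numE ?lambda_ge0// -EFinD.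
exact: lambda_le_competitor cu Eu.
Qed.

End comparison.

Section scaling.
Context (R : realType) (d : nat) (s : R).
Hypothesis s01 : 0 < s < 1.
Local Open Scope ereal_scope.

Lemma integral_leb2_scale (c : R) (f : 'rV[R]_d * 'rV[R]_d -> \bar R) : (0 < c)%R ->
  measurable_fun setT f -> (forall p, 0 <= f p) ->
  \int[mm d]_p f (c *: p.1, c *: p.2)%R = (c ^- d * c ^- d)%:E * \int[mm d]_p f p.
Proof.
move=> c0 mf f0; have ci0 : 0 <= (c ^- d)%:E by rewrite lee_fin invr_ge0 exprn_ge0 ?ltW.
have mfx (x : 'rV[R]_d) : measurable_fun setT (fun y : 'rV[R]_d => f (x, y)) by meas.
have mfc : measurable_fun setT
    (fun p : 'rV[R]_d * 'rV[R]_d => f (c *: p.1, c *: p.2)%R) by meas.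
pose G (x : 'rV[R]_d) := \int[mu d]_y f (x, y).
have G0 x : 0 <= G x by apply: integralT_ge0.
have mG : measurable_fun setT G.
  by apply: (@measurable_integral_section _ _ _ _ R (mu d)
    (fun (x y : 'rV[R]_d) => f (x, y))); [meas|].
rewrite (integral_leb2l mfc (fun p => f0 _)) (integral_leb2l mf f0) -/(G _).
transitivity (\int[mu d]_x ((c ^- d)%:E * G (c *: x)%R)).
  by apply: eq_integralT => x; exact: (@integral_rV_scale R d c (fun y => f (c *: x, y)%R) c0 (mfx _) (fun y => f0 _)).
have mGc : measurable_fun setT (fun x : 'rV[R]_d => G (c *: x)%R) by meas.
rewrite (integralT_ge0Zl (mu d) mGc ci0 (fun x => G0 _)).
by rewrite (integral_rV_scale c0 mG G0) muleA EFinM.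
Qed.

Lemma enormZ (c : R) (x : 'rV[R]_d) : (0 < c)%R -> enorm (c *: x) = (c * enorm x)%R.
Proof.
move=> c0; rewrite /enorm -{2}(gtr0_norm c0) -sqrtr_sqr -sqrtrM ?sqr_ge0//.
by congr Num.sqrt; rewrite mulr_sumr; apply: eq_bigr => i _; rewrite mxE exprMn.
Qed.

(** The homogeneity of the kernel contributes c^(d+2s), and the change of both variables c^(-2d). *)
Lemma energy_scale (c : R) (v : 'rV[R]_d -> R) : (0 < c)%R -> measurable_fun setT v ->
  energy s (fun x => v (c *: x)%R) = (c `^ (2 * s) * c ^- d)%:E * energy s v.
Proof.
move=> c0 mv; have cd0 : (c ^- d != 0)%R by rewrite invr_neq0// expf_neq0// gt_eqF.
pose K (p : 'rV[R]_d * 'rV[R]_d) : \bar R :=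
  ((v p.1 - v p.2) ^+ 2 / enorm (p.1 - p.2) `^ (d%:R + 2 * s))%:E.
have mK : measurable_fun setT K by exact: measurable_gagliardo.
have mc : measurable_fun setT
    (fun p : 'rV[R]_d * 'rV[R]_d => (c *: p.1, c *: p.2)%R) by meas.
have K0 p : 0 <= K p by rewrite lee_fin divr_ge0 ?sqr_ge0 ?powR_ge0.
have mKc : measurable_fun setT
    (fun p : 'rV[R]_d * 'rV[R]_d => K (c *: p.1, c *: p.2)%R).
  exact: measurableT_comp mK mc.
have cp0 : 0 <= (c `^ (d%:R + 2 * s))%:E by rewrite lee_fin powR_ge0.
rewrite /energy -/K [RHS]muleCA; congr (_ * _).
transitivity (\int[mm d]_p ((c `^ (d%:R + 2 * s))%:E * K (c *: p.1, c *: p.2)%R)).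
  apply: eq_integralT => p; rewrite /K/= -EFinM -scalerBr enormZ//.
  rewrite powRM ?(ltW c0) ?sqrtr_ge0// invfM [in RHS]mulrCA mulVKf//.
  by rewrite gt_eqF// powR_gt0.
have key (x : \bar R) : (c `^ (d%:R + 2 * s))%:E * ((c ^- d * c ^- d)%:E * x) =
    (c `^ (2 * s) * c ^- d)%:E * x.
  rewrite muleA -EFinM; congr (_%:E * _).
  rewrite powRD ?(gt_eqF c0) ?implybT// powR_mulrn ?(ltW c0)//.
  by field; rewrite expf_neq0// gt_eqF.
apply: etrans (key _); apply: etrans (integralT_ge0Zl (mm d) mKc cp0 (fun p => K0 _)) _.
by congr (_ * _); exact: integral_leb2_scale.
Qed.

(** Near-minimizers for V, rescaled by 1/l, compete on the dilate; their quotient is multiplied by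
    l^(-2s), so the initial error is taken larger by l^(2s). *)
Lemma lambda_dilation (l : R) (V : set 'rV[R]_d) : (0 < l)%R ->
  measurable V -> boundary_null V -> lambda s V < +oo ->
  lambda s (dilation l V) <= (fine (lambda s V) / l `^ (2 * s))%:E.
Proof.
move=> l0 mV nV Voo; pose c := (l^-1)%R; have c0 : (0 < c)%R by rewrite invr_gt0.
have cl : ((l `^ (2 * s))^-1 = c `^ (2 * s))%R.
  apply: (@mulfI _ (l `^ (2 * s))%R); first by rewrite gt_eqF// powR_gt0.
  rewrite -powRM ?(ltW l0) ?(ltW c0)// !mulfV ?powR1// gt_eqF// powR_gt0//.
rewrite cl; have cs0 : (0 < c `^ (2 * s))%R by rewrite powR_gt0.
apply/lee_addgt0Pr => e e0.
have e'0 : (0 < e / c `^ (2 * s))%R by rewrite divr_gt0.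
have [v cv Ev] := lambda_approx s01 mV nV Voo e'0.
have [mv v0 vV /andP[N0 Noo]] := cv.
have NE : l2sqr (fun x => v (c *: x)%R) = (c ^- d)%:E * l2sqr v.
  apply: (integral_rV_scale c0 (f := fun x => (v x ^+ 2)%:E)); first by meas.
  by move=> x; rewrite lee_fin sqr_ge0.
have cd0 : (0 < c ^- d)%R by rewrite invr_gt0 exprn_gt0.
have cw : competitor (dilation l V) (fun x => v (c *: x)%R).
  split.
  - by meas.
  - by [].
  - by move=> x; rewrite dilationE// => /vV.
  - rewrite NE mule_gt0//=; apply: mule_lty => //; [exact: ltW|exact: ltry|exact: ltW].
rewrite -EFinD; apply: (lambda_le_competitor cw); rewrite energy_scale// NE.
have c2 : 0 <= (c `^ (2 * s) * c ^- d)%:E by rewrite lee_fin mulr_ge0// ltW.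
apply: le_trans (lee_wpmul2l c2 Ev) _.
rewrite le_eqVlt; apply/orP; left; apply/eqP; rewrite !muleA -!EFinM.
by congr (_%:E * _); field; rewrite ?expf_neq0// gt_eqF.
Qed.

End scaling.

(** * Product domains and the theorem *)

Section product_domains.
Context (R : realType) (n k : nat) (s : R) (U : set 'rV[R]_n) (V : set 'rV[R]_k).
Hypotheses (s01 : 0 < s < 1) (mU : measurable U) (mV : measurable V).
Hypotheses (nU : boundary_null U) (nV : boundary_null V).
Hypothesis Uoo : (lambda s U < +oo)%E.
Local Open Scope ereal_scope.

(** The slice comparison without defect places no bound on V, so it also covers the infinite
    cylinder. *)
Lemma lambda_prod_ge : lambda s U <= lambda s (prod_rV U V).
Proof.
have [mP nP] := boundary_null_prod mU mV nU nV.
have [Poo|] := ltP (lambda s (prod_rV U V)) +oo; last by rewrite leye_eq => /eqP ->; rewrite leey.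
apply/lee_addgt0Pr => e e0; have [u cu Eu] := lambda_approx s01 mP nP Poo e0.
rewrite -[X in X + _](@fineK _ (lambda s (prod_rV U V))) ?ge0_fin_numE ?lambda_ge0// -EFinD.
apply: (competitor_cancel cu); apply: le_trans Eu.
apply: le_trans (energy_slices_le s01 cu); exact: (energy_slices_ge s01 cu).
Qed.

(** The gap of [lower_bound_gap] is the same for all competitors, so a near-minimizer within half of
    it already separates the two infima. *)
Lemma lambda_prod_gt (M : R) : (0 < k)%N -> (0 < M)%R -> (forall y, V y -> (`|y| <= M)%R) ->
  lambda s U < lambda s (prod_rV U V).
Proof.
move=> k0 M0 VM; have [mP nP] := boundary_null_prod mU mV nU nV.
have [Poo|] := ltP (lambda s (prod_rV U V)) +oo; last by rewrite leye_eq => /eqP ->.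
have [e e0 gap] := lower_bound_gap s01 Uoo k0 M0 VM.
have e20 : (0 < e / 2)%R by rewrite divr_gt0.
have [u cu Eu] := lambda_approx s01 mP nP Poo e20.
have := competitor_cancel cu (le_trans (gap u cu) Eu).
rewrite -[in X in _ -> X < _](fineK (x := lambda s U)) ?ge0_fin_numE ?lambda_ge0//.
rewrite -[in X in _ -> _ < X](fineK (x := lambda s (prod_rV U V))) ?ge0_fin_numE ?lambda_ge0//.
by rewrite lee_fin lte_fin => h; lra.
Qed.

End product_domains.

Section power_decay.
Context (R : realType) (a b : R).
Hypotheses (a0 : 0 < a) (b0 : 0 <= b).

Lemma near_div_powR_lt e : 0 < e -> exists2 l0, 0 < l0 & forall l, l0 <= l -> b / l `^ a < e.
Proof.
move=> e0; pose x := b / e + 1; have x0 : 0 < x by rewrite ltr_pwDr// divr_ge0// ltW.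
exists (x `^ a^-1); first by rewrite powR_gt0.
move=> l xl; have : x <= l `^ a.
  rewrite -[leLHS](powRr1 (ltW x0)) -(mulVf (lt0r_neq0 a0)) powRrM.
  by rewrite ge0_ler_powR ?nnegrE ?powR_ge0 ?(ltW a0)// (le_trans (powR_ge0 _ _) xl).
move=> xla; rewrite ltr_pdivrMr; last exact: lt_le_trans xla.
apply: (@lt_le_trans _ _ (e * x)); last by rewrite ler_pM2l.
by rewrite /x mulrDr mulrCA divff ?gt_eqF// !mulr1 ltrDl.
Qed.

End power_decay.

Theorem theorem1p1 (R : realType) (n k : nat) (s : R)
    (omega : set 'rV[R]_n) (B : set 'rV[R]_k) :
  (1 <= n)%N -> (1 <= k)%N -> 0 < s < 1 ->
  lipschitz_domain omega -> bounded_set omega ->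
  bounded_set B -> open B -> convex_set B -> B 0 ->
  [/\ lambda s (prod_rV omega [set: 'rV[R]_k]) = lambda s omega,
      forall l : R, 0 < l ->
        (lambda s omega < lambda s (prod_rV omega (dilation l B)))%E /\
        (lambda s (prod_rV omega (dilation l B)) <
           lambda s omega + lambda s B / (l `^ (2 * s))%:E)%E
    & lambda s (prod_rV omega (dilation l B)) @[l --> +oo%R] -->
        lambda s omega].
Proof.
move=> n1 k1 s01 Lo bo bB oB cB B0; have /andP[s0 s1] := s01.
have [oo _ no _] := Lo.
have mo := open_measurable_rV oo; have mB := open_measurable_rV oB.
have nullo := boundary_null_lipschitz Lo bo.
have nullB := boundary_null_convex bB oB cB B0.
have looo := lambda_lty s01 oo no.
have lBoo := lambda_lty s01 oB (ex_intro _ 0 B0).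
have [M1 M10 oM1] := bounded_setP bo; have [M2 M20 BM2] := bounded_setP bB.
have l0 := lambda_ge0 omega s01; have lB0 := lambda_ge0 B s01.
have boundD l y : 0 < l -> dilation l B y -> `|y| <= l * M2.
  by move=> lp [x Bx <-]; rewrite normrZ gtr0_norm// ler_pM2l//; exact: BM2.
have gt l : 0 < l -> (lambda s omega < lambda s (prod_rV omega (dilation l B)))%E.
  move=> lp; have [mD nD] := boundary_null_dilation lp mB nullB.
  apply: (@lambda_prod_gt _ _ _ _ _ _ s01 mo mD nullo nD looo (l * M2)) => //.
    by rewrite mulr_gt0.
  by move=> y; exact: boundD.
have lt l : 0 < l -> (lambda s (prod_rV omega (dilation l B)) <
    lambda s omega + (fine (lambda s B) / l `^ (2 * s))%:E)%E.
  move=> lp; have [mD nD] := boundary_null_dilation lp mB nullB.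
  have lD := lambda_dilation s01 lp mB nullB lBoo.
  have M0 : 0 < Num.max M1 (l * M2) by rewrite lt_max M10.
  apply: lt_le_trans (leeD2l _ lD).
  apply: (lambda_prod_lt (M := Num.max M1 (l * M2))) => //.
  - by move=> x /oM1 h; rewrite le_max h.
  - by move=> y /(boundD _ _ lp) h; rewrite le_max h orbT.
  - exact: le_lt_trans lD (ltry _).
have s2 : 0 < 2 * s by rewrite mulr_gt0.
have fB0 : 0 <= fine (lambda s B) by exact: fine_ge0.
have foE : lambda s omega = (fine (lambda s omega))%:E.
  by rewrite fineK// ge0_fin_numE.
have fBE : lambda s B = (fine (lambda s B))%:E by rewrite fineK// ge0_fin_numE.
split.
- apply/eqP; rewrite eq_le; apply/andP; split; last first.
    by apply: lambda_prod_ge => //; exact: boundary_null_setT.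
  (* The cylinder of length l lies in the infinite one, so its constant is an upper bound; l is
     taken so large that the extra term of the finite upper bound is below e. *)
  apply/lee_addgt0Pr => e e0.
  have [l lp h] := near_div_powR_lt s2 fB0 e0.
  have [mD nD] := boundary_null_dilation lp mB nullB.
  have [mP nP] := boundary_null_prod mo mD nullo nD.
  apply: le_trans (lambda_anti s01 mP nP _) _; first by move=> z [].
  apply: le_trans (ltW (lt l lp)) _; apply: leeD2l.
  by rewrite lee_fin ltW// h.
- move=> l lp; split; first exact: gt.
  rewrite inver gt_eqF ?powR_gt0// fBE -EFinM; exact: lt.
(* Convergence in [\bar R] to a finite limit means eventual finiteness plus convergence of the real
   parts; both come from the two strict bounds. *)
- rewrite [X in _ --> X]foE; apply/fine_cvgP; split.
    near=> l; rewrite ge0_fin_numE ?lambda_ge0//.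
    have lp : 0 < l by near: l; exact: nbhs_pinfty_gt.
    by apply: lt_trans (lt l lp) _; rewrite foE -EFinD ltry.
  apply/cvgrPdist_lt => e e0; have [l1 lp1 h] := near_div_powR_lt s2 fB0 e0.
  near=> l; have ll : l1 <= l by near: l; by apply: nbhs_pinfty_ge; rewrite num_real.
  have lp := lt_le_trans lp1 ll; have := gt l lp; have := lt l lp.
  have := h l ll; rewrite foE /=.
  case: (lambda s (prod_rV omega (dilation l B))) => [x| |]//= hl.
  move=> h1 h2.
  have {}h1 : x < fine (lambda s omega) + fine (lambda s B) / l `^ (2 * s) by exact: h1.
  have {}h2 : fine (lambda s omega) < x by exact: h2.
  by rewrite ltr_norml; apply/andP; split; lra.
Unshelve. all: by end_near.
Qed.
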